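(* Under the hypotheses of Lemma 6.5 — namely: (A) $\partial\Omega$ has a local parabolic support of order $\tau$ at every point, $0\le\tau<\infty$; (B) $R(\boldsymbol{p})\ge C_0|\boldsymbol{p}|^{-2k}$ for $|\boldsymbol{p}|\ge r_0$ ($k\ge0$, $C_0,r_0>0$); (C) $\mu(\Omega)<\int_{\mathbb{R}^d}R\,d\boldsymbol{p}$; (D) there are $C_1'>0$, $\lambda\ge0$ such that each $\boldsymbol{x}_0\in\partial\Omega$ has an open ball $U_\rho(\boldsymbol{x}_0)$ with $\mu(e\cap\Omega)\le C_1'(\sup_{\boldsymbol{x}\in e}\operatorname{dist}(\boldsymbol{x},\partial\Omega))^\lambda|e|$ for all Borel $e\subset U_\rho(\boldsymbol{x}_0)\cap\Omega$; with $K=\frac{d+\tau+1}{\tau+2}+\frac\lambda2$, $k\le K$ if $0\le k<1$ or $k\ge d/2$ and $k<K$ if $1\le k<d/2$; and $I$ an admissible mesh family — the classical Dirichlet problem has a unique generalised solution $u\in W^+(\Omega)\cap C(\overline\Omega)$, and for every $\delta>0$, $$\lim_{I\ni h\to0}\|u_h-u\|_{L^\infty(\overline{\Omega_\delta})}=0,$$ where $u_h$ is the solution of the finite element problem on $\mathcal T_h$.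
   Context: $\Omega\subset\mathbb{R}^d$ is a bounded open convex domain; $g\in C(\partial\Omega)$; $R:\mathbb{R}^d\to(0,\infty)$ locally integrable; $\mu$ a nonnegative Borel measure on $\Omega$; $W^+(U)$ the convex real-valued functions on open convex $U$; $\partial u(\boldsymbol{x})=\{\boldsymbol{p}:\ u(\boldsymbol{y})\ge u(\boldsymbol{x})+\boldsymbol{p}\cdot(\boldsymbol{y}-\boldsymbol{x})\ \forall\boldsymbol{y}\in U\}$, $\partial u(E)=\bigcup_{\boldsymbol{x}\in E}\partial u(\boldsymbol{x})$; $|e|$ Lebesgue measure; $\Omega_\delta=\{\boldsymbol{x}\in\Omega:\operatorname{dist}(\boldsymbol{x},\partial\Omega)>\delta\}$. Generalised solution of the classical Dirichlet problem: $u\in W^+(\Omega)\cap C(\overline\Omega)$ with $\int_{\partial u(e)}R\,d\boldsymbol{p}=\mu(e)$ for every Borel $e\subset\Omega$ and $u=g$ on $\partial\Omega$. Local parabolic support of order $\tau$ at $\boldsymbol{a}_0\in\partial\Omega$: in Cartesian coordinates with $\boldsymbol{a}_0=0$, supporting hyperplane $\{x^d=0\}$ and $x^d$ along the interior normal, $\partial\Omega$ near $\boldsymbol{a}_0$ is a graph $x^d=g_0(x^1,\dots,x^{d-1})$ over its projection $\Pi$, with $g_0\ge\eta(\boldsymbol{a}_0)(\sum_{i<d}|x^i|^2)^{(\tau+2)/2}$ on $\Pi$ for some $\eta(\boldsymbol{a}_0)>0$. Mesh: finite set $\mathcal T_h$ of closed $d$-simplices in $\overline\Omega$, pairwise meeting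 in common sub-simplices of dimension $\le d-1$, $h=\max\operatorname{diam}T$, $\Omega_h:=\operatorname{Int}(\bigcup T)$ convex, all vertices of $\mathcal T_h$ on $\partial\Omega_h$ lying on $\partial\Omega$; interior vertices $\boldsymbol{A}_i$ ($1\le i\le k_h$), vertices on $\partial\Omega_h$: $\boldsymbol{B}_j$. $H_h$: functions $v\in W^+(\Omega_h)\cap C(\overline{\Omega_h})$ with $v(\boldsymbol{x})=\inf\{t:(\boldsymbol{x},t)\in M_h(z)\}$, $M_h(z)$ the convex hull of $\{(\boldsymbol{A}_i,z_i)\}\cup\{(\boldsymbol{B}_j,g(\boldsymbol{B}_j))\}$, for some $z\in\mathbb{R}^{k_h}$. $\phi_{i,h}$: continuous, affine on each simplex, $\phi_{i,h}(\boldsymbol{A}_j)=\delta_{ij}$, $\phi_{i,h}(\boldsymbol{B}_j)=0$. Finite element problem: find $u_h\in H_h$ with $\int_{\partial u_h(\boldsymbol{A}_i)}R\,d\boldsymbol{p}=\int_{\Omega_h}\phi_{i,h}\,d\mu$ for all $i$ (sub-differential relative to $\Omega_h$); it has a unique solution. Admissible mesh family: $I\subset(0,1)$ with $0$ as unique accumulation point, a mesh $\mathcal T_h$ for each $h\in I$, and for every $\delta>0$ some $h_\delta>0$ with $\overline{\Omega_\delta}\subset\Omega_h$ for $h\in I$, $h<h_\delta$. *)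

(* Defs.v *)
From mathcomp Require Import all_boot all_order all_algebra.
From mathcomp Require Import all_classical all_reals all_analysis.
Import numFieldNormedType.Exports.
Set Implicit Arguments. Unset Strict Implicit. Unset Printing Implicit Defensive.
Import Order.TTheory GRing.Theory Num.Theory.
Local Open Scope classical_set_scope.
Local Open Scope ring_scope.

Section Defs.
Variable R : realType.
Variable m : nat.
Local Notation pt := 'rV[R]_m.

Definition borel_pt := g_sigma_algebraType (@open pt).
Definition borel (A : set pt) : Prop := @measurable _ borel_pt A.

Definition dotv (x y : pt) : R := \sum_(i < m) x 0 i * y 0 i.
Definition enorm (x : pt) : R := Num.sqrt (dotv x x).
Definition eball (c : pt) (r : R) : set pt := [set y | enorm (y - c) < r].
Definition dist_set (x : pt) (A : set pt) : R := inf [set enorm (x - y) | y in A].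
Definition diam_set (A : set pt) : R :=
  sup [set r | exists x y, [/\ A x, A y & r = enorm (x - y)]].
Definition bounded_set (A : set pt) : Prop := exists M : R, forall x, A x -> enorm x <= M.

Definition bnd (A : set pt) : set pt := closure A `\` A°.

Definition inner_set (A : set pt) (delta : R) : set pt :=
  [set x | A x /\ dist_set x (bnd A) > delta].

Definition convex_set (A : set pt) : Prop :=
  forall x y, A x -> A y -> forall t : R, 0 <= t <= 1 -> A ((1 - t) *: x + t *: y).

Definition convex_on (U : set pt) (f : pt -> R) : Prop :=
  forall x y, U x -> U y -> forall t : R, 0 <= t <= 1 ->
    f ((1 - t) *: x + t *: y) <= (1 - t) * f x + t * f y.

Definition subdiff (U : set pt) (u : pt -> R) (x : pt) : set pt :=
  [set p | forall y, U y -> u x + dotv p (y - x) <= u y].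
Definition subdiff_img (U : set pt) (u : pt -> R) (E : set pt) : set pt :=
  [set p | exists2 x, E x & subdiff U u x p].

Definition is_lebesgue (leb : {measure set borel_pt -> \bar R}) : Prop :=
  forall a b : pt, (forall i, a 0 i <= b 0 i) ->
    leb [set x : pt | forall i, a 0 i <= x 0 i <= b 0 i] =
    (\prod_(i < m) (b 0 i - a 0 i))%:E.

(* locally integrable (Lebesgue measurable: equals a Borel function off a null set) *)
Definition loc_integrable (leb : {measure set borel_pt -> \bar R}) (f : pt -> R) : Prop :=
  exists N : set pt, borel N /\ leb N = 0%E /\
  exists f' : borel_pt -> R, measurable_fun setT f' /\
    (forall p, ~ N p -> f p = f' p) /\
    (forall (c : pt) (r : R), (\int[leb]_(p in eball c r) (`|f' p|)%:E < +oo)%E).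

Definition gen_solution (leb mu : {measure set borel_pt -> \bar R})
  (Omega : set pt) (g Rf u : pt -> R) : Prop :=
  [/\ convex_on Omega u,
      {within closure Omega, continuous u},
      (forall e : set pt, borel e -> e `<=` Omega ->
          (\int[leb]_(p in subdiff_img Omega u e) (Rf p)%:E)%E = mu e)
    & (forall x, bnd Omega x -> u x = g x)].

Definition parabolic_support (Omega : set pt) (tau : R) (a0 : pt) : Prop :=
  exists (Q : 'M[R]_m) (r eta : R) (last : 'I_m),
    [/\ [/\ Q *m Q^T = 1%:M, 0 < r, 0 < eta & (m = last.+1)%N],
       (* supporting hyperplane {y_last = 0}, y_last along the interior normal *)
       (forall x, Omega x -> ((x - a0) *m Q) 0 last > 0),
       (* near a0 the boundary is a graph over its projection *)
       (forall x1 x2, bnd Omega x1 -> bnd Omega x2 -> eball a0 r x1 -> eball a0 r x2 ->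
          (forall i : 'I_m, (i < last)%N -> ((x1 - a0) *m Q) 0 i = ((x2 - a0) *m Q) 0 i) ->
          x1 = x2)
     & (forall x, bnd Omega x -> eball a0 r x ->
          ((x - a0) *m Q) 0 last >=
          eta * (Num.sqrt (\sum_(i < m | (i < last)%N) (((x - a0) *m Q) 0 i) ^+ 2))
                `^ (tau + 2))].

Definition accum (x : R) (I : set R) : Prop :=
  forall eps : R, 0 < eps -> exists y, [/\ I y, y <> x & `|y - x| < eps].

Definition simplex := 'I_m.+1 -> pt.

Definition simplex_set (T : simplex) : set pt :=
  [set x | exists l : 'I_m.+1 -> R, [/\ forall i, 0 <= l i, \sum_i l i = 1
                                     & x = \sum_i l i *: T i]].

Definition aff_indep (T : simplex) : Prop :=
  forall l : 'I_m.+1 -> R, \sum_i l i = 0 -> \sum_i l i *: T i = 0 -> forall i, l i = 0.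

Definition common_face (T T' : simplex) : set pt :=
  [set x | exists l : 'I_m.+1 -> R,
     [/\ forall i, 0 <= l i, forall i, ~ (exists j, T' j = T i) -> l i = 0,
         \sum_i l i = 1 & x = \sum_i l i *: T i]].

Record mesh := Mesh { msize : nat; msimp : 'I_msize -> simplex }.
Arguments msimp : clear implicits.

Definition mesh_dom (M : mesh) : set pt :=
  (\bigcup_(t in [set: 'I_(msize M)]) simplex_set (msimp M t))°.

Definition is_vertex (M : mesh) (x : pt) : Prop := exists t i, msimp M t i = x.

Definition is_mesh (Omega : set pt) (M : mesh) (h : R) : Prop :=
  [/\ forall t, aff_indep (msimp M t) /\ simplex_set (msimp M t) `<=` closure Omega,
      (forall t t', t <> t' ->
         simplex_set (msimp M t) `&` simplex_set (msimp M t') =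
           common_face (msimp M t) (msimp M t') /\
         ~ (forall i, exists j, msimp M t' j = msimp M t i)),
      (exists t, diam_set (simplex_set (msimp M t)) = h) /\
      (forall t, diam_set (simplex_set (msimp M t)) <= h),
      convex_set (mesh_dom M)
    & forall x, is_vertex M x -> bnd (mesh_dom M) x -> bnd Omega x].

Definition admissible (Omega : set pt) (I : set R) (Th : R -> mesh) : Prop :=
  [/\ forall h, I h -> 0 < h < 1,
      accum 0 I,
      forall x, x <> 0 -> ~ accum x I,
      forall h, I h -> is_mesh Omega (Th h) h
    & forall delta, 0 < delta -> exists hd, 0 < hd /\
        forall h, I h -> h < hd -> closure (inner_set Omega delta) `<=` mesh_dom (Th h)].

Definition in_Hh (M : mesh) (g v : pt -> R) : Prop :=
  [/\ convex_on (mesh_dom M) v,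
      {within closure (mesh_dom M), continuous v}
    & exists z : pt -> R,
      let w p := if `[< mesh_dom M p >] then z p else g p in
      forall x, closure (mesh_dom M) x ->
        v x = inf [set s | exists l : 'I_(msize M) * 'I_m.+1 -> R,
                  [/\ forall k, 0 <= l k, \sum_k l k = 1,
                      x = \sum_k l k *: msimp M k.1 k.2
                    & s = \sum_k l k * w (msimp M k.1 k.2)]]].

Definition hat_fn (M : mesh) (a : pt) (phi : pt -> R) : Prop :=
  [/\ {within closure (mesh_dom M), continuous phi},
      forall t, exists (c : pt) (b : R), forall x, simplex_set (msimp M t) x -> phi x = dotv c x + b,
      phi a = 1
    & forall x, is_vertex M x -> x <> a -> phi x = 0].

Definition fe_solution (leb mu : {measure set borel_pt -> \bar R}) (M : mesh)
  (g Rf v : pt -> R) : Prop :=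
  in_Hh M g v /\
  forall a, is_vertex M a -> mesh_dom M a ->
    forall phi, hat_fn M a phi ->
      (\int[leb]_(p in subdiff (mesh_dom M) v a) (Rf p)%:E)%E =
      (\int[mu]_(x in mesh_dom M) (phi x)%:E)%E.

End Defs.

(* Main.v *)
(** Let [nu] be the measure with density [Rf]. The mass of [u] on [e] is the [nu]-measure of the slopes [p] for which [u - p.x] attains its minimum over the closure of [Omega] in [e]; off a null set of slopes the minimiser is unique, so this is a measure in [e].

Uniqueness. Let [U], [V] be the Legendre transforms of two solutions [u], [v]. If [V p - U p > d], then the minimiser for [v] lies in the set where [u - v > d], and conversely the slopes that [u] realises there satisfy [V - U > d]. As both functions have the same mass on this set, almost every [p] with [V p > U p] has a common minimiser for [u] and [v], so [max U V] and [U] have a common subgradient almost everywhere and differ by a constant. An exposed boundary point makes the constant vanish; thus [V <= U], that is [u <= v].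

Boundary behaviour. Suppose that, as [h -> 0], the discrete solutions drop by [J > 0] below an affine lower barrier at a boundary point. Then dyadic boxes of steep slopes are realised at nodes in a cap of small height [c]. The lower bound on [Rf] bounds the weight of the boxes from below, the local parabolic support and the bound on [mu] near the boundary bound the mass of the cap from above, and the condition on [k] makes the two bounds incompatible as [c -> 0].

Convergence. The barriers and the Lipschitz bounds for convex functions make the discrete solutions equicontinuous, so along every set of mesh sizes accumulating at [0] some subsequence converges uniformly. The lower and upper limits of its slope sets show that the limit has mass [mu]; by uniqueness all limits agree. *)
From HB Require Import structures.
Require Import Defs.
From mathcomp Require Import all_boot all_order all_algebra.
From mathcomp Require Import all_classical all_reals all_analysis.
From mathcomp Require Import measurable_realfun lra ring.
Import numFieldNormedType.Exports.
Set Implicit Arguments. Unset Strict Implicit. Unset Printing Implicit Defensive.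
Import Order.TTheory GRing.Theory Num.Theory.
Local Open Scope classical_set_scope.
Local Open Scope ring_scope.

(** * Euclidean structure and Borel sets *)

(** The set [subdiff_img U u e] is not known to be measurable, so an integral over it is a priori
    only a lower integral. For this reason everything is moved to the side of the slopes: a slope
    selects a minimiser of the tilted function, and away from a Borel null set this selection is
    unique and Borel. Mass becomes a push-forward of [nu], and only values of [nu] on Borel sets
    matter afterwards. Slopes with several minimisers, and hyperplanes, are null by one counting
    argument along parallel lines, without Fubini's theorem or differentiability almost everywhere.
    At the boundary the discrete equation sees only nodal masses, so a barrier cannot be compared
    pointwise. The drop [J] is taken as the infimum of the asymptotic drops: a bound with [J + th]
    then holds in a whole cap, while drops beyond [J - th] occur arbitrarily low in it. The two
    facts together trap the contact nodes of steep slopes in the cap. At the critical exponent the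
    two masses scale with the same power of [c], and only the sum over sufficiently many dyadic
    scales decides. *)

Lemma cvg_sumr (R : realType) (T I : Type) (F : set_system T) {FF : Filter F}
    (r : seq I) (P : pred I) (f : I -> T -> R) (l : I -> R) :
  (forall i, P i -> f i x @[x --> F] --> l i) ->
  \sum_(i <- r | P i) f i x @[x --> F] --> \sum_(i <- r | P i) l i.
Proof.
move=> fl; elim: r => [|i r IH].
  by rewrite big_nil; under eq_cvg do rewrite big_nil; exact: cvg_cst.
rewrite big_cons; under eq_cvg do rewrite big_cons.
case: ifPn => Pi; last exact: IH.
by apply: cvgD => //; exact: fl.
Qed.

Section NormedContinuity.
Variables (R : realType) (V W : normedModType R).

Lemma continuous_epsdelta (f : V -> W) (x : V) :
  {for x, continuous f} <->
  forall e, 0 < e -> exists2 d, 0 < d & forall y, `|y - x| < d -> `|f y - f x| < e.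
Proof.
split=> [cf e e0|h].
  move/cvgrPdist_lt : cf => /(_ _ e0) /nbhs_ballP [d /= d0 h].
  by exists d => // y yd; rewrite distrC; apply: h; rewrite -ball_normE /= distrC.
apply/cvgrPdist_lt => e /h [d d0 {}h]; apply/nbhs_ballP; exists d => //= y.
by rewrite -ball_normE /= distrC => /h; rewrite distrC.
Qed.

Lemma continuous_within_epsdelta (A : set V) (f : V -> W) :
  {within A, continuous f} <->
  forall x, A x -> forall e, 0 < e ->
    exists2 d, 0 < d & forall y, A y -> `|y - x| < d -> `|f y - f x| < e.
Proof.
rewrite continuous_subspace_in; split=> [cf x Ax e e0|h x].
  have /cvgrPdist_lt /(_ _ e0) := cf x (mem_set Ax).
  rewrite /prop_near1 /nbhs /= -nbhs_subspace_in // => /nbhs_ballP [d /= d0 {}h].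
  exists d => // y Ay yd; rewrite distrC.
  by apply: h => //; rewrite -ball_normE /= distrC.
rewrite inE => Ax; apply/cvgrPdist_lt => e /(h _ Ax) [d d0 {}h].
rewrite /prop_near1 /nbhs /= -nbhs_subspace_in //; apply/nbhs_ballP; exists d => //= y.
by rewrite -ball_normE /= distrC => + Ay => /(h y Ay); rewrite distrC.
Qed.

Lemma translate_continuous (z : V) : continuous (fun x : V => x + z).
Proof. by move=> x; apply: cvgD; [exact: cvg_id|exact: cvg_cst]. Qed.

Lemma closure_epsP (A : set V) (x : V) :
  closure A x <-> forall e, 0 < e -> exists2 y, A y & `|y - x| < e.
Proof.
split=> [cA e e0|h B /nbhs_ballP [e /= e0 eB]].
  have [y [Ay]] := cA _ (nbhsx_ballx x e e0).
  by rewrite -ball_normE /= distrC; exists y.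
have [y Ay yx] := h e e0; exists y; split => //; apply: eB.
by rewrite -ball_normE /= distrC.
Qed.

Lemma interior_epsP (A : set V) (x : V) :
  A° x <-> exists2 e, 0 < e & forall y, `|y - x| < e -> A y.
Proof.
split=> [/nbhs_ballP [e /= e0 eA]|[e e0 h]].
  by exists e => // y yx; apply: eA; rewrite -ball_normE /= distrC.
by apply/nbhs_ballP; exists e => //= y; rewrite -ball_normE /= distrC; exact: h.
Qed.

Lemma open_epsP (A : set V) :
  open A <-> forall x, A x -> exists2 e, 0 < e & forall y, `|y - x| < e -> A y.
Proof.
split=> [oA x Ax|h]; first by apply/interior_epsP; exact: open_nbhs_nbhs.
by rewrite openE => x Ax; apply/interior_epsP; exact: h.
Qed.

End NormedContinuity.

Section Coordinates.
Variables (R : realType) (m : nat).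
Local Notation pt := 'rV[R]_m.
Implicit Types (x y z p q : pt) (t : R).

Lemma dotvC x y : dotv x y = dotv y x.
Proof. by apply: eq_bigr => i _; rewrite mulrC. Qed.

Lemma dotvDl x y z : dotv (x + y) z = dotv x z + dotv y z.
Proof. by rewrite -big_split; apply: eq_bigr => i _; rewrite mxE mulrDl. Qed.

Lemma dotvZl t x z : dotv (t *: x) z = t * dotv x z.
Proof. by rewrite mulr_sumr; apply: eq_bigr => i _; rewrite mxE mulrA. Qed.

Lemma dotvNl x z : dotv (- x) z = - dotv x z.
Proof. by rewrite -scaleN1r dotvZl mulN1r. Qed.

Lemma dotvDr x y z : dotv z (x + y) = dotv z x + dotv z y.
Proof. by rewrite dotvC dotvDl !(dotvC z). Qed.

Lemma dotvZr t x z : dotv z (t *: x) = t * dotv z x.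
Proof. by rewrite dotvC dotvZl (dotvC z). Qed.

Lemma dotvNr x z : dotv z (- x) = - dotv z x.
Proof. by rewrite dotvC dotvNl (dotvC z). Qed.

Definition dotvE := (dotvDl, dotvDr, dotvZl, dotvZr, dotvNl, dotvNr).

Lemma dotv0r x : dotv x 0 = 0.
Proof. by rewrite -(scale0r 0) dotvZr mul0r. Qed.

Lemma dotv_sumr (I : Type) (r : seq I) (P : pred I) (F : I -> pt) p :
  dotv p (\sum_(i <- r | P i) F i) = \sum_(i <- r | P i) dotv p (F i).
Proof.
by elim/big_rec2: _ => [|i a b _ <-]; rewrite ?dotv0r ?dotvDr.
Qed.

Lemma dotvv_ge0 x : 0 <= dotv x x.
Proof. by apply: sumr_ge0 => i _; rewrite -expr2 sqr_ge0. Qed.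

Lemma enorm_ge0 x : 0 <= enorm x.
Proof. exact: sqrtr_ge0. Qed.

Lemma sqr_enorm x : enorm x ^+ 2 = dotv x x.
Proof. by rewrite /enorm sqr_sqrtr // dotvv_ge0. Qed.

Lemma coord_le_norm x i : `|x 0 i| <= `|x|.
Proof.
rewrite [leRHS]/Num.Def.normr /= mx_normrE.
by apply: (le_trans _ (le_bigmax _ _ (0, i))).
Qed.

Lemma norm_le_coord x t : 0 <= t -> (forall i, `|x 0 i| <= t) -> `|x| <= t.
Proof.
move=> t0 h; rewrite [leLHS]/Num.Def.normr /= mx_normrE; apply/bigmax_leP; split => //.
by move=> [i j] _ /=; rewrite ord1.
Qed.

Lemma coord_le_enorm x i : `|x 0 i| <= enorm x.
Proof.
rewrite -(@ler_pXn2r _ 2) ?nnegrE ?enorm_ge0 // sqr_enorm -normrX ger0_norm ?sqr_ge0 //.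
rewrite /dotv (bigD1 i) //= -expr2 lerDl sumr_ge0 // => j _.
by rewrite -expr2 sqr_ge0.
Qed.

Lemma norm_le_enorm x : `|x| <= enorm x.
Proof. by apply: norm_le_coord; [exact: enorm_ge0|move=> i; exact: coord_le_enorm]. Qed.

Lemma dotv_le_norm x y : `|dotv x y| <= m%:R * `|x| * `|y|.
Proof.
apply: le_trans (ler_norm_sum _ _ _) _.
apply: (@le_trans _ _ (\sum_(i < m) (`|x| * `|y|))).
  by apply: ler_sum => i _; rewrite normrM ler_pM ?coord_le_norm.
by rewrite sumr_const card_ord -mulrA mulr_natl.
Qed.

Lemma dotv_continuous p : continuous (dotv p : pt -> R).
Proof.
move=> x; rewrite /dotv; apply: (cvg_sumr (F := nbhs x)) => i _.
by apply: cvgM; [exact: cvg_cst|exact: coord_continuous].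
Qed.

Lemma enorm_continuous : continuous (@enorm R m).
Proof.
move=> x; apply: (@continuous_comp pt R R (fun y => dotv y y) Num.sqrt).
  apply: (cvg_sumr (F := nbhs x)) => i _.
  by apply: cvgM; exact: coord_continuous.
exact: sqrt_continuous.
Qed.

Lemma eball_open (c : pt) r : open (eball c r).
Proof.
apply: (@open_comp _ _ (fun y => enorm (y - c)) [set t | t < r]); last exact: open_lt.
move=> y _; apply: (@continuous_comp pt pt R (fun y => y - c) (@enorm R m)).
  exact: translate_continuous.
exact: enorm_continuous.
Qed.

End Coordinates.

Lemma enorm_le_norm (R : realType) (n : nat) (x : 'rV[R]_n.+1) :
  enorm x <= n.+1%:R * `|x|.
Proof.
have h0 : 0 <= n.+1%:R * `|x| by rewrite mulr_ge0.
rewrite -(@ler_pXn2r _ 2) ?nnegrE ?enorm_ge0 // sqr_enorm.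
apply: le_trans (ler_norm _) _; apply: le_trans (dotv_le_norm _ _) _.
have n1 : 1 <= n.+1%:R :> R by rewrite ler1n.
have x0 : 0 <= `|x| by [].
by rewrite expr2 mulrA ler_wpM2r // ler_peMr // mulr_ge0 // (le_trans ler01).
Qed.

Section Borel.
Variables (R : realType) (n : nat).
Local Notation pt := 'rV[R]_n.+1.
Local Notation bt := (borel_pt R n.+1).

Lemma open_borel (A : set pt) : open A -> @measurable _ bt A.
Proof. by move=> oA; apply: sub_sigma_algebra. Qed.

Lemma closed_borel (A : set pt) : closed A -> @measurable _ bt A.
Proof.
move=> cA; rewrite -(setCK A); apply: measurableC; apply: open_borel.
exact: closed_openC.
Qed.

Lemma rV_compact_closed (A : set pt) : compact A -> closed A.
Proof. by move=> cA; apply: (compact_closed _ cA); exact: (@norm_hausdorff R pt). Qed.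

Lemma compact_borel (A : set pt) : compact A -> @measurable _ bt A.
Proof. by move=> cA; apply: closed_borel; exact: rV_compact_closed. Qed.

Lemma continuous_borel (f : pt -> pt) : continuous f ->
  measurable_fun [set: bt] (f : bt -> bt).
Proof.
move=> cf; apply: (@measurability _ _ bt bt setT f (@open pt)) => //.
move=> _ [B oB <-]; rewrite setTI; apply: open_borel.
by apply: open_comp => // x _; exact: cf.
Qed.

Lemma within_continuous_borel (K : set pt) (f : pt -> R) : closed K ->
  {within K, continuous f} -> measurable_fun (K : set bt) (f : bt -> R).
Proof.
move=> cK cf; apply: (measurability _ (measurable_realfun.RGenOpens.measurableE R)).
move=> _ [_ [a [b ->] <-]].
have [V oV VD] : exists2 V, open V & V `&` K = (f @^-1` `]a, b[) `&` K.
  apply/open_subspaceP; move/continuousP: cf; apply; exact: interval_open.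
rewrite setIC -VD; apply: measurableI; first exact: open_borel.
exact: closed_borel.
Qed.

End Borel.

(** * Lebesgue measure *)

Section Boxes.
Variables (R : realType) (n : nat).
Local Notation pt := 'rV[R]_n.+1.
Local Notation bt := (borel_pt R n.+1).

Definition cbox (a b : pt) : set pt := [set x : pt | forall i, a 0 i <= x 0 i <= b 0 i].

Lemma cboxI a b a' b' : cbox a b `&` cbox a' b' =
  cbox (\row_i Num.max (a 0 i) (a' 0 i)) (\row_i Num.min (b 0 i) (b' 0 i)).
Proof.
apply/seteqP; split => [x [h h'] i|x h].
  by rewrite !mxE ge_max le_min; move: (h i) (h' i) => /andP[-> ->] /andP[-> ->].
by split=> i; move: (h i); rewrite !mxE ge_max le_min => /andP[/andP[? ?] /andP[? ?]];
  apply/andP.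
Qed.

Lemma closed_cbox a b : closed (cbox a b).
Proof.
have -> : cbox a b = \bigcap_(i in [set: 'I_n.+1])
    ((fun x : pt => x 0 i) @^-1` [set t | a 0 i <= t] `&`
     (fun x : pt => x 0 i) @^-1` [set t | t <= b 0 i]).
  apply/seteqP; split => [x h i _ /=|x h i]; first by split; case/andP: (h i).
  by have [/= -> ->] := h i I.
apply: closed_bigI => i _; apply: closedI.
  by apply: closed_comp => [x _|]; [exact: coord_continuous|exact: closed_ge].
by apply: closed_comp => [x _|]; [exact: coord_continuous|exact: closed_le].
Qed.

Lemma cbox_borel a b : @measurable _ bt (cbox a b).
Proof. by apply: closed_borel; exact: closed_cbox. Qed.

Lemma cbox_ball (c : pt) (r : R) : 0 <= r ->
  cbox (c - const_mx r) (c + const_mx r) = [set x | `|x - c| <= r].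
Proof.
move=> r0; apply/seteqP; split => [x h|x h i] /=.
  apply: norm_le_coord => // i; rewrite !mxE ler_distl.
  by have := h i; rewrite !mxE.
have := le_trans (coord_le_norm (x - c) i) h.
by rewrite !mxE ler_distl.
Qed.

Definition boxes : set (set bt) := [set A | exists a b, A = cbox a b].

Let rcenter (q : 'rV[rat]_n.+1) : pt := map_mx ratr q.

Let rbox (qk : 'rV[rat]_n.+1 * nat) : set pt :=
  cbox (rcenter qk.1 - const_mx qk.2.+1%:R^-1) (rcenter qk.1 + const_mx qk.2.+1%:R^-1).

(** An open set is the union of the rational cubes that it contains, and these are countably many.
    Since boxes are also stable under intersection, measures can be identified on boxes alone. *)
Lemma borel_boxes : @measurable _ bt = <<s boxes >>.
Proof.
apply/seteqP; split; last first.
  by apply: smallest_sub;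
    [exact: sigma_algebra_measurable|move=> _ [a [b ->]]; exact: cbox_borel].
apply: smallest_sub; first exact: smallest_sigma_algebra.
move=> A oA.
have -> : A = \bigcup_(k in [set k | rbox k `<=` A]) rbox k.
  apply/seteqP; split => [x Ax|x [k kA xk]]; last exact: kA.
  have : nbhs x A by exact: open_nbhs_nbhs.
  move=> /nbhs_ballP [e /= e0 eA].
  have [k ke] : exists k, k.+1%:R^-1 < e / 2.
    have e20 : 0 < e / 2 by rewrite divr_gt0.
    by have [k _ /(_ k) h] := near_infty_natSinv_lt (PosNum e20); exists k; apply: h => /=.
  set d := k.+1%:R^-1 in ke.
  have d0 : 0 < d by rewrite invr_gt0.
  have /choice [q qP] : forall i, exists q : rat, x 0 i - d < ratr q < x 0 i + d.
    move=> i; have [|q] := @rat_in_itvoo R (x 0 i - d) (x 0 i + d); first lra.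
    by rewrite in_itv /= => ?; exists q.
  exists (\row_i q i, k) => /=; rewrite /rbox /= cbox_ball ?(ltW d0) //.
    move=> y /= yd; apply: eA; rewrite -ball_normE /= distrC.
    rewrite -(subrK (rcenter (\row_i q i)) y) -addrA.
    apply: le_lt_trans (ler_normD _ _) _.
    suff : `|rcenter (\row_i q i) - x| <= d by rewrite -/d in yd; lra.
    apply: norm_le_coord => [|i]; first exact: ltW.
    by rewrite !mxE ler_distl; move: (qP i); lra.
  apply: norm_le_coord => [|i]; first exact: ltW.
  by rewrite !mxE ler_distl; move: (qP i); rewrite -/d; lra.
rewrite bigcup_mkcond; set F := fun k => _.
suff h : forall k, @measurable _ (g_sigma_algebraType boxes) (F k).
  exact: (@countable_bigcupT_measurable _ (g_sigma_algebraType boxes) _ F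
    (countableP _) h).
move=> k; rewrite /F; case: ifPn => _; last exact: measurable0.
by apply: sub_sigma_algebra; eexists; eexists; reflexivity.
Qed.

End Boxes.

Section AdditiveFunctions.
Variables (R : realType).

(** Additivity and monotonicity pin [k * t] between consecutive integers, so [k * |f t - t * f 1|]
    stays below [f 1] for every [k]; the Archimedean property does the rest. *)
Lemma additive_linear (f : R -> R) :
  (forall s t, 0 <= s -> 0 <= t -> f (s + t) = f s + f t) ->
  (forall t, 0 <= t -> 0 <= f t) -> forall t, 0 <= t -> f t = t * f 1.
Proof.
move=> fD f0 t t0.
have fM k s : 0 <= s -> f (k%:R * s) = k%:R * f s.
  move=> s0; elim: k => [|k IH].
    by have := fD 0 0 (lexx _) (lexx _); rewrite !mul0r addr0; lra.
  by rewrite -addn1 natrD !mulrDl !mul1r fD ?mulr_ge0 // IH.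
have fmono s s' : 0 <= s -> s <= s' -> f s <= f s'.
  move=> s0 ss'; rewrite -(subrK s s') addrC fD ?subr_ge0 //.
  by rewrite lerDl f0 // subr_ge0.
have f1 : 0 <= f 1 by apply: f0.
have key k : k%:R * `|f t - t * f 1| <= f 1.
  have kt0 : 0 <= k%:R * t by rewrite mulr_ge0.
  have /andP[l1 l2] := truncn_itv kt0.
  set j := Num.truncn (k%:R * t) in l1 l2.
  have h1 := fmono _ _ (ler0n _ j) l1.
  have h2 := fmono _ _ kt0 (ltW l2).
  have e3 : f j%:R = j%:R * f 1 by rewrite -[in LHS](mulr1 j%:R) fM.
  have e4 : f j.+1%:R = j.+1%:R * f 1 by rewrite -[in LHS](mulr1 j.+1%:R) fM.
  rewrite fM // in h1 h2; rewrite e3 in h1; rewrite e4 in h2.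
  have h5 : j%:R * f 1 <= k%:R * t * f 1 by rewrite ler_wpM2r.
  have h6 : k%:R * t * f 1 <= j.+1%:R * f 1 by rewrite ler_wpM2r // ltW.
  rewrite -[X in X * _](ger0_norm (ler0n _ k)) -normrM mulrBr mulrA.
  have ej : j.+1%:R = j%:R + 1 :> R by rewrite -natr1.
  by rewrite ej in h2 h6; rewrite ler_norml; lra.
apply/eqP; rewrite -subr_eq0 -normr_eq0; apply/eqP/le_anti/andP; split => //.
rewrite leNgt; apply/negP => d0.
have := key (Num.truncn (f 1 / `|f t - t * f 1|)).+1.
rewrite leNgt => /negP; apply; rewrite -ltr_pdivrMr //.
by apply: truncnS_gt.
Qed.

End AdditiveFunctions.

(** * Translation-invariant measures on boxes *)

Section TranslationInvariant.
Variables (R : realType) (n : nat).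
Local Notation pt := 'rV[R]_n.+1.
Local Notation bt := (borel_pt R n.+1).

Lemma measure_preimage (m : {measure set bt -> \bar R}) (f : pt -> pt) : continuous f ->
  exists m' : {measure set bt -> \bar R}, forall A, m' A = m (f @^-1` A).
Proof.
move=> cf; have mf := continuous_borel cf.
by exists (measure_function_pushforward__canonical__measure_function_Measure m mf).
Qed.

(** Half-open in every coordinate, so that a box cut by a coordinate hyperplane is a disjoint union
    of two boxes of the same kind. *)
Definition hbox (z a : pt) : set pt :=
  [set x : pt | forall i, z 0 i <= x 0 i < z 0 i + a 0 i].

Lemma hbox_borel z a : @measurable _ bt (hbox z a).
Proof.
have -> : hbox z a = ~` (\bigcup_(i in [set: 'I_n.+1])
    (~` ((fun x : pt => x 0 i) @^-1` [set t | z 0 i <= t]) `|`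
     (fun x : pt => x 0 i) @^-1` [set t | z 0 i + a 0 i <= t])).
  apply/seteqP; split => [x h [i _ [|/=]]|x h i].
  - by apply; case/andP: (h i).
  - by case/andP: (h i) => _; rewrite ltNge => /negP.
  apply/andP; split.
    by apply: contrapT => c; apply: h; exists i => //; left.
  by rewrite ltNge; apply/negP => c; apply: h; exists i => //; right.
apply: measurableC.
apply: (@countable_bigcupT_measurable _ bt _ _ (countableP _)) => i.
apply: measurableU; first apply: measurableC.
  apply: closed_borel; apply: closed_comp => [x _|]; first exact: coord_continuous.
  exact: closed_ge.
apply: closed_borel; apply: closed_comp => [x _|]; first exact: coord_continuous.
exact: closed_ge.
Qed.

Lemma hbox_shift z w a : hbox (z - w) a = (fun x => x + w) @^-1` hbox z a.
Proof.
apply/seteqP; split => x h i; move: (h i); rewrite !mxE; lra.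
Qed.

Variable F : {measure set bt -> \bar R}.
Hypothesis Ftrans : forall z A, @measurable _ bt A -> F ((fun x : pt => x + z) @^-1` A) = F A.
Hypothesis Ffin : forall z a, (F (hbox z a) < +oo)%E.

Let setc (v : pt) i t : pt := \row_j if j == i then t else v 0 j.

Let G v i t := fine (F (hbox 0 (setc v i t))).

Let GE v i t : F (hbox 0 (setc v i t)) = (G v i t)%:E.
Proof. by rewrite fineK // ge0_fin_numE. Qed.

Let GD v i s t : 0 <= s -> 0 <= t -> G v i (s + t) = G v i s + G v i t.
Proof.
move=> s0 t0; apply: EFin_inj; rewrite EFinD -!GE.
have -> : hbox 0 (setc v i (s + t)) = hbox 0 (setc v i s) `|`
    (fun x => x + (- (s *: delta_mx 0 i))) @^-1` (hbox 0 (setc v i t)).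
  apply/seteqP; split => x /=.
    move=> h; have [xs|xs] := ltP (x 0 i) s; [left|right] => j; move: (h j);
    by rewrite !mxE; case: (eqVneq j i) => [->|_] /=; rewrite ?eqxx; lra.
  by move=> [h|h] j; move: (h j); rewrite !mxE; case: (eqVneq j i) => [->|_] /=; rewrite ?eqxx; lra.
rewrite measureU //=.
- by rewrite Ftrans //; exact: hbox_borel.
- exact: hbox_borel.
- by rewrite -hbox_shift; exact: hbox_borel.
- apply/seteqP; split => x //= [h1 h2]; move: (h1 i) (h2 i).
  by rewrite !mxE !eqxx /=; lra.
Qed.

Let GM v i t : 0 <= t -> G v i t = t * G v i 1.
Proof.
move=> t0; apply: (additive_linear (f := G v i)) => //; first exact: GD.
by move=> s s0; apply: fine_ge0.
Qed.

(** In each side length separately the measure is additive, hence linear. Changing the sides of the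
    unit cube one at a time, through the vectors [ak k], produces the product. *)
Lemma hbox_measure (z a : pt) : (forall i, 0 <= a 0 i) ->
  F (hbox z a) = (fine (F (hbox 0 (const_mx 1))) * \prod_i a 0 i)%:E.
Proof.
move=> a0.
have -> : F (hbox z a) = F (hbox 0 a).
  by rewrite -[in RHS](subrr z) hbox_shift Ftrans //; exact: hbox_borel.
pose ak k : pt := \row_j if (j < k)%N then a 0 j else 1.
suff key k : (k <= n.+1)%N -> F (hbox 0 (ak k)) =
    (fine (F (hbox 0 (const_mx 1))) * \prod_(i < n.+1 | (i < k)%N) a 0 i)%:E.
  have <- : ak n.+1 = a by apply/rowP => j; rewrite mxE ltn_ord.
  rewrite key //; congr (_ * _)%:E; apply: eq_big => i; first by rewrite ltn_ord.
  by move=> _; rewrite mxE ltn_ord.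
elim: k => [|k IH] kn.
  rewrite big_pred0 // mulr1 fineK ?ge0_fin_numE //.
  by congr (F (hbox 0 _)); apply/rowP => j; rewrite !mxE.
pose i : 'I_n.+1 := Ordinal kn.
have e1 : ak k.+1 = setc (ak k) i (a 0 i).
  apply/rowP => j; rewrite !mxE ltnS leq_eqVlt; case: (eqVneq j i) => [->|ji].
    by rewrite eqxx.
  by rewrite (_ : (j == k :> nat) = false) //; apply/negbTE.
have e2 : ak k = setc (ak k) i 1.
  by apply/rowP => j; rewrite !mxE; case: (eqVneq j i) => [->|ji] //=; rewrite ltnn.
rewrite e1 GE GM // ; congr (_%:E).
have <- : fine (F (hbox 0 (ak k))) = G (ak k) i 1 by rewrite {1}e2.
rewrite IH ?(ltnW kn) //= mulrCA; congr (_ * _).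
rewrite [RHS](bigD1 i) ?ltnSn //=; congr (_ * _); apply: eq_bigl => j.
by rewrite -val_eqE /= ltnS andbC -ltn_neqAle.
Qed.

End TranslationInvariant.

Section Lebesgue.
Variables (R : realType) (n : nat).
Local Notation pt := 'rV[R]_n.+1.
Local Notation bt := (borel_pt R n.+1).
Variable leb : {measure set bt -> \bar R}.
Hypothesis hleb : is_lebesgue leb.

Let leb_cbox_fin a b : (leb (cbox a b) < +oo)%E.
Proof.
have [ab|] := pselect (forall i, a 0 i <= b 0 i); first by rewrite hleb ?ltry.
move=> /existsNP [i ab]; rewrite (_ : cbox a b = set0) ?measure0 //.
apply/seteqP; split => // x /(_ i) /andP[h1 h2]; apply: ab; exact: le_trans h2.
Qed.

Lemma leb_bounded (A : set pt) (M : R) : @measurable _ bt A ->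
  (forall x, A x -> `|x| <= M) -> (leb A < +oo)%E.
Proof.
move=> mA AM; have [M0|M0] := ltP M 0.
  rewrite (_ : A = set0) ?measure0 //; apply/seteqP; split => // x /AM.
  by rewrite leNgt => /negP; apply; apply: lt_le_trans M0 _.
apply: le_lt_trans (leb_cbox_fin (0 - const_mx M) (0 + const_mx M)).
apply: le_measure; rewrite ?inE //; first exact: cbox_borel.
by rewrite cbox_ball // => x /AM /=; rewrite subr0.
Qed.

Lemma leb_translate (z : pt) (A : set pt) : @measurable _ bt A ->
  leb ((fun x => x + z) @^-1` A) = leb A.
Proof.
have cz : continuous (fun x : pt => x + z).
  exact: translate_continuous.
have [m mE] := measure_preimage leb cz; rewrite -mE.
have shift a b : (fun x => x + z) @^-1` cbox a b = cbox (a - z) (b - z).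
  by apply/seteqP; split => x h i; move: (h i); rewrite !mxE; lra.
pose g k : set bt := cbox (0 - const_mx k%:R) (0 + const_mx k%:R : pt).
apply: (@measure_unique _ _ _ (@boxes R n) g).
- exact: borel_boxes.
- by move=> _ _ [a [b ->]] [a' [b' ->]]; rewrite cboxI; eexists; eexists; reflexivity.
- by move=> k; eexists; eexists; reflexivity.
- rewrite -subTset => x _; exists (Num.truncn `|x|).+1 => //.
  by rewrite /g cbox_ball //= subr0 ltW // truncnS_gt.
- move=> _ [a [b ->]]; rewrite mE shift.
  (* [is_lebesgue] speaks only of boxes with ordered corners; the others are empty, and so are their
     translates. *)
  have [ab|] := pselect (forall i, a 0 i <= b 0 i).
    rewrite !hleb // => [|i]; last by rewrite !mxE lerB.
    by congr (_%:E); apply: eq_bigr => i _; rewrite !mxE; ring.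
  move=> /existsNP [i ab]; rewrite (_ : cbox a b = set0); last first.
    by apply/seteqP; split => // x /(_ i) /andP[h1 h2]; apply: ab; exact: le_trans h2.
  rewrite (_ : cbox _ _ = set0) //.
  apply/seteqP; split => // x /(_ i); rewrite !mxE => /andP[h1 h2]; apply: ab.
  by have := le_trans h1 h2; rewrite lerD2r.
- by move=> k; rewrite mE shift.
Qed.

Lemma leb_open_gt0 (O : set pt) : open O -> O !=set0 -> (0 < leb O)%E.
Proof.
move=> oO [x Ox].
have : nbhs x O by exact: open_nbhs_nbhs.
move=> /nbhs_ballP [e /= e0 eO].
have e20 : 0 < e / 2 by rewrite divr_gt0.
have le_ab i : (x - const_mx (e / 2)) 0 i <= (x + const_mx (e / 2)) 0 i.
  by rewrite !mxE; lra.
apply: (@lt_le_trans _ _ (leb (cbox (x - const_mx (e / 2)) (x + const_mx (e / 2))))).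
  rewrite hleb // lte_fin; apply: prodr_gt0 => i _; rewrite !mxE; lra.
apply: le_measure; rewrite ?inE; [exact: cbox_borel|exact: open_borel|].
rewrite cbox_ball ?(ltW e20) // => y /= h; apply: eO; rewrite -ball_normE /= distrC; lra.
Qed.

Lemma enorm_mulmx_orth (Q : 'M[R]_n.+1) (x : pt) : Q *m Q^T = 1%:M ->
  enorm (x *m Q) = enorm x.
Proof.
move=> QQ; rewrite /enorm; congr Num.sqrt.
have dE (y : pt) : dotv y y = (y *m y^T) 0 0.
  by rewrite mxE; apply: eq_bigr => i _; rewrite mxE.
by rewrite !dE trmx_mul mulmxA -(mulmxA x) QQ mulmx1.
Qed.

(* Only the positivity of [kappa] matters below, so invariance of Lebesgue measure under rotations is not needed. *)
Lemma leb_rotated_box (Q : 'M[R]_n.+1) : Q *m Q^T = 1%:M ->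
  exists2 kappa : R, 0 < kappa &
    forall z a : pt, (forall i, 0 <= a 0 i) ->
      leb [set x | hbox z a (x *m Q)] = (kappa * \prod_i a 0 i)%:E.
Proof.
move=> QQ; have QQ' : Q^T *m Q = 1%:M by apply: mulmx1C.
have cQ : continuous (fun x : pt => x *m Q).
  move=> x; apply/continuous_epsdelta => e e0; exists (e / n.+1%:R).
    by rewrite divr_gt0.
  move=> y yd; rewrite -mulmxBl; apply: le_lt_trans (norm_le_enorm _) _.
  rewrite enorm_mulmx_orth //; apply: le_lt_trans (enorm_le_norm _) _.
  by rewrite mulrC -ltr_pdivlMr.
have [F FE] := measure_preimage leb cQ.
have Ffin z a : (F (hbox z a) < +oo)%E.
  rewrite FE; apply: (@leb_bounded _ (n.+1%:R * (`|z| + `|a|))).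
    rewrite -[X in measurable X]setTI.
    by apply: (continuous_borel cQ) => //; exact: hbox_borel.
  move=> x h; apply: le_trans (norm_le_enorm _) _.
  rewrite -(enorm_mulmx_orth x QQ); apply: le_trans (enorm_le_norm _) _.
  rewrite ler_wpM2l //; apply: norm_le_coord => [|i]; first by rewrite addr_ge0.
  have := coord_le_norm z i; have := coord_le_norm a i; move: (h i).
  by rewrite !ler_norml => /andP[? ?] /andP[? ?] /andP[? ?]; apply/andP; split; lra.
have Ftrans z A : @measurable _ bt A -> F ((fun x : pt => x + z) @^-1` A) = F A.
  move=> mA; rewrite !FE -[RHS](leb_translate (z *m Q^T)).
    congr (leb _); apply/seteqP; split => x /=;
    by rewrite mulmxDl -mulmxA QQ' mulmx1.
  rewrite -[X in measurable X]setTI.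
  by apply: (continuous_borel cQ) => //; exact: hbox_borel.
exists (fine (F (hbox 0 (const_mx 1)))); last first.
  by move=> z a a0; rewrite -(hbox_measure Ftrans Ffin z a0) FE.
(* The unit box contains the open ball of radius 1/2 about its centre in the maximum norm, and the
   preimage of this ball under [Q] is open and non-empty. *)
apply: fine_gt0; rewrite Ffin andbT FE.
have : (0 < leb ((fun x : pt => x *m Q) @^-1` ball (const_mx 2^-1%R : pt) 2^-1%R))%E.
  apply: leb_open_gt0.
    by apply: open_comp => [x _|]; [exact: cQ|exact: ball_open].
  exists (const_mx 2^-1 *m Q^T) => /=.
  by rewrite -mulmxA QQ' mulmx1; apply: ballxx.
move=> /lt_le_trans; apply; apply: le_measure; rewrite ?inE.
- rewrite -[X in measurable X]setTI.
  by apply: (continuous_borel cQ) => //; apply: open_borel; exact: ball_open.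
- rewrite -[X in measurable X]setTI.
  by apply: (continuous_borel cQ) => //; exact: hbox_borel.
move=> x /=; rewrite -ball_normE /= => h i.
have := le_lt_trans (coord_le_norm (const_mx 2^-1 - x *m Q) i) h.
by rewrite !mxE ltr_norml add0r => /andP[? ?]; apply/andP; split; lra.
Qed.

(* Translates of [E] along [e] overlap at most [N] times, so arbitrarily many of them fit in a bounded region. *)
Lemma leb_null_lines (E : set pt) (e : pt) (M : R) (N : nat) :
  @measurable _ bt E -> (forall x, E x -> `|x| <= M) ->
  (forall p (s : seq R), uniq s -> (forall t, t \in s -> E (p + t *: e)) ->
     (size s <= N)%N) ->
  leb E = 0%E.
Proof.
move=> mE EM EN.
have M0 : E !=set0 -> 0 <= M by move=> [x /EM]; apply: le_trans.
have [E0|/set0P En] := eqVneq E set0; first by rewrite E0 measure0.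
pose M' := M + `|e|.
have M'0 : 0 <= M' by rewrite addr_ge0 // M0.
pose B := cbox (0 - const_mx M' : pt) (0 + const_mx M').
have mB : @measurable _ bt B by exact: cbox_borel.
have fB : (leb B < +oo)%E by exact: leb_cbox_fin.
have fE : (leb E < +oo)%E by exact: leb_bounded EM.
have key K : (K%:R%:E * leb E <= N%:R%:E * leb B)%E.
  pose t j : R := j%:R / K%:R.
  pose Ej j : set bt := (fun x => x + t j *: e) @^-1` E.
  have mEj j : measurable (Ej j).
    rewrite -[X in measurable X]setTI; apply: continuous_borel => //.
    exact: translate_continuous.
  have -> : (K%:R%:E * leb E)%E = (\sum_(j < K) \int[leb]_x (\1_(Ej j) x)%:E)%E.
    rewrite (eq_bigr (fun=> leb E)) => [|j _].
      by rewrite sumr_const card_ord mule_natl.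
    by rewrite integral_indic ?setIT // leb_translate.
  rewrite -ge0_integral_sum //; last first.
    by move=> j; apply/measurable_EFinP; exact: measurable_indic.
  have -> : (N%:R%:E * leb B)%E = (\int[leb]_x (N%:R * \1_B x)%:E)%E.
    under eq_integral do rewrite EFinM.
    rewrite ge0_integralZl //; first by rewrite integral_indic ?setIT.
    by apply/measurable_EFinP; exact: measurable_indic.
  apply: ge0_le_integral => //.
  - by move=> x _; apply: sume_ge0 => j _; rewrite lee_fin.
  - apply: emeasurable_sum => j; apply/measurable_EFinP; exact: measurable_indic.
  - by apply/measurable_EFinP; apply: measurable_funM => //; exact: measurable_indic.
  (* The sum counts the translates that contain [x]: at most [N] by [EN], and none if [x] is outside
     [B], since the shifts [t j] stay in [0, 1]. *)
  move=> x _; rewrite sumEFin lee_fin.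
  have -> : \sum_(j < K) \1_(Ej j) x = (count (fun j => x \in Ej j) (iota 0 K))%:R :> R.
    rewrite -sum1_count natr_sum [RHS]big_mkcond /= -(big_mkord xpredT (fun j => \1_(Ej j) x)).
    rewrite /index_iota subn0.
    by apply: eq_bigr => j _; rewrite indicE; case: (x \in _).
  have [K0|K0] := posnP K; first by rewrite K0 /= mulr_ge0 ?ler0n // indicE ler0n.
  have K0' : 0 < K%:R :> R by rewrite ltr0n.
  have [xB|xB] := boolP (x \in B); last first.
    rewrite indicE (negbTE xB) mulr0 -(@eq_in_count _ pred0) ?count_pred0 // => j.
    rewrite mem_iota /= add0n => jK; apply/esym/negbTE; apply: contra xB; rewrite !inE => Exj.
    rewrite /B cbox_ball //= subr0 -(addrK (t j *: e) x).
    apply: le_trans (ler_normB _ _) _; apply: lerD; first exact: EM.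
    rewrite normrZ ler_piMl // /t ger0_norm ?divr_ge0 //.
    by rewrite ler_pdivrMr // mul1r ler_nat ltnW.
  rewrite indicE xB mulr1 ler_nat -size_filter -(size_map t).
  apply: (EN x) => [|_ /mapP [j + ->]].
    rewrite map_inj_uniq ?filter_uniq ?iota_uniq // => i j /eqP.
    by rewrite /t -subr_eq0 -mulrBl mulf_eq0 invr_eq0 (gt_eqF K0') orbF subr_eq0 eqr_nat => /eqP.
  by rewrite mem_filter => /andP[/set_mem].
apply/eqP; rewrite eq_le measure_ge0 andbT.
have leE : leb E = (fine (leb E))%:E by rewrite fineK // ge0_fin_numE.
have leB : leb B = (fine (leb B))%:E by rewrite fineK // ge0_fin_numE.
rewrite leE lee_fin leNgt; apply/negP => c0.
set c := fine (leb E) in leE c0; set L := fine (leb B) in leB.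
have := key (Num.truncn (N%:R * L / c)).+1.
rewrite leE leB -!EFinM lee_fin leNgt => /negP; apply.
by rewrite -ltr_pdivrMr // truncnS_gt.
Qed.

End Lebesgue.

(** * The measure with density [Rf] *)

Section LowerIntegral.
Context d (T : measurableType d) (R : realType) (mu : {measure set T -> \bar R}).
Local Open Scope ereal_scope.
Import HBNNSimple.

(* No measurability of [f], [g], [D] or [D'] is assumed: [\int] is then the supremum over the simple functions below. *)
Lemma le_lower_integral (f g : T -> \bar R) (D D' N : set T) :
  (forall x, 0 <= f x) -> (forall x, 0 <= g x) -> measurable N -> mu N = 0 ->
  (forall x, ~ N x -> (f \_ D) x <= (g \_ D') x) ->
  \int[mu]_(x in D) f x <= \int[mu]_(x in D') g x.
Proof.
move=> f0 g0 mN N0 fg; rewrite !ge0_integralE //.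
apply: ge_ereal_sup => _ [h /= hf <-].
(* A simple function below [f] is cut off to 0 on [N]. This keeps its integral and puts it below
   [g]. *)
pose h' : {nnsfun T >-> R} := proj_nnsfun h (measurableC mN).
apply: (@le_trans _ _ (sintegral mu h')); last first.
  apply: ereal_sup_ubound; exists h' => //= x; rewrite mindicE.
  have [xN|xN] := boolP (x \in ~` N).
    by rewrite mulr1; apply: le_trans (hf x) (fg _ _); rewrite inE in xN.
  by rewrite mulr0; apply: erestrict_ge0.
have sE (k : {nnsfun T >-> R}) : sintegral mu k = \int[mu]_x (k x)%:E.
  by rewrite integral_nnsfun // patch_setT.
rewrite !sE (@ge0_ae_eq_integral _ _ _ mu setT (EFin \o h) (EFin \o h')) //.
- exact/measurable_EFinP.
- by apply/measurable_EFinP; apply: measurable_funP.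
- by move=> x _ /=; rewrite lee_fin; exact: fun_ge0.
- by move=> x _ /=; rewrite mindicE lee_fin mulr_ge0 //; exact: fun_ge0.
exists N; split => // x /= hx; apply: contrapT => xN; apply: hx => _ /=.
by rewrite mindicE mem_set // mulr1.
Qed.

Lemma eq_lower_integral (f g : T -> \bar R) (D D' N : set T) :
  (forall x, 0 <= f x) -> (forall x, 0 <= g x) -> measurable N -> mu N = 0 ->
  (forall x, ~ N x -> (f \_ D) x = (g \_ D') x) ->
  \int[mu]_(x in D) f x = \int[mu]_(x in D') g x.
Proof.
move=> f0 g0 mN N0 fg; apply/eqP; rewrite eq_le.
by rewrite !(@le_lower_integral _ _ _ _ N) // => x /fg ->.
Qed.

End LowerIntegral.

Section DensityMeasure.
Context d (T : measurableType d) (R : realType) (mu : {measure set T -> \bar R}).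
Variable f : T -> \bar R.
Hypothesis f0 : forall x, (0 <= f x)%E.
Hypothesis mf : measurable_fun setT f.

Definition density (A : set T) := (\int[mu]_(x in A) f x)%E.

Let density0 : density set0 = 0%E.
Proof. exact: integral_set0. Qed.

Let density_ge0 A : (0 <= density A)%E.
Proof. by apply: integral_ge0 => x _. Qed.

Let density_sigma_additive : semi_sigma_additive density.
Proof.
move=> F mF tF mUF; rewrite /density ge0_integral_bigcup //; last first.
  exact: measurable_funTS.
by apply: is_cvg_nneseries => i _ _; exact: integral_ge0.
Qed.

HB.instance Definition _ := isMeasure.Build _ _ _ density
  density0 density_ge0 density_sigma_additive.

Lemma densityE : exists m : {measure set T -> \bar R}, forall A, m A = density A.
Proof. by eexists. Qed.

End DensityMeasure.

Section Weight.
Variables (R : realType) (n : nat).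
Local Notation pt := 'rV[R]_n.+1.
Local Notation bt := (borel_pt R n.+1).
Variable leb : {measure set bt -> \bar R}.

(** The interface through which the later sections know the measure with density [Rf]. In
    [weight_integral] the set [D] may be non-measurable as long as it agrees with a Borel set off a
    null set; this is the situation of [subdiff_img]. *)
Record weight_of (Rf : pt -> R) (nu : {measure set bt -> \bar R}) : Prop := WeightOf {
  weight_integral : forall D D' N : set pt, @measurable _ bt D' ->
    @measurable _ bt N -> leb N = 0%E -> (forall p, ~ N p -> D p <-> D' p) ->
    (\int[leb]_(p in D) (Rf p)%:E)%E = nu D';
  weight_bounded : forall (A : set pt) M, @measurable _ bt A ->
    (forall x, A x -> `|x| <= M) -> (nu A < +oo)%E;
  weight_null : forall A : set pt, @measurable _ bt A -> leb A = 0%E -> nu A = 0%E;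
  weight_gt0 : forall A : set pt, @measurable _ bt A -> (0 < leb A)%E -> (0 < nu A)%E;
  weight_ge : forall (A : set pt) c, @measurable _ bt A -> 0 <= c ->
    (forall x, A x -> c <= Rf x) -> (c%:E * leb A <= nu A)%E }.

Lemma exists_weight (Rf : pt -> R) : (forall p, 0 < Rf p) -> loc_integrable leb Rf ->
  exists nu, weight_of Rf nu.
Proof.
move=> Rf0 [N [bN [N0 [f' [mf' [ff' intf']]]]]].
(* The absolute value makes the Borel representative nonnegative everywhere; off [N] it changes
   nothing, because [Rf] is positive. *)
pose F (p : bt) : \bar R := (`|f' p|)%:E.
have F0 p : (0 <= F p)%E by rewrite lee_fin.
have mF : measurable_fun setT F.
  by apply/measurable_EFinP; apply: measurableT_comp.
have [nu nuE] := densityE leb F0 mF.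
have RfF p : ~ N p -> (Rf p)%:E = F p.
  by move=> Np; rewrite /F -ff' // ger0_norm // ltW.
have nuI (D D' N' : set pt) : @measurable _ bt D' ->
    @measurable _ bt N' -> leb N' = 0%E -> (forall p, ~ N' p -> D p <-> D' p) ->
    (\int[leb]_(p in D) (Rf p)%:E)%E = nu D'.
  move=> mD' mN' N'0 DD'; rewrite nuE /density.
  apply: (@eq_lower_integral _ bt R leb (fun p => (Rf p)%:E) F D D' (N `|` N')).
  - by move=> x; rewrite lee_fin ltW.
  - by [].
  - exact: measurableU.
  - have U2 : (leb (N `|` N') <= leb N + leb N')%E by exact: measureU2.
    by apply/eqP; rewrite eq_le measure_ge0 andbT (le_trans U2) // N0 N'0 adde0.
  move=> x /not_orP [Nx N'x]; rewrite /patch.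
  have -> : (x \in D) = (x \in D') by apply/idP/idP; rewrite !inE => /DD'; apply.
  by case: ifP => // _; exact: RfF.
have nu_null (A : set pt) : @measurable _ bt A -> leb A = 0%E -> nu A = 0%E.
  by move=> mA A0; rewrite nuE; apply: null_set_integral => //; exact: measurable_funTS.
exists nu; split => //.
- move=> A M mA AM; apply: le_lt_trans (intf' 0 (n.+1%:R * `|M| + 1)).
  rewrite nuE; apply: ge0_subset_integral => //.
  - by apply: open_borel; exact: eball_open.
  - exact: measurable_funTS.
  move=> x /AM xM; rewrite /eball /= subr0; apply: le_lt_trans (enorm_le_norm _) _.
  have := ler_wpM2l (ler0n R n.+1) (le_trans xM (ler_norm M)); lra.
(* If [nu A = 0], the density vanishes almost everywhere on [A] minus [N]. There it equals the
   positive function [Rf], so this set is null. *)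
- move=> A mA A0; rewrite lt_neqAle measure_ge0 andbT; apply/eqP => /esym nuA.
  have : leb (A `\` N) = 0%E.
    apply/eqP; rewrite -measure_le0; apply/negP => /negP; rewrite -ltNge => pos.
    have mAN : @measurable _ bt (A `\` N) by exact: measurableD.
    have : (\int[leb]_(x in A `\` N) `|F x|)%E = 0%E.
      under eq_integral do rewrite gee0_abs //.
      apply/eqP; rewrite eq_le integral_ge0 // andbT -nuA nuE.
      by apply: ge0_subset_integral => //; exact: measurable_funTS.
    move=> /ae_eq_integral_abs -/(_ mAN (measurable_funTS mF)) [Z [mZ Z0 sub]].
    have : (leb (A `\` N) <= leb Z)%E.
      apply: le_measure; rewrite ?inE // => x [Ax Nx]; apply: sub => /=.
      move=> /(_ (conj Ax Nx)); rewrite -RfF // => -[] /eqP.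
      by rewrite gt_eqF.
    by rewrite Z0 leNgt pos.
  move=> AN; suff : (leb A <= 0)%E by rewrite leNgt A0.
  rewrite -(adde0 0%E) -{1}AN -N0.
  apply: le_trans (measureU2 _ _ _) => //; last exact: measurableD.
  by apply: le_measure; rewrite ?inE //; [apply: measurableU => //; exact: measurableD|move=> x Ax; have [|] := pselect (N x); [right|left]].
- move=> A c mA c0 cRf; rewrite nuE /density (@ge0_negligible_integral _ _ _ leb A N) //; last exact: measurable_funTS.
  have mAN : @measurable _ bt (A `\` N) by exact: measurableD.
  have -> : (c%:E * leb A = \int[leb]_(x in A `\` N) (cst c%:E) x)%E.
    rewrite integral_cst //; congr (_ * _)%E; rewrite -[in RHS](adde0 (leb _)) -[in RHS]N0.
    apply/eqP; rewrite eq_le; apply/andP; split.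
      apply: le_trans (measureU2 _ _ _) => //.
      by apply: le_measure; rewrite ?inE //; [apply: measurableU => //; exact: measurableD|move=> x Ax; have [|] := pselect (N x); [right|left]].
    by rewrite N0 adde0; apply: le_measure; rewrite ?inE // => x [].
  apply: ge0_le_integral => //.
    exact: measurable_funTS.
  by move=> x [Ax Nx]; rewrite -RfF // lee_fin cRf.
Qed.

End Weight.

(** * Convex functions *)

Section ConvexSets.
Variables (R : realType) (m : nat).
Local Notation pt := 'rV[R]_m.
Implicit Types (U : set pt) (x y z a b : pt) (f : pt -> R) (s t e : R).

(** The point is also the combination of some [x'] in [U] near [x] and a corrected [y]. Taking [x']
    within [e * t] keeps the correction below [e], the radius of a ball about [y] in [U]. *)
Lemma convex_closure_interior U x y t : open U -> Defs.convex_set U ->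
  closure U x -> U y -> 0 < t <= 1 -> U ((1 - t) *: x + t *: y).
Proof.
move=> oU cU cx Uy /andP[t0 t1].
have [e e0 eU] := (open_epsP U).1 oU y Uy.
have [x' Ux' x'x] := (closure_epsP U x).1 cx (e * t) (mulr_gt0 e0 t0).
have -> : (1 - t) *: x + t *: y = (1 - t) *: x' + t *: (y + ((1 - t) / t) *: (x - x')).
  rewrite scalerDr scalerA mulrC divfK ?gt_eqF // scalerBr.
  by rewrite addrCA addrC; congr (_ + _); rewrite addrC subrK.
apply: cU => //; last by rewrite (ltW t0).
apply: eU; rewrite addrAC subrr add0r normrZ distrC ger0_norm; last first.
  by rewrite divr_ge0 ?subr_ge0 // ltW.
rewrite mulrAC ltr_pdivrMr //; apply: le_lt_trans x'x.
by rewrite ler_piMl // gerBl ltW.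
Qed.

(** The segment from a point [y] of [U] to [x] can be prolonged slightly inside the closure, which
    places [x] strictly between a point of the closure and [y]. *)
Lemma interior_closure_convex U : open U -> Defs.convex_set U -> U !=set0 ->
  (closure U)° `<=` U.
Proof.
move=> oU cU [y Uy] x /interior_epsP [e e0 eU].
pose s := e / (2 * (`|x - y| + 1)).
have D0 : 0 < `|x - y| + 1 by rewrite ltr_wpDl.
have s0 : 0 < s by rewrite divr_gt0 // mulr_gt0.
have cz : closure U (x + s *: (x - y)).
  apply: eU; rewrite addrC addKr normrZ gtr0_norm // /s mulrAC ltr_pdivrMr ?mulr_gt0 //.
  rewrite ltr_pM2l //; have := normr_ge0 (x - y); lra.
have -> : x = (1 - s / (1 + s)) *: (x + s *: (x - y)) + (s / (1 + s)) *: y.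
  apply/rowP => i; rewrite !mxE; field; lra.
apply: convex_closure_interior => //; apply/andP; split.
  by rewrite divr_gt0 // addr_gt0.
by rewrite ler_pdivrMr ?addr_gt0 // mul1r; lra.
Qed.

Lemma convex_comb_dist x x' y y' t e : 0 <= t <= 1 -> `|x' - x| < e -> `|y' - y| < e ->
  `|((1 - t) *: x' + t *: y') - ((1 - t) *: x + t *: y)| < e.
Proof.
move=> /andP[t0 t1] hx hy.
have -> : ((1 - t) *: x' + t *: y') - ((1 - t) *: x + t *: y) =
    (1 - t) *: (x' - x) + t *: (y' - y).
  by rewrite !scalerBr opprD addrACA.
apply: le_lt_trans (ler_normD _ _) _; rewrite !normrZ !ger0_norm ?subr_ge0 //.
have [t00|t00] := eqVneq t 0; first by rewrite t00; lra.
have tp : 0 < t by rewrite lt_def t00.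
have : t * `|y' - y| < t * e by rewrite ltr_pM2l.
have : (1 - t) * `|x' - x| <= (1 - t) * e by rewrite ler_wpM2l ?subr_ge0 // ltW.
lra.
Qed.

Lemma convex_set_closure U : Defs.convex_set U -> Defs.convex_set (closure U).
Proof.
move=> cU x y cx cy t t01; apply/closure_epsP => e e0.
have [x' Ux' x'x] := (closure_epsP U x).1 cx e e0.
have [y' Uy' y'y] := (closure_epsP U y).1 cy e e0.
by exists ((1 - t) *: x' + t *: y'); [exact: cU|exact: convex_comb_dist].
Qed.

Lemma convex_on_closure U f : Defs.convex_set U -> convex_on U f ->
  {within closure U, continuous f} -> convex_on (closure U) f.
Proof.
move=> cU cf /continuous_within_epsdelta ctf x y cx cy t t01.
rewrite leNgt; apply/negP => lt_f.
set z := (1 - t) *: x + t *: y in lt_f.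
pose g := f z - ((1 - t) * f x + t * f y).
have g0 : 0 < g / 3 by rewrite divr_gt0 // subr_gt0.
have [dx dx0 hx] := ctf x cx _ g0.
have [dy dy0 hy] := ctf y cy _ g0.
have [dz dz0 hz] := ctf z (convex_set_closure cU cx cy t01) _ g0.
pose e := Num.min (Num.min dx dy) dz.
have e0 : 0 < e by rewrite !lt_min dx0 dy0 dz0.
have [x' Ux' x'x] := (closure_epsP U x).1 cx e e0.
have [y' Uy' y'y] := (closure_epsP U y).1 cy e e0.
have [ex [ey ez]] : e <= dx /\ e <= dy /\ e <= dz.
  by rewrite /e !ge_min !lexx !orbT.
have hx' := hx _ (subset_closure Ux') (lt_le_trans x'x ex).
have hy' := hy _ (subset_closure Uy') (lt_le_trans y'y ey).
have Uz' := cU _ _ Ux' Uy' _ t01.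
have hz' := hz _ (subset_closure Uz')
  (lt_le_trans (convex_comb_dist t01 x'x y'y) ez).
have := cf _ _ Ux' Uy' _ t01.
move: t01 hx' hy' hz' => /andP[t0 t1]; rewrite !ltr_norml.
move=> /andP[_ hx'] /andP[_ hy'] /andP[hz' _].
have : (1 - t) * (f x' - f x) <= (1 - t) * (g / 3) by rewrite ler_wpM2l ?subr_ge0 // ltW.
have : t * (f y' - f y) <= t * (g / 3) by rewrite ler_wpM2l // ltW.
rewrite /g in g0 hz' *; lra.
Qed.

(** Jensen's inequality. Dividing by the total weight, instead of assuming it to be 1, makes the
    statement inductive in the list, and points of weight 0 may lie outside [U]. *)
Lemma convex_sum (I : Type) (r : seq I) (l : I -> R) (x : I -> pt) U f :
  Defs.convex_set U -> convex_on U f -> (forall i, 0 <= l i) ->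
  (forall i, l i != 0 -> U (x i)) -> 0 < \sum_(i <- r) l i ->
  U ((\sum_(i <- r) l i)^-1 *: \sum_(i <- r) l i *: x i) /\
  f ((\sum_(i <- r) l i)^-1 *: \sum_(i <- r) l i *: x i) <=
    (\sum_(i <- r) l i)^-1 * \sum_(i <- r) l i * f (x i).
Proof.
move=> cU cf l0 Ux.
have Z (s : seq I) : \sum_(i <- s) l i = 0 ->
    \sum_(i <- s) l i *: x i = 0 /\ \sum_(i <- s) l i * f (x i) = 0.
  elim: s => [|i s IH]; rewrite ?big_nil // !big_cons => h.
  have s0 : 0 <= \sum_(i <- s) l i by apply: sumr_ge0.
  have li : l i = 0 by have := l0 i; lra.
  have /IH [-> ->] : \sum_(i <- s) l i = 0 by lra.
  by rewrite li scale0r mul0r !addr0.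
elim: r => [|i r IH]; first by rewrite big_nil ltxx.
rewrite !big_cons; have Zr := Z r; set S := \sum_(i <- r) l i in IH Zr *.
set X := \sum_(j <- r) l j *: x j in IH Zr *; set Y := \sum_(j <- r) l j * f (x j) in IH Zr *.
move=> SS; have S0 : 0 <= S by apply: sumr_ge0.
have [Se|Sn] := eqVneq S 0.
  have [-> ->] := Zr Se; rewrite Se !addr0 in SS *.
  rewrite scalerA mulVf ?gt_eqF // scale1r mulKf ?gt_eqF //; split => //.
  by apply: Ux; rewrite gt_eqF.
have Sp : 0 < S by rewrite lt_def Sn.
have [UX fX] := IH Sp.
have [lie|lin] := eqVneq (l i) 0.
  by rewrite lie !add0r scale0r mul0r !add0r.
have lip : 0 < l i by rewrite lt_def lin l0.
have Uxi := Ux i lin.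
pose t := S / (l i + S).
have t01 : 0 <= t <= 1 by rewrite divr_ge0 ?(ltW SS) // ler_pdivrMr // mul1r lerDr l0.
have e1 : 1 - t = l i / (l i + S).
  by rewrite /t -[1](@divff _ (l i + S)) ?gt_eqF // -mulrBl addrK.
have -> : (l i + S)^-1 *: (l i *: x i + X) = (1 - t) *: x i + t *: (S^-1 *: X).
  rewrite scalerDr scalerA e1 mulrC; congr (_ + _).
  by rewrite scalerA /t mulrAC divff ?mul1r // gt_eqF.
split; first exact: cU.
apply: le_trans (cf _ _ Uxi UX _ t01) _.
have -> : (l i + S)^-1 * (l i * f (x i) + Y) = (1 - t) * f (x i) + t * (S^-1 * Y).
  by rewrite e1 /t; field; rewrite !gt_eqF.
by rewrite lerD2l ler_wpM2l // (andP t01).1.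
Qed.

(** The supremum of the parameters whose point lies in [U] gives a limit of points of [U] that
    cannot be interior. *)
Lemma exists_boundary_segment U a b : U a -> ~ U° b ->
  exists2 t, 0 <= t <= 1 & bnd U ((1 - t) *: a + t *: b).
Proof.
move=> Ua Ub; pose z t := (1 - t) *: a + t *: b.
pose S := [set t | 0 <= t <= 1 /\ U (z t)].
have S0 : S 0 by split; [rewrite lexx ler01|rewrite /z subr0 scale1r scale0r addr0].
have Sub : ubound S 1 by move=> t [/andP[]].
have hS : has_sup S by split; [exists 0|exists 1].
have t0 : 0 <= sup S by apply: sup_upper_bound.
have t1 : sup S <= 1 by apply: ge_sup => //; exists 0.
have zD t s : z t - z s = (t - s) *: (b - a).
  by rewrite /z; apply/rowP => i; rewrite !mxE; ring.
pose D := `|b - a| + 1; have D0 : 0 < D by rewrite ltr_wpDl.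
have zlt t s e : `|t - s| < e / D -> `|z t - z s| < e.
  move=> h; rewrite zD normrZ; apply: (@le_lt_trans _ _ (`|t - s| * D)).
    by rewrite ler_wpM2l // lerDl.
  by rewrite -ltr_pdivlMr.
exists (sup S); first by rewrite t0.
split; first apply/closure_epsP => e e0.
  have [t St lt_t] := sup_adherent (divr_gt0 e0 D0) hS.
  exists (z t); first by case: St.
  apply: zlt; have := sup_upper_bound hS St; rewrite ltr_norml; move: D0; lra.
move=> /interior_epsP [e e0 eU].
have t_lt1 : sup S < 1.
  rewrite lt_neqAle t1 andbT; apply/negP => /eqP e1; apply: Ub.
  apply/interior_epsP; exists e => //.
  by move: eU; rewrite e1 subrr scale0r scale1r add0r.
pose t := Num.min (sup S + e / D / 2) 1.
have eD : 0 < e / D by rewrite divr_gt0.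
have tS : sup S < t by rewrite lt_min t_lt1 andbT; lra.
suff St : S t by have := sup_upper_bound hS St; rewrite leNgt tS.
split; first by rewrite (le_trans t0 (ltW tS)) ge_min lexx orbT.
apply: eU; apply: zlt; rewrite gtr0_norm ?subr_gt0 //.
have : t <= sup S + e / D / 2 by rewrite ge_min lexx.
lra.
Qed.

(** The segment from [y] to [z] is prolonged by [r] to a point [w], still in the larger ball.
    Convexity bounds the increment over [|z - y|] by its share of the increment up to [w], which is
    at most [2 * M]. *)
Lemma convex_lipschitz U f x r M : convex_on U f -> 0 < r ->
  (forall y, `|y - x| < 2 * r -> U y /\ `|f y| <= M) ->
  forall y z, `|y - x| < r -> `|z - x| < r -> `|f y - f z| <= 2 * M / r * `|y - z|.
Proof.
move=> cf r0 fM.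
suff key y z : `|y - x| < r -> `|z - x| < r -> f z - f y <= 2 * M / r * `|z - y|.
  move=> y z yx zx; rewrite ler_norml key // -lerN2 opprB opprK andbT.
  by rewrite distrC; exact: key.
move=> yx zx; have [->|yz] := eqVneq z y; first by rewrite !subrr normr0 mulr0.
have d0 : 0 < `|z - y| by rewrite normr_gt0 subr_eq0.
set d := `|z - y| in d0 *.
pose w := z + (r / d) *: (z - y).
have wx : `|w - x| < 2 * r.
  rewrite /w addrAC; apply: le_lt_trans (ler_normD _ _) _.
  by rewrite normrZ gtr0_norm ?divr_gt0 // -/d divfK ?gt_eqF //; lra.
have yx2 : `|y - x| < 2 * r by lra.
have [Uw fw] := fM _ wx; have [Uy fy] := fM _ yx2.
pose t := d / (d + r).
have t01 : 0 <= t <= 1.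
  by rewrite divr_ge0 ?ler_pdivrMr ?mul1r ?addr_gt0 ?addr_ge0 ?lerDl // ltW.
have zE : z = (1 - t) *: y + t *: w.
  apply/rowP => i; rewrite !mxE /t; field.
  by rewrite !gt_eqF ?addr_gt0.
have := cf _ _ Uy Uw _ t01; rewrite -zE => fz.
have M0 : 0 <= M by apply: le_trans fy.
have : f z - f y <= t * (2 * M).
  apply: (@le_trans _ _ (t * (f w - f y))); first lra.
  rewrite ler_wpM2l ?(andP t01).1 //.
  by move: fw fy; rewrite !ler_norml => /andP[? ?] /andP[? ?]; lra.
move=> /le_trans; apply; rewrite mulrC -!mulrA ler_wpM2l // ler_wpM2l // mulrC.
rewrite /t ler_wpM2l ?(ltW d0) // lef_pV2 ?posrE ?addr_gt0 //; lra.
Qed.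

(** The sum of [f] and a steep paraboloid centred at [x] has a minimiser near [x]. There the
    negative gradient of the paraboloid is a subgradient of [f]. *)
Lemma subdiff_dense U f x e : open U -> convex_on U f ->
  (forall x, U x -> {for x, continuous f}) -> U x -> 0 < e ->
  exists y p, [/\ U y, `|y - x| < e & subdiff U f y p].
Proof.
move=> oU cf ctf Ux e0.
have [r0 r00 rU] := (open_epsP U).1 oU x Ux.
pose r := Num.min e r0 / 2.
have r_gt0 : 0 < r by rewrite divr_gt0 // lt_min e0 r00.
have [re rr0] : r < e /\ r < r0.
  have : Num.min e r0 <= e by rewrite ge_min lexx.
  have : Num.min e r0 <= r0 by rewrite ge_min lexx orbT.
  by move: r_gt0; rewrite /r; lra.
pose K := [set y : pt | `|y - x| <= r].
have KU y : K y -> U y by move=> h; apply: rU; apply: le_lt_trans rr0.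
have Kc : compact K.
  apply: bounded_closed_compact.
    exists (`|x| + r); split; first by rewrite num_real.
    move=> M hM y Ky; apply: ltW; apply: le_lt_trans hM.
    rewrite -(subrK x y) addrC; apply: le_trans (ler_normD _ _) _.
    by rewrite lerD2l.
  rewrite (_ : K = (fun y => `|y - x|) @^-1` [set t | t <= r]) //.
  apply: closed_comp; last exact: closed_le.
  move=> y _; apply: (@continuous_comp pt pt R (fun y => y - x) (fun y => `|y|)).
    exact: translate_continuous.
  exact: norm_continuous.
have K0 : K !=set0 by exists x; rewrite /K /= subrr normr0 ltW.
have ctK : {within K, continuous f}.
  apply: continuous_in_subspaceT => y; rewrite inE => Ky; exact/ctf/KU.
have [c1 Kc1 hc1] := compact_EVT_min K0 Kc ctK.
(* At distance [r] from [x] the penalty then exceeds [f x - f c1], the largest possible gain on [K],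
   so the minimiser is not on the boundary of [K]. *)
pose N := (f x - f c1) / r ^+ 2 + 1.
pose q y := f y + N * dotv (y - x) (y - x).
have ctq : {within K, continuous q}.
  apply: continuous_in_subspaceT => y; rewrite inE => Ky.
  apply: (@continuousD R R pt f (fun y => N * dotv (y - x) (y - x))); first exact/ctf/KU.
  apply: continuousM; first exact: cst_continuous.
  apply: (@continuous_comp pt pt R (fun y => y - x) (fun y => dotv y y)).
    exact: translate_continuous.
  apply: (cvg_sumr (F := nbhs (y - x))) => i _.
  by apply: cvgM; exact: coord_continuous.
have [y] := compact_EVT_min K0 Kc ctq; rewrite inE => Ky hy.
have N0 : 0 < N.
  rewrite ltr_wpDl // divr_ge0 ?exprn_ge0 ?(ltW r_gt0) // subr_ge0 hc1 // inE /K /=.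
  by rewrite subrr normr0 ltW.
have yr : `|y - x| < r.
  rewrite lt_neqAle Ky andbT; apply/eqP => yx.
  have : q y <= q x by apply: hy; rewrite inE /K /= subrr normr0 ltW.
  rewrite /q subrr dotv0r mulr0 addr0.
  have h1 : f c1 <= f y by apply: hc1; rewrite inE.
  have h2 : r ^+ 2 <= dotv (y - x) (y - x).
    rewrite -sqr_enorm -yx ler_pXn2r ?nnegrE ?enorm_ge0 //; exact: norm_le_enorm.
  have h3 : N * r ^+ 2 <= N * dotv (y - x) (y - x) by rewrite ler_wpM2l // ltW.
  have h4 : N * r ^+ 2 = f x - f c1 + r ^+ 2.
    by rewrite /N mulrDl divfK ?mul1r // expf_neq0 // gt_eqF.
  have h5 : 0 < r ^+ 2 by rewrite exprn_gt0.
  lra.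
exists y, (- (2 * N) *: (y - x)); split; [exact: KU|exact: lt_trans re|].
move=> z Uz; rewrite leNgt; apply/negP => hz.
pose D := dotv (z - y) (z - y).
have D0 : 0 <= D by exact: dotvv_ge0.
pose g := f y + dotv (- (2 * N) *: (y - x)) (z - y) - f z.
have g0 : 0 < g by rewrite subr_gt0.
pose B := `|z - y| + 1.
have B0 : 0 < B by rewrite ltr_wpDl.
(* The second bound keeps the point at parameter [t] in [K]. The third makes the quadratic error
   [N * t ^+ 2 * D] smaller than the linear gain [t * g], against minimality. *)
pose t := Num.min (Num.min 1 ((r - `|y - x|) / B)) (g / (2 * (N * D + 1))).
have ND0 : 0 < N * D + 1 by rewrite ltr_wpDl // mulr_ge0 // ltW.
have t0 : 0 < t.
  by rewrite !lt_min ltr01 !divr_gt0 ?subr_gt0 // mulr_gt0.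
have [t1 [t2 t3]] : t <= 1 /\ t <= (r - `|y - x|) / B /\ t <= g / (2 * (N * D + 1)).
  by rewrite /t !ge_min !lexx !orbT.
have Kt : K ((1 - t) *: y + t *: z).
  rewrite /K /= (_ : _ - x = (y - x) + t *: (z - y)); last first.
    by apply/rowP => i; rewrite !mxE; ring.
  apply: le_trans (ler_normD _ _) _; rewrite normrZ gtr0_norm //.
  have : t * `|z - y| <= (r - `|y - x|).
    move: t2; rewrite ler_pdivlMr // => t2; apply: le_trans t2.
    by rewrite ler_wpM2l ?(ltW t0) // lerDl.
  lra.
have := hy _ (mem_set Kt); rewrite /q.
have t01 : 0 <= t <= 1 by rewrite (ltW t0).
have := cf _ _ (KU _ Ky) Uz _ t01.
have -> : dotv ((1 - t) *: y + t *: z - x) ((1 - t) *: y + t *: z - x) =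
    dotv (y - x) (y - x) + 2 * t * dotv (y - x) (z - y) + t ^+ 2 * D.
  rewrite (_ : _ - x = (y - x) + t *: (z - y)); last first.
    by apply/rowP => i; rewrite !mxE; ring.
  rewrite /D; move: (y - x) (z - y) => a b.
  by rewrite !dotvE (dotvC b a); ring.
move=> h1 h2.
have h3 : t * g <= t * (N * (t * D)).
  by move: h1 h2; rewrite /g dotvZl; nra.
have h4 : g <= N * (t * D) by move: h3; rewrite ler_pM2l.
have h5 : t * (N * D + 1) <= g / 2.
  by rewrite -ler_pdivlMr // -mulrA -invfM.
have : 0 < t by []; lra.
Qed.

End ConvexSets.

(** * Simplicial meshes *)

Section Barycentric.
Variables (R : realType) (n : nat).
Local Notation pt := 'rV[R]_n.+1.

(** The rows of [B] are the vertices with an entry 1 put in front, so affine independence is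
    invertibility of [B]. The coordinates are the row (1, x) times the inverse, hence affine in
    [x]. *)
Lemma exists_barycentric (T : simplex R n.+1) : aff_indep T ->
  exists (c : 'I_n.+2 -> pt) (b : 'I_n.+2 -> R), forall x,
    \sum_i (dotv (c i) x + b i) = 1 /\ \sum_i (dotv (c i) x + b i) *: T i = x.
Proof.
move=> aT.
pose ext (e : R) (x : pt) : 'rV[R]_n.+2 :=
  \row_j (if unlift ord0 j is Some k then x 0 k else e).
pose B : 'M[R]_n.+2 := \matrix_(i, j) ext 1 (T i) 0 j.
have mulB (l : 'rV[R]_n.+2) : l *m B = ext (\sum_i l 0 i) (\sum_i l 0 i *: T i).
  apply/rowP => j; rewrite !mxE.
  case: (unliftP ord0 j) => [k ->|->].
    rewrite summxE; apply: eq_bigr => i _; by rewrite !mxE liftK.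
  by apply: eq_bigr => i _; rewrite !mxE unlift_none mulr1.
have ext_inj e x e' x' : ext e x = ext e' x' -> e = e' /\ x = x'.
  move=> /rowP h; split; first by have := h ord0; rewrite !mxE unlift_none.
  by apply/rowP => k; have := h (lift ord0 k); rewrite !mxE liftK.
have ext0 : ext 0 0 = 0.
  by apply/rowP => j; rewrite !mxE; case: unlift => // k; rewrite mxE.
have uB : B \in unitmx.
  rewrite -row_free_unit -kermx_eq0; apply/eqP/row_matrixP => i; rewrite row0.
  have := mulB (row i (kermx B)).
  rewrite -row_mul mulmx_ker row0 -ext0 => /ext_inj [/esym s0 /esym x0].
  apply/rowP => j; have hj := aT (fun j => row i (kermx B) 0 j) s0 x0 j.
  by rewrite /= in hj; rewrite hj ext0 mxE.
pose lam x := ext 1 x *m invmx B.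
have lamE x i : lam x 0 i =
    dotv (\row_k invmx B (lift ord0 k) i) x + invmx B ord0 i.
  rewrite /lam mxE big_ord_recl addrC; congr (_ + _).
    by apply: eq_bigr => k _; rewrite !mxE liftK mulrC.
  by rewrite mxE unlift_none mul1r.
exists (fun i => \row_k invmx B (lift ord0 k) i), (fun i => invmx B ord0 i) => x.
have := mulB (lam x); rewrite {1}/lam mulmxKV // => /ext_inj [s1 sx].
by split; under eq_bigr do rewrite -lamE.
Qed.

End Barycentric.

Section MeshGeometry.
Variables (R : realType) (n : nat).
Local Notation pt := 'rV[R]_n.+1.
Local Notation bt := (borel_pt R n.+1).
Variables (M : mesh R n.+1) (Omega : set pt) (h : R).
Hypothesis hM : is_mesh Omega M h.
Hypotheses (oO : open Omega) (cO : Defs.convex_set Omega) (O0 : Omega !=set0).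
Local Notation T := (@msimp R n.+1 M).

Let aff t : aff_indep (T t).
Proof. by case: hM => + _ _ _ _ => /(_ t) []. Qed.

Lemma exists_bary : exists lam : 'I_(msize M) -> 'I_n.+2 -> pt -> R,
  (forall t i, exists c b, forall x, lam t i x = dotv c x + b) /\
  (forall t x, \sum_i lam t i x = 1) /\ (forall t x, \sum_i lam t i x *: T t i = x).
Proof.
have /choice [c /choice [b H]] := fun t => exists_barycentric (T := T t) (@aff t).
exists (fun t i x => dotv (c t i) x + b t i); split; last first.
  by split=> t x; have [] := H t x.
by move=> t i; exists (c t i), (b t i).
Qed.

Definition bary := projT1 (cid exists_bary).

Lemma baryE t i : exists c b, forall x, bary t i x = dotv c x + b.
Proof. exact: (projT2 (cid exists_bary)).1. Qed.

Lemma bary_sum t x : \sum_i bary t i x = 1.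
Proof. exact: (projT2 (cid exists_bary)).2.1. Qed.

Lemma bary_comb t x : \sum_i bary t i x *: T t i = x.
Proof. exact: (projT2 (cid exists_bary)).2.2. Qed.

Lemma bary_unique t x (l : 'I_n.+2 -> R) : \sum_i l i = 1 ->
  \sum_i l i *: T t i = x -> forall i, l i = bary t i x.
Proof.
move=> l1 lx i; apply/eqP; rewrite -subr_eq0; apply/eqP; move: i.
apply: (@aff t); first by rewrite sumrB l1 bary_sum subrr.
by under eq_bigr do rewrite scalerBl; rewrite sumrB lx bary_comb subrr.
Qed.

Lemma bary_continuous t i : continuous (bary t i).
Proof.
have [c [b E]] := baryE t i; move=> x.
rewrite (_ : bary t i = fun y => dotv c y + b); last by apply/funext.
by apply: continuousD; [exact: dotv_continuous|exact: cst_continuous].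
Qed.

Lemma bary_vertex t i j : bary t i (T t j) = (i == j)%:R.
Proof.
apply/esym; apply: (bary_unique (l := fun i => (i == j)%:R)).
  by rewrite (bigD1 j) //= eqxx big1 ?addr0 // => k /negbTE ->.
rewrite (bigD1 j) //= eqxx scale1r big1 ?addr0 // => k /negbTE ->.
by rewrite scale0r.
Qed.

Lemma vertex_inj t i j : T t i = T t j -> i = j.
Proof.
move=> e; apply/eqP; have := bary_vertex t i i.
rewrite e bary_vertex eqxx; case: eqP => // _ /eqP.
by rewrite eq_sym oner_eq0.
Qed.

Lemma simplexP t x : simplex_set (T t) x <-> forall i, 0 <= bary t i x.
Proof.
split=> [[l [l0 l1 xl]] i|h0]; first by rewrite -(bary_unique l1 (esym xl)).
by exists (bary t ^~ x); split; rewrite ?bary_sum ?bary_comb.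
Qed.

Definition mesh_union := \bigcup_(t in [set: 'I_(msize M)]) simplex_set (T t).

Lemma closed_simplex t : closed (simplex_set (T t)).
Proof.
rewrite (_ : simplex_set _ = \bigcap_(i in [set: 'I_n.+2]) (bary t i @^-1` [set s | 0 <= s])).
  apply: closed_bigI => i _; apply: closed_comp => [x _|]; last exact: closed_ge.
  exact: bary_continuous.
apply/seteqP; split=> x; first by move=> /simplexP hx i _; exact: hx.
by move=> hx; apply/simplexP => i; exact: hx.
Qed.

Lemma closed_mesh_union : closed mesh_union.
Proof.
by rewrite /mesh_union; apply: closed_bigcup => [|t _]; [exact: finite_finset|exact: closed_simplex].
Qed.

Lemma bary_gt0_mesh_dom t x : (forall i, 0 < bary t i x) -> mesh_dom M x.
Proof.
move=> hx; rewrite /mesh_dom /interior.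
have : closed (\bigcup_(i in [set: 'I_n.+2]) (bary t i @^-1` [set s | s <= 0])).
  apply: closed_bigcup => [|i _]; first exact: finite_finset.
  by apply: closed_comp => [y _|]; [exact: bary_continuous|exact: closed_le].
move=> /closed_openC /open_epsP /(_ x) [|e e0 he].
  by move=> [i _ /=]; rewrite leNgt hx.
apply/nbhs_ballP; exists e => //= y; rewrite -ball_normE /= distrC => /he hy.
exists t => //; apply/simplexP => i; rewrite leNgt; apply/negP => c; apply: hy.
by exists i => //=; exact: ltW.
Qed.

(** A point of a simplex moved slightly towards the centroid has positive barycentric coordinates,
    hence lies in the open domain. *)
Lemma closure_mesh_dom : closure (mesh_dom M) = mesh_union.
Proof.
apply/seteqP; split.
  rewrite [X in _ `<=` X](closure_id mesh_union).1; last exact: closed_mesh_union.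
  by apply: closure_subset; exact: interior_subset.
move=> x [t _ /simplexP hx]; apply/closure_epsP => e e0.
pose c : pt := \sum_i (n.+2%:R^-1 : R) *: T t i.
pose D := `|c - x| + 1; have D0 : 0 < D by rewrite ltr_wpDl.
pose s := Num.min 1 (e / D / 2).
have eD : 0 < e / D by rewrite divr_gt0.
have s0 : 0 < s by rewrite lt_min ltr01 divr_gt0.
have [s1 s2] : s <= 1 /\ s <= e / D / 2 by rewrite /s !ge_min !lexx orbT.
exists ((1 - s) *: x + s *: c).
  apply: (@bary_gt0_mesh_dom t) => i.
  have n2 : 0 < n.+2%:R^-1 :> R by rewrite invr_gt0.
  rewrite -(@bary_unique t _ (fun i => (1 - s) * bary t i x + s * n.+2%:R^-1)).
  - by rewrite ltr_wpDl ?mulr_ge0 ?subr_ge0 // mulr_gt0.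
  - rewrite big_split -!mulr_sumr bary_sum sumr_const card_ord /=.
    by rewrite -[_ *+ _]mulr_natl divff ?mulr1 ?subrK // pnatr_eq0.
  under eq_bigr do rewrite scalerDl -!scalerA.
  by rewrite big_split -!scaler_sumr bary_comb /c -scaler_sumr.
rewrite (_ : _ - x = s *: (c - x)); last by apply/rowP => i; rewrite !mxE; ring.
rewrite normrZ gtr0_norm //; apply: (@le_lt_trans _ _ (s * D)).
  by rewrite ler_wpM2l ?(ltW s0) // lerDl.
by rewrite -ltr_pdivlMr //; lra.
Qed.

Lemma vertex_simplex t i : simplex_set (T t) (T t i).
Proof. by apply/simplexP => j; rewrite bary_vertex. Qed.

Lemma vertex_closure x : is_vertex M x -> closure (mesh_dom M) x.
Proof. by move=> [t [i <-]]; rewrite closure_mesh_dom; exists t => //; exact: vertex_simplex. Qed.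

Lemma open_mesh_dom : open (mesh_dom M).
Proof. exact: open_interior. Qed.

Lemma mesh_domS : mesh_dom M `<=` Omega.
Proof.
apply: subset_trans (interior_closure_convex oO cO O0); apply: interiorS.
by move=> x [t _]; case: hM => + _ _ _ _ => /(_ t) [_]; exact.
Qed.

Lemma boundary_vertex x : is_vertex M x -> ~ mesh_dom M x -> bnd Omega x.
Proof.
move=> vx nx; case: hM => _ _ _ _ /(_ x vx); apply; split; first exact: vertex_closure.
by rewrite (_ : (mesh_dom M)° = mesh_dom M) //; apply/interior_id/open_mesh_dom.
Qed.

Lemma convex_mesh_dom : Defs.convex_set (mesh_dom M).
Proof. by case: hM. Qed.

Lemma exists_simplex : exists t : 'I_(msize M), True.
Proof. by case: hM => _ _ [[t _] _] _ _; exists t. Qed.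

(** Repetitions are removed because a vertex belongs to several simplices, while the partition of
    unity [hat_sum] must count it once. *)
Definition vertices : seq pt := undup (flatten [seq [seq T t i | i <- enum 'I_n.+2] | t <- enum 'I_(msize M)]).

Lemma mem_vertices x : x \in vertices <-> is_vertex M x.
Proof.
rewrite mem_undup; split.
  by move=> /flatten_mapP [t _ /mapP [i _ ->]]; exists t, i.
move=> [t [i <-]]; apply/flatten_mapP; exists t; first by rewrite mem_enum.
by apply: map_f; rewrite mem_enum.
Qed.

(** The nodal basis function, read off in an arbitrary simplex containing [x]; [hatE] shows that the
    choice does not matter. Vertices are compared as points, since each simplex numbers its own. *)
Definition hat (a x : pt) : R :=
  match pselect (exists t, simplex_set (T t) x) with
  | left e => \sum_(i | T (projT1 (cid e)) i == a) bary (projT1 (cid e)) i x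
  | right _ => 0
  end.

(** Two simplices meet in a common face, so the coordinates of [x] in the first vanish at vertices
    that are not shared. Moved to the equal vertices of the second, they are its coordinates by
    uniqueness. *)
Lemma hatE a t x : simplex_set (T t) x -> hat a x = \sum_(i | T t i == a) bary t i x.
Proof.
move=> tx; rewrite /hat; case: pselect => [e|[]]; last by exists t.
set t' := projT1 _; have : simplex_set (T t') x by exact: (projT2 (cid e)).
move: t' => t' t'x; have [->//|] := pselect (t' = t).
move=> tt'; have [_ /(_ t' t tt') [cf _] _ _ _] := hM.
have : common_face (T t') (T t) x by rewrite -cf.
move=> [l [l0 lz l1 xl]].
have lE i : l i = bary t' i x by rewrite -(bary_unique l1 (esym xl)).
pose l' j := \sum_(i | T t' i == T t j) l i.
have sl j0 : \sum_i (if T t' i == T t j0 then l i else 0) = l' j0.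
  by rewrite /l' [in RHS]big_mkcond.
have onej i : l i != 0 -> exists2 j, T t j = T t' i & forall k, (T t' i == T t k) = (k == j).
  move=> li; have [j tj] : exists j, T t j = T t' i.
    by apply: contrapT => nj; move/eqP: li; apply; exact: lz.
  exists j => // k; rewrite -tj; apply/eqP/eqP => [|->//].
  by move=> /(@vertex_inj t) ->.
have l'E j : l' j = bary t j x.
  apply: bary_unique.
    rewrite -l1; under eq_bigr do rewrite /l' big_mkcond.
    rewrite exchange_big; apply: eq_bigr => i _ /=.
    have [li|/onej [j0 _ E]] := eqVneq (l i) 0.
      by rewrite li big1 // => k _; case: ifP.
    rewrite (bigD1 j0) //= E eqxx big1 ?addr0 // => k kj.
    by rewrite E (negbTE kj).
  rewrite xl; under eq_bigr do rewrite /l' scaler_suml big_mkcond.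
  rewrite exchange_big; apply: eq_bigr => i _ /=.
  have [li|/onej [j0 Tj E]] := eqVneq (l i) 0.
    by rewrite li scale0r big1 // => k _; case: ifP; rewrite ?scale0r.
  rewrite (bigD1 j0) //= E eqxx Tj big1 ?addr0 // => k kj.
  by rewrite E (negbTE kj).
under eq_bigr do rewrite -lE; under [RHS]eq_bigr do rewrite -l'E.
have [[j0 Ta]|na] := pselect (exists j, T t j = a).
  rewrite [RHS](bigD1 j0) ?Ta //= [X in _ + X]big1 ?addr0.
    by rewrite /l' Ta.
  by move=> k /andP[/eqP ka]; rewrite -(inj_eq (@vertex_inj t)) ka Ta eqxx.
rewrite [RHS]big1 => [|k /eqP ka]; last by case: na; exists k.
by apply: big1 => i /eqP ia; apply: lz => -[j tj]; apply: na; exists j; rewrite tj.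
Qed.

Lemma hat_ge0 a x : 0 <= hat a x.
Proof.
have [[t tx]|ne] := pselect (exists t, simplex_set (T t) x).
  by rewrite (hatE _ tx); apply: sumr_ge0 => i _; move/simplexP : tx; exact.
by rewrite /hat; case: pselect.
Qed.

Lemma hat_neq0 a x : hat a x != 0 ->
  exists t i, T t i = a /\ simplex_set (T t) x.
Proof.
have [[t tx]|ne] := pselect (exists t, simplex_set (T t) x); last first.
  by rewrite /hat; case: pselect => // _; rewrite eqxx.
rewrite (hatE _ tx) => hn; exists t.
have [[i ia]|na] := pselect (exists i, T t i = a); first by exists i.
by case/eqP: hn; apply: big1 => i /eqP ia; case: na; exists i.
Qed.

Lemma hat_sum x : mesh_union x -> \sum_(a <- vertices) hat a x = 1.
Proof.
move=> [t _ tx]; under eq_bigr do rewrite (hatE _ tx) big_mkcond.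
rewrite exchange_big -[RHS](bary_sum t x); apply: eq_bigr => i _ /=.
have vi : T t i \in vertices by apply/mem_vertices; exists t, i.
rewrite (bigD1_seq (T t i)) ?undup_uniq //= eqxx big1 ?addr0 // => a /negbTE.
by rewrite eq_sym => ->.
Qed.

(** The simplices are closed and finitely many, so near [x] only those through [x] occur, and on
    each of them the function is affine. *)
Lemma hat_continuous a : {within closure (mesh_dom M), continuous (hat a)}.
Proof.
rewrite closure_mesh_dom; apply/(@continuous_within_epsdelta R pt R) => x Kx e e0.
have loc t : exists2 d, 0 < d & forall y, simplex_set (T t) y -> `|y - x| < d -> `|hat a y - hat a x| < e.
  have [tx|ntx] := pselect (simplex_set (T t) x).
    pose f y := \sum_(i | T t i == a) bary t i y.
    have cf : continuous f.
      move=> y; apply: (cvg_sumr (F := nbhs y)) => i _; exact: bary_continuous.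
    have [d d0 hd] := (@continuous_epsdelta R pt R f x).1 (cf x) e e0.
    by exists d => // y ty yx; rewrite (hatE a ty) (hatE a tx); exact: hd.
  have [d d0 hd] := (open_epsP _).1 (closed_openC (@closed_simplex t)) x ntx.
  by exists d => // y ty /hd.
have /choice [d hd] : forall t, exists d, 0 < d /\ forall y, simplex_set (T t) y -> `|y - x| < d -> `|hat a y - hat a x| < e.
  by move=> t; have [d d0 hd] := loc t; exists d.
exists (\big[Num.min/1]_t d t).
  by apply/bigmin_gtP; split => // t _; exact: (hd t).1.
move=> y [t _ ty] yx; apply: (hd t).2 => //; apply: lt_le_trans yx _.
exact: bigmin_le_cond.
Qed.

Lemma hat_fnP a : is_vertex M a -> hat_fn M a (hat a).
Proof.
move=> [t0 [i0 ta]]; split; first exact: hat_continuous.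
- move=> t; have /choice [c /choice [b H]] := fun i => baryE t i.
  exists (\sum_(i | T t i == a) c i), (\sum_(i | T t i == a) b i) => x tx.
  rewrite (hatE _ tx) dotvC dotv_sumr -big_split; apply: eq_bigr => i _.
  by rewrite H dotvC.
- have va := vertex_simplex t0 i0; rewrite ta in va; rewrite (hatE a va) (bigD1 i0) ?ta //= -ta.
  rewrite bary_vertex eqxx big1 ?addr0 // => j /andP[_ /negbTE ji].
  by rewrite bary_vertex ji.
move=> x [t [i <-]] xa; rewrite (hatE _ (vertex_simplex t i)) big1 // => j /eqP ja.
rewrite bary_vertex; case: eqP => // ji; case: xa.
by rewrite -ja ji.
Qed.

Lemma hat_borel a : measurable_fun (mesh_dom M : set bt) (hat a : bt -> R).
Proof.
apply: (@measurable_funS _ _ bt R (closure (mesh_dom M))).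
- by apply: closed_borel; exact: closed_closure.
- exact: subset_closure.
by apply: within_continuous_borel; [exact: closed_closure|exact: hat_continuous].
Qed.

Hypothesis bO : Defs.bounded_set Omega.

Lemma simplex_diam t x y : simplex_set (T t) x -> simplex_set (T t) y -> enorm (x - y) <= h.
Proof.
move=> tx ty; have [_ _ [_ /(_ t) dh] _ _] := hM; apply: le_trans dh.
apply: sup_upper_bound; last by exists x, y.
split; first by exists (enorm (x - y)), x, y.
(* Boundedness of [Omega] is what makes the [sup] in [diam_set] an upper bound. *)
have [B hB] := bO.
have clB z : closure Omega z -> `|z| <= B + 1.
  move=> /closure_epsP /(_ 1 ltr01) [z' /hB zB zz'].
  rewrite -(subrK z' z); apply: le_trans (ler_normD _ _) _.
  have := le_trans (norm_le_enorm z') zB; move: zz'; rewrite distrC; lra.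
exists (n.+1%:R * (B + 1 + (B + 1))) => _ [u [v [tu tv ->]]].
apply: le_trans (enorm_le_norm _) _; rewrite ler_wpM2l //.
apply: le_trans (ler_normB _ _) _.
by case: hM => /(_ t) [_ tO] _ _ _ _; apply: lerD; apply: clB; exact: tO.
Qed.

End MeshGeometry.

(** * Finite element solutions *)

Section NullSets.
Variables (R : realType) (n : nat).
Local Notation pt := 'rV[R]_n.+1.
Local Notation bt := (borel_pt R n.+1).

Lemma closed_norm_le (M : R) : closed [set x : pt | `|x| <= M].
Proof.
rewrite (_ : [set x : pt | _] = (fun y : pt => `|y|) @^-1` [set t | t <= M]) //.
by apply: closed_comp; [move=> x _; exact: norm_continuous|exact: closed_le].
Qed.

Lemma measure_null_local (m : {measure set bt -> \bar R}) (E : set pt) :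
  @measurable _ bt E ->
  (forall k : nat, m (E `&` [set x | `|x| <= k%:R]) = 0%E) -> m E = 0%E.
Proof.
move=> mE h; pose F (k : nat) : set bt := E `&` [set x | `|x| <= k%:R].
have mF k : measurable (F k).
  by apply: measurableI => //; apply: closed_borel; exact: closed_norm_le.
have EF : E = \bigcup_k F k.
  apply/seteqP; split => [x Ex|x [k _ []//]].
  by exists (Num.truncn `|x|).+1 => //; split => //=; rewrite ltW // truncnS_gt.
apply/eqP; rewrite eq_le measure_ge0 andbT {1}EF.
apply: le_trans (generalized_Boole_inequality m mF _) _; first by rewrite -EF.
by rewrite eseries0 // => i _ _; exact: h.
Qed.

Lemma closed_hyperplane (a : pt) (c : R) : closed [set p | dotv p a = c].
Proof.
rewrite (_ : [set p : pt | _] = dotv a @^-1` [set c]); last first.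
  by apply/seteqP; split => p /=; rewrite dotvC.
by apply: closed_comp; [move=> x _; exact: dotv_continuous|exact: closed_eq].
Qed.

(** A line in the normal direction [a] meets the hyperplane only once. *)
Lemma leb_hyperplane (leb : {measure set bt -> \bar R}) (a : pt) (c : R) :
  is_lebesgue leb -> a != 0 -> leb [set p | dotv p a = c] = 0%E.
Proof.
move=> hleb a0; have mH : @measurable _ bt [set p | dotv p a = c].
  by apply: closed_borel; exact: closed_hyperplane.
apply: measure_null_local => // k.
apply: (leb_null_lines hleb (e := a) (M := k%:R) (N := 1)).
- by apply: measurableI => //; apply: closed_borel; exact: closed_norm_le.
- by move=> x [].
move=> p s; case: s => [//|t [//|t' s]] /= /andP[] /[!inE] /norP[tt' _] _ h.
have aa : dotv a a != 0.
  apply: contra a0 => /eqP a0; apply/eqP/rowP => i; rewrite mxE; apply/eqP.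
  rewrite -normr_eq0 eq_le normr_ge0 andbT; apply: le_trans (coord_le_enorm a i) _.
  by rewrite /enorm a0 sqrtr0.
have [/= e1 _] := h t (mem_head _ _).
have [|/= e2 _] := h t'; first by rewrite !inE eqxx orbT.
case/eqP: tt'; apply: (mulIf aa); move: e1 e2; rewrite !dotvDl !dotvZl; lra.
Qed.

Lemma closed_subdiff (U : set pt) (u : pt -> R) (x : pt) : closed (subdiff U u x).
Proof.
rewrite (_ : subdiff U u x = \bigcap_(y in U) (dotv (y - x) @^-1` [set t | t <= u y - u x])).
  apply: closed_bigI => y _; apply: closed_comp; last exact: closed_le.
  by move=> p _; exact: dotv_continuous.
apply/seteqP; split => p h y Uy; have := h y Uy; rewrite /= dotvC; lra.
Qed.

(** The two subgradient inequalities fix the product of a common slope with [a - b], so these slopes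
    lie in a hyperplane. *)
Lemma subdiffI_null (leb : {measure set bt -> \bar R}) (U : set pt) (u : pt -> R) a b :
  is_lebesgue leb -> U a -> U b -> a != b ->
  leb (subdiff U u a `&` subdiff U u b) = 0%E.
Proof.
move=> hleb Ua Ub ab; apply/eqP; rewrite eq_le measure_ge0 andbT.
have ab0 : a - b != 0 by rewrite subr_eq0.
rewrite -[leRHS](leb_hyperplane (u a - u b) hleb ab0).
apply: le_measure; rewrite ?inE.
- by apply: measurableI; apply: closed_borel; exact: closed_subdiff.
- by apply: closed_borel; exact: closed_hyperplane.
move=> p [/(_ b Ub) h1 /(_ a Ua) h2] /=; move: h1 h2.
by rewrite !dotvDr !dotvNr; lra.
Qed.

Lemma measure_bigsetU_null (m : {measure set bt -> \bar R}) (I : eqType) (s : seq I)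
    (F : I -> set pt) : uniq s -> (forall i, @measurable _ bt (F i)) ->
  (forall i j, i \in s -> j \in s -> i != j -> m (F i `&` F j) = 0%E) ->
  m (\big[setU/set0]_(i <- s) F i) = (\sum_(i <- s) m (F i))%E.
Proof.
move=> + mF; elim: s => [|i s IH] /=; first by rewrite !big_nil measure0.
move=> /andP[is_ us] H; rewrite !big_cons -IH //; last first.
  by move=> j k js ks; apply: H; rewrite inE ?js ?ks orbT.
set G := \big[setU/set0]_(j <- s) F j.
have mG : @measurable _ bt G by apply: bigsetU_measurable.
have mFG : @measurable _ bt (F i `&` G) by exact: measurableI.
have FG0 : m (F i `&` G) = 0%E.
  apply/eqP; rewrite eq_le measure_ge0 andbT.
  have -> : F i `&` G = \big[setU/set0]_(j <- s) (F i `&` F j).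
    by rewrite /G big_distrr.
  have HH j : j \in s -> i != j -> m (F i `&` F j) = 0%E.
    by move=> js; apply: H; rewrite ?mem_head // inE js orbT.
  elim: (s) HH is_ => [|j s' IH' H' js]; first by rewrite big_nil measure0.
  rewrite big_cons; set B := \big[setU/set0]_(_ <- s') _ in IH' *.
  have mB : @measurable _ bt B by apply: bigsetU_measurable => k _; exact: measurableI.
  have mA : @measurable _ bt (F i `&` F j) by exact: measurableI.
  have U2 : (m (F i `&` F j `|` B) <= m (F i `&` F j) + m B)%E by exact: measureU2.
  apply: le_trans U2 _; move: js; rewrite inE => /norP[ij is']; rewrite H' ?mem_head // add0e IH' //.
  by move=> k ks ik; apply: H' => //; rewrite inE ks orbT.
apply/eqP; rewrite eq_le; apply/andP; split; first exact: measureU2.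
have -> : F i `|` G = F i `|` (G `\` F i).
  apply/seteqP; split => x; last by case=> [|[]]; [left|right].
  by move=> [|Gx]; [left|have [|] := pselect (F i x); [left|right]].
rewrite measureU //; last 2 first.
- exact: measurableD.
- by apply/seteqP; split => // x [Fx [_ /(_ Fx)]].
have mD : (m G = m (G `\` F i) + m (G `&` F i))%E by exact: measureDI.
by rewrite mD (setIC G) FG0 adde0.
Qed.

End NullSets.

Section FiniteElements.
Variables (R : realType) (n : nat).
Local Notation pt := 'rV[R]_n.+1.
Local Notation bt := (borel_pt R n.+1).
Variables (leb mu nu : {measure set bt -> \bar R}) (Omega : set pt) (g Rf : pt -> R).
Variables (M : mesh R n.+1) (h : R) (v : pt -> R).
Hypotheses (hleb : is_lebesgue leb) (hnu : weight_of leb Rf nu).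
Hypotheses (oO : open Omega) (cO : Defs.convex_set Omega) (O0 : Omega !=set0)
  (bO : Defs.bounded_set Omega).
Hypothesis hM : is_mesh Omega M h.
Hypothesis hv : fe_solution leb mu M g Rf v.
Local Notation T := (@msimp R n.+1 M).
Local Notation D := (mesh_dom M).

Lemma fe_convex : convex_on D v. Proof. by case: hv => -[]. Qed.

Lemma fe_continuous : {within closure D, continuous v}. Proof. by case: hv => -[]. Qed.

(** Stands in for the convex-hull description of [in_Hh]. With the nodal data [w], the last clause
    says that [v] is above every affine function below the data, which is all that the search for
    contact nodes uses. *)
Lemma fe_vertex_values : exists w : pt -> R,
  [/\ forall B, is_vertex M B -> ~ D B -> w B = g B,
      forall V, is_vertex M V -> v V <= w V
    & forall p c, (forall V, is_vertex M V -> dotv p V + c <= w V) ->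
        forall x, closure D x -> dotv p x + c <= v x].
Proof.
case: hv => -[_ _ [z vE]] _.
pose w p := if `[< D p >] then z p else g p.
have {}vE x : closure D x -> v x = inf [set s | exists l : 'I_(msize M) * 'I_n.+2 -> R,
    [/\ forall k, 0 <= l k, \sum_k l k = 1, x = \sum_k l k *: T k.1 k.2
      & s = \sum_k l k * w (T k.1 k.2)]] by exact: vE.
exists w; split.
- by move=> B _ nB; rewrite /w; case: asboolP.
- move=> V [t [i VE]]; rewrite vE; last by apply: (vertex_closure hM); exists t, i.
  apply: ge_inf.
    (* The infimum is meaningful only for a set bounded below: weights in [0, 1] keep a combination
       above minus the sum of all absolute nodal values. *)
    exists (- \sum_(k : 'I_(msize M) * 'I_n.+2) `|w (T k.1 k.2)|) => _ [l [l0 l1 _ ->]].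
    rewrite -sumrN; apply: ler_sum => k _.
    have lk : l k <= 1.
      by rewrite -l1 (bigD1 k) //= lerDl sumr_ge0.
    rewrite lerNl -mulrN; apply: le_trans (ler_norm _) _; rewrite normrM normrN.
    by rewrite ger0_norm // ler_piMl.
  exists (fun k => (k == (t, i))%:R); split => //.
  - by rewrite (bigD1 (t, i)) //= eqxx big1 ?addr0 // => k /negbTE ->.
  - by rewrite (bigD1 (t, i)) //= eqxx scale1r VE big1 ?addr0 // => k /negbTE ->; rewrite scale0r.
  by rewrite (bigD1 (t, i)) //= eqxx mul1r VE big1 ?addr0 // => k /negbTE ->; rewrite mul0r.
move=> p c pc x cx; rewrite vE //; apply: lb_le_inf.
  move: cx; rewrite (closure_mesh_dom hM) => -[t _ [l [l0 l1 xl]]].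
  eexists; exists (fun k => if k.1 == t then l k.2 else 0); split; last reflexivity.
  - by move=> k; case: ifP.
  - rewrite -(pair_bigA _ (fun s i => if s == t then l i else 0)) /= (bigD1 t) //= eqxx l1.
    by rewrite big1 ?addr0 // => s /negbTE ->; rewrite big1.
  rewrite -(pair_bigA _ (fun s i => (if s == t then l i else 0) *: T s i)) /= (bigD1 t) //= eqxx -xl.
  rewrite big1 ?addr0 // => s /negbTE ->; rewrite big1 // => i _.
  by rewrite scale0r.
move=> _ [l [l0 l1 -> ->]]; rewrite dotv_sumr -[c]mulr1 -l1 mulr_sumr -big_split.
apply: ler_sum => k _ /=; rewrite dotvZr (mulrC c) -mulrDr ler_wpM2l //.
by apply: pc; exists k.1, k.2.
Qed.

Lemma vertex_argmin (f : pt -> R) : exists2 V, is_vertex M V &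
  forall V', is_vertex M V' -> f V <= f V'.
Proof.
have [t _] := exists_simplex hM.
have [k _ hk] := @arg_minP _ _ _ (t, ord0 : 'I_n.+2) xpredT (fun k => f (T k.1 k.2)) isT.
exists (T k.1 k.2); first by exists k.1, k.2.
by move=> _ [s [i <-]]; exact: (hk (s, i)).
Qed.

(** The affine function of slope [p] that touches the nodal data from below at [V] stays below [v],
    while [v V] is at most the datum; hence it supports [v] at [V]. *)
Lemma fe_contact (w : pt -> R) p V :
  (forall V, is_vertex M V -> v V <= w V) ->
  (forall p c, (forall V, is_vertex M V -> dotv p V + c <= w V) ->
        forall x, closure D x -> dotv p x + c <= v x) ->
  is_vertex M V -> (forall V', is_vertex M V' -> w V - dotv p V <= w V' - dotv p V') ->
  subdiff D v V p.
Proof.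
move=> vw wv vV hV y Dy.
have := wv p (w V - dotv p V) _ y (subset_closure Dy).
have := vw V vV; rewrite dotvDr dotvNr => h1 h2.
suff /h2 : forall V', is_vertex M V' -> dotv p V' + (w V - dotv p V) <= w V' by lra.
by move=> V' /hV; lra.
Qed.

Lemma mesh_dom_neq0 : D !=set0.
Proof.
have [t _] := exists_simplex hM.
have : closure D (T t ord0) by apply: (vertex_closure hM); exists t, ord0.
by move=> /closure_epsP /(_ 1 ltr01) [y Dy _]; exists y.
Qed.

(** If all vertices were interior, convexity would put every simplex, and so the closure, into the
    open domain; but a bounded non-empty domain has boundary points. *)
Lemma exists_boundary_vertex : exists2 B, is_vertex M B & ~ D B.
Proof.
apply: contrapT => nB.
have allD t i : D (T t i).
  by apply: contrapT => nD; apply: nB; exists (T t i) => //; exists t, i.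
have [a Da] := mesh_dom_neq0; have [K hK] := bO.
pose b : pt := const_mx (`|K| + 1).
have nDb : ~ D° b.
  move=> /interior_subset /(mesh_domS hM oO cO O0) /hK /(le_trans (coord_le_enorm _ ord0)).
  rewrite mxE ger0_norm ?addr_ge0 // => c; have := ler_norm K; lra.
have [t _ [+ nz]] := exists_boundary_segment Da nDb.
set z := (X in closure D X); rewrite (closure_mesh_dom hM) => -[s _ hz].
apply: nz; rewrite (_ : D° = D); last by apply/interior_id; exact: open_mesh_dom.
have hz' := (simplexP hM s _).1 hz.
have [||] := @convex_sum R _ _ (index_enum _) (bary hM s ^~ z) (T s) D (fun=> 0) (convex_mesh_dom hM) _ hz' (fun i _ => allD s i).
  by move=> x y _ _ e _; rewrite !mulr0 addr0.
  by rewrite bary_sum.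
by rewrite bary_sum bary_comb invr1 scale1r.
Qed.

(** The convex difference [f] is largest at a vertex [V]. If [V] is interior, the segment from a
    boundary vertex [B] can be prolonged beyond [V], and convexity along it forces [f V <= f B]. *)
Lemma fe_max_principle p c : (forall x, bnd Omega x -> g x <= dotv p x + c) ->
  forall x, closure D x -> v x <= dotv p x + c.
Proof.
move=> gp; pose f x := v x - (dotv p x + c).
have cf : convex_on D f.
  move=> x y Dx Dy t t01; have := fe_convex Dx Dy t01.
  by rewrite /f dotvDr !dotvZr; move: t01 => /andP[t0 t1]; nra.
have ctf : {within closure D, continuous f}.
  have ca : {within closure D, continuous (fun x => dotv p x + c)}.
    apply: continuous_subspaceT => x.
    by apply: continuousD; [exact: dotv_continuous|exact: cst_continuous].
  by move=> x; apply: (@continuousB R R (subspace (closure D)) v); [exact: fe_continuous|exact: ca].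
have ccf := convex_on_closure (convex_mesh_dom hM) cf ctf.
have [V vV hV] := vertex_argmin (fun x => - f x).
have fV x : closure D x -> f x <= f V.
  rewrite (closure_mesh_dom hM) => -[s _ hx]; have hx' := (simplexP hM s _).1 hx.
  have [||_] := @convex_sum R _ _ (index_enum _) (bary hM s ^~ x) (T s) (closure D) f (convex_set_closure (convex_mesh_dom hM)) ccf hx'.
  - by move=> i _; apply: (vertex_closure hM); exists s, i.
  - by rewrite bary_sum.
  rewrite bary_sum bary_comb invr1 scale1r mul1r => /le_trans; apply.
  rewrite -[leRHS]mul1r -(bary_sum hM s x) mulr_suml; apply: ler_sum => i _.
  by rewrite ler_wpM2l // -lerN2 hV //; exists s, i.
have [w [wB wV _]] := fe_vertex_values.
have fB B : is_vertex M B -> ~ D B -> f B <= 0.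
  move=> vB nB; rewrite /f subr_le0; apply: le_trans (wV B vB) _.
  by rewrite wB //; apply: gp; exact: (boundary_vertex hM).
suff fV0 : f V <= 0 by move=> x /fV; rewrite /f in fV0 *; lra.
have [DV|] := pselect (D V); last exact: fB.
have [B vB nB] := exists_boundary_vertex; have fB0 := fB _ vB nB.
have [e e0 eD] := (open_epsP D).1 (@open_mesh_dom _ _ M) V DV.
pose d := `|V - B| + 1; have d0 : 0 < d by rewrite ltr_wpDl.
pose s := e / d / 2; have s0 : 0 < s by rewrite !divr_gt0.
have Dz : D (V + s *: (V - B)).
  apply: eD; rewrite addrAC subrr add0r normrZ gtr0_norm //.
  apply: (@le_lt_trans _ _ (s * d)); first by rewrite ler_wpM2l ?(ltW s0) // lerDl.
  by rewrite /s mulrAC divfK ?gt_eqF //; lra.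
have t01 : 0 <= s / (1 + s) <= 1.
  apply/andP; split; first by rewrite divr_ge0 ?addr_ge0 // ltW.
  rewrite ler_pdivrMr ?mul1r; lra.
have := ccf _ _ (subset_closure Dz) (vertex_closure hM vB) _ t01.
have -> : (1 - s / (1 + s)) *: (V + s *: (V - B)) + (s / (1 + s)) *: B = V.
  by apply/rowP => i; rewrite !mxE; field; lra.
have t0 : 0 < s / (1 + s) by rewrite divr_gt0 ?addr_gt0.
have := fV _ (subset_closure Dz); move: t01 t0.
set t := s / (1 + s) => /andP[_ t1] t0 h1 h2.
have h3 : (1 - t) * f (V + s *: (V - B)) <= (1 - t) * f V by rewrite ler_wpM2l // subr_ge0.
have h4 : t * f V <= t * f B by lra.
by rewrite ler_pM2l // in h4; exact: le_trans h4 fB0.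
Qed.

Definition fe_slopes (P : set pt) : set pt :=
  \bigcup_(a in [set a | is_vertex M a /\ D a /\ P a]) subdiff D v a.

Let S (P : set pt) := [seq a <- vertices M | `[< D a /\ P a >]].

Let mem_S P a : a \in S P <-> is_vertex M a /\ D a /\ P a.
Proof.
rewrite mem_filter; split => [/andP[/asboolP ? /mem_vertices ?]//|[? ?]].
by apply/andP; split; [apply/asboolP|apply/mem_vertices].
Qed.

Let fe_slopesE P : fe_slopes P = \big[setU/set0]_(a <- S P) subdiff D v a.
Proof.
rewrite -bigcup_seq; apply: eq_bigcupl; split => a /=; first by move/mem_S.
by move=> ?; apply/mem_S.
Qed.

Lemma fe_slopes_borel P : @measurable _ bt (fe_slopes P).
Proof.
rewrite fe_slopesE; apply: bigsetU_measurable => a _.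
by apply: closed_borel; exact: closed_subdiff.
Qed.

Let mD : @measurable _ bt D.
Proof. by apply: open_borel; exact: open_mesh_dom. Qed.

(** Slopes shared by two nodes form a null set, so the weights of the nodes add up; each of them is
    the integral of its hat function by the discrete equation. *)
Let fe_slopes_measure P :
  nu (fe_slopes P) = (\int[mu]_(x in D) (\sum_(a <- S P) hat hM a x)%:E)%E.
Proof.
rewrite fe_slopesE measure_bigsetU_null.
- under [RHS]eq_integral do rewrite -sumEFin.
  rewrite ge0_integral_sum //; last 2 first.
  + by move=> a; apply/measurable_EFinP; exact: hat_borel.
  + by move=> a x _; rewrite lee_fin hat_ge0.
  rewrite big_seq [RHS]big_seq; apply: eq_bigr => a /mem_S [va [Da Pa]].
  case: hv => _ /(_ a va Da _ (hat_fnP hM va)) <-.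
  rewrite -(weight_integral hnu (D := subdiff D v a) (N := set0)) //.
  by apply: closed_borel; exact: closed_subdiff.
- by rewrite filter_uniq // undup_uniq.
- by move=> a; apply: closed_borel; exact: closed_subdiff.
move=> a b /mem_S [_ [Da _]] /mem_S [_ [Db _]] ab.
apply: (weight_null hnu); last exact: subdiffI_null.
by apply: measurableI; apply: closed_borel; exact: closed_subdiff.
Qed.

Let hat_sum_borel P : measurable_fun (D : set bt) (fun x : bt => (\sum_(a <- S P) hat hM a x)%:E).
Proof.
under eq_fun do rewrite -sumEFin.
by apply: emeasurable_sum => a; apply/measurable_EFinP; exact: hat_borel.
Qed.

(** The hat functions sum to at most 1, and each vanishes at distance more than [h] from its
    node. *)
Lemma fe_slopes_le (P E : set pt) : @measurable _ bt E ->
  (forall x a, D x -> is_vertex M a -> P a -> enorm (x - a) <= h -> E x) ->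
  (nu (fe_slopes P) <= mu E)%E.
Proof.
move=> mE hE; rewrite fe_slopes_measure.
apply: (@le_trans _ _ (\int[mu]_(x in D) (\1_E x)%:E)%E); last first.
  by rewrite integral_indic //; apply: le_measure; rewrite ?inE //; exact: measurableI.
apply: ge0_le_integral => //.
- by move=> x _; rewrite lee_fin sumr_ge0 // => a _; exact: hat_ge0.
- by apply/measurable_EFinP; exact: measurable_indic.
move=> x Dx; rewrite lee_fin indicE.
have ux : mesh_union M x by rewrite -(closure_mesh_dom hM); exact: subset_closure.
have [xE|xE] := boolP (x \in E).
  rewrite -(hat_sum hM ux) big_filter big_mkcond; apply: ler_sum => a _.
  by case: ifP => // _; exact: hat_ge0.
rewrite big1_seq // => a /andP[_ /mem_S [va [Da Pa]]]; apply/eqP.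
apply: contraNT xE => /hat_neq0 [t [i [ta tx]]]; rewrite inE; apply: (hE x a) => //.
by apply: (simplex_diam hM bO) tx _; rewrite -ta; exact: (vertex_simplex hM).
Qed.

(** At a point of [E] every hat function that does not vanish belongs to a counted node, so the sum
    there is the full partition of unity. *)
Lemma fe_slopes_ge (P E : set pt) : @measurable _ bt E -> E `<=` D ->
  (forall x a, E x -> is_vertex M a -> enorm (x - a) <= h -> D a /\ P a) ->
  (mu E <= nu (fe_slopes P))%E.
Proof.
move=> mE ED hE; rewrite fe_slopes_measure.
have -> : mu E = (\int[mu]_(x in D) (\1_E x)%:E)%E.
  by rewrite integral_indic // setIidl.
apply: ge0_le_integral => //.
- by apply/measurable_EFinP; exact: measurable_indic.
move=> x Dx; rewrite lee_fin indicE.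
have [xE|xE] := boolP (x \in E); last by rewrite sumr_ge0 // => a _; exact: hat_ge0.
have ux : mesh_union M x by rewrite -(closure_mesh_dom hM); exact: subset_closure.
rewrite -(hat_sum hM ux) big_filter [leRHS]big_mkcond /= big_seq [leRHS]big_seq.
apply: ler_sum => a /mem_vertices va; case: asboolP => // nP.
rewrite le_eqVlt; apply/orP; left; apply/eqP/eqP; apply: contrapT => /negP.
move=> /hat_neq0 [t [i [ta tx]]]; apply: nP; rewrite inE in xE; apply: (hE x) => //.
by apply: (simplex_diam hM bO) tx _; rewrite -ta; exact: (vertex_simplex hM).
Qed.

End FiniteElements.

(** * Contact sets and the comparison principle *)

Section Contact.
Variables (R : realType) (n : nat).
Local Notation pt := 'rV[R]_n.+1.
Local Notation bt := (borel_pt R n.+1).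
Variables (C : set pt) (u : pt -> R).

Definition contact (p : pt) : set pt :=
  [set x | C x /\ forall y, C y -> u x - dotv p x <= u y - dotv p y].

Definition contact_slopes (K : set pt) : set pt := [set p | exists2 x, K x & contact p x].

(** A chosen minimiser; by [selP] the default 0 is never taken for compact non-empty [C] and
    continuous [u]. *)
Definition sel (p : pt) : pt := xget 0 (contact p).

(** The Legendre transform of [u] over [C]: the selected point attains the supremum, by
    [conj_ge]. *)
Definition conj (p : pt) : R := dotv p (sel p) - u (sel p).

Hypotheses (Cc : compact C) (C0 : C !=set0) (cu : {within C, continuous u}).

Let Cb : exists2 B : R, 0 < B & forall x, C x -> `|x| <= B.
Proof.
have /compact_bounded [B [_ hB]] := Cc.
exists (`|B| + 1) => [|x Cx]; first by rewrite ltr_wpDl.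
by apply: (hB (`|B| + 1)) => //; rewrite (le_lt_trans (ler_norm _)) // ltrDl.
Qed.

Lemma tilt_continuous (K : set pt) p : K `<=` C -> {within K, continuous (fun x => u x - dotv p x)}.
Proof.
move=> KC; have cK : {within K, continuous u} by exact: continuous_subspaceW cu.
have cp : {within K, continuous (dotv p)} by apply: continuous_subspaceT; exact: dotv_continuous.
by move=> x; apply: (@continuousB R R (subspace K) u); [exact: cK|exact: cp].
Qed.

Lemma selP p : contact p (sel p).
Proof.
apply: xgetPex.
have [x] := compact_EVT_min C0 Cc (tilt_continuous (p := p) (@subset_refl _ C)).
by rewrite inE => Cx hx; exists x; split => // y Cy; apply: hx; rewrite inE.
Qed.

Lemma conj_ge p y : C y -> dotv p y - u y <= conj p.
Proof. by move=> Cy; have [_ /(_ y Cy)] := selP p; rewrite /conj; lra. Qed.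

Lemma conjE p x : contact p x -> conj p = dotv p x - u x.
Proof.
move=> [Cx hx]; apply/eqP; rewrite eq_le (conj_ge p Cx) andbT /conj.
by have := hx _ (selP p).1; lra.
Qed.

Lemma conj_subgradient p q x : contact p x -> conj p + dotv (q - p) x <= conj q.
Proof.
move=> px; rewrite (conjE px); have := conj_ge q px.1.
by rewrite dotvDl dotvNl; lra.
Qed.

Lemma contact_monotone p q x y : contact p x -> contact q y -> 0 <= dotv (p - q) (x - y).
Proof.
move=> [Cx hx] [Cy hy]; have := hx y Cy; have := hy x Cx.
by rewrite !dotvE; lra.
Qed.

(** For a limit slope the best point of [C] in [K] is compared with all of [C]. A deficit [d] would
    persist for nearby slopes, because changing the slope moves differences of tilted values
    uniformly little on the bounded set [C]. *)
Lemma closed_contact_slopes (K : set pt) : closed K -> closed (contact_slopes K).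
Proof.
move=> cK p /closure_epsP cl; have [B B0 hB] := Cb.
have [q0 [x0 Kx0 [Cx0 _]] _] := cl 1 ltr01.
have KCc : compact (C `&` K).
  by apply: (@subclosed_compact _ _ C) => //; apply: closedI => //; exact: rV_compact_closed.
have KC0 : (C `&` K) !=set0 by exists x0.
have [x] := compact_EVT_min KC0 KCc (tilt_continuous (p := p) (@subIsetl _ C K)).
rewrite inE => -[Cx Kx] hx; exists x => //; split => // y Cy.
rewrite leNgt; apply/negP => lt_y.
pose d := u x - dotv p x - (u y - dotv p y).
have d0 : 0 < d by rewrite subr_gt0.
have nB : 0 < 2 * n.+1%:R * B by rewrite !mulr_gt0.
have [q [z Kz [Cz hz]] qp] := cl (d / (2 * n.+1%:R * B)) (divr_gt0 d0 nB).
have h1 : u x - dotv p x <= u z - dotv p z by apply: hx; rewrite inE.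
have h2 := hz y Cy.
have h3 : dotv (q - p) (z - y) <= n.+1%:R * `|q - p| * `|z - y|.
  exact: le_trans (ler_norm _) (dotv_le_norm _ _).
have h4 : `|z - y| <= 2 * B.
  apply: le_trans (ler_normB _ _) _; have := hB _ Cz; have := hB _ Cy; lra.
have h5 : n.+1%:R * `|q - p| * `|z - y| <= n.+1%:R * `|q - p| * (2 * B).
  by rewrite ler_wpM2l // mulr_ge0.
have h6 : `|q - p| * (2 * n.+1%:R * B) < d by rewrite -ltr_pdivlMr.
have h7 : n.+1%:R * `|q - p| * (2 * B) = `|q - p| * (2 * n.+1%:R * B) by ring.
have h8 : d <= dotv (q - p) (z - y).
  by rewrite /d !dotvE; lra.
lra.
Qed.

(** The slopes with more than one contact point. Distinct points are separated by two rationals in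
    some coordinate, which exhibits this set as a countable union of closed sets. *)
Definition multi_slopes : set pt :=
  \bigcup_(k : 'I_n.+1 * (rat * rat)) (
    if k.2.1 < k.2.2 then
      contact_slopes [set x : pt | x 0 k.1 <= ratr k.2.1] `&`
      contact_slopes [set x : pt | ratr k.2.2 <= x 0 k.1]
    else set0).

Let closed_coord_le i (r : R) : closed [set x : pt | x 0 i <= r].
Proof.
rewrite (_ : [set x : pt | _] = (fun y : pt => y 0 i) @^-1` [set t | t <= r]) //.
by apply: closed_comp; [move=> x _; exact: coord_continuous|exact: closed_le].
Qed.

Let closed_coord_ge i (r : R) : closed [set x : pt | r <= x 0 i].
Proof.
rewrite (_ : [set x : pt | _] = (fun y : pt => y 0 i) @^-1` [set t | r <= t]) //.
by apply: closed_comp; [move=> x _; exact: coord_continuous|exact: closed_ge].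
Qed.

Lemma multi_slopes_borel : @measurable _ bt multi_slopes.
Proof.
apply: (@countable_bigcupT_measurable _ bt _ _ (countableP _)) => k.
case: ifP => // _; apply: measurableI; apply: closed_borel;
by apply: closed_contact_slopes.
Qed.

Lemma contact_unique p x y : ~ multi_slopes p -> contact p x -> contact p y -> x = y.
Proof.
move=> np px py; apply/rowP => i; apply: contrapT => xy.
wlog lt_xy : x y px py xy / x 0 i < y 0 i.
  move=> H; case: (ltgtP (x 0 i) (y 0 i)) => // [|c]; first exact: H.
  by apply: (H y x) => //; apply/nesym.
have [r] := rat_in_itvoo lt_xy; rewrite in_itv /= => /andP[r1 r2].
have [s] := rat_in_itvoo r2; rewrite in_itv /= => /andP[s1 s2].
apply: np; exists (i, (r, s)) => //=; rewrite -(ltr_rat R) s1.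
by split; [exists x => //=; exact: ltW|exists y => //=; exact: ltW].
Qed.

(** By monotonicity, along a line in direction [i] the [i]-th coordinate of the contact point cannot
    fall from at least [s] to at most [r] as the slope increases. So each line meets a given piece
    at most once. *)
Lemma multi_slopes_null (leb : {measure set bt -> \bar R}) :
  is_lebesgue leb -> leb multi_slopes = 0%E.
Proof.
move=> hleb.
have [f fE] : exists f : nat -> option ('I_n.+1 * (rat * rat)), forall k, exists j, f j = Some k.
  by exists unpickle => k; exists (pickle k); rewrite pickleK.
pose E k := if k is Some k then (if k.2.1 < k.2.2 then
      contact_slopes [set x : pt | x 0 k.1 <= ratr k.2.1] `&`
      contact_slopes [set x : pt | ratr k.2.2 <= x 0 k.1]
    else set0) else set0.
have mE k : @measurable _ bt (E k).
  case: k => [k|] //=; case: ifP => // _; apply: measurableI; apply: closed_borel;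
  by apply: closed_contact_slopes.
have E0 k : leb (E k) = 0%E.
  case: k => [[i [r s]]|] /=; last exact: measure0.
  case: ifPn => [rs|_]; last exact: measure0.
  have rs' : ratr r < ratr s :> R by rewrite ltr_rat.
  apply: measure_null_local; first by have := mE (Some (i, (r, s))); rewrite /= rs.
  move=> k; apply: (leb_null_lines hleb (e := delta_mx 0 i) (M := k%:R) (N := 1)).
  - apply: measurableI; first by have := mE (Some (i, (r, s))); rewrite /= rs.
    by apply: closed_borel; exact: closed_norm_le.
  - by move=> x [].
  move=> p l; case: l => [//|t [//|t' l]] /= /andP[] /[!inE] /norP[tt' _] _ h.
  have di (w : pt) : dotv (delta_mx 0 i) w = w 0 i.
    rewrite /dotv (bigD1 i) //= big1 => [|j ji]; first by rewrite mxE !eqxx mul1r addr0.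
    by rewrite mxE eqxx (negbTE ji) mul0r.
  have key a b : a < b -> a \in [:: t, t' & l] -> b \in [:: t, t' & l] -> False.
    move=> ab /h [[_ [y /= ys ay]] _] /h [[[x /= xr bx] _] _].
    have := contact_monotone bx ay.
    have -> : p + b *: delta_mx 0 i - (p + a *: delta_mx 0 i) = (b - a) *: delta_mx 0 i.
      by rewrite scalerBl opprD addrACA subrr add0r.
    rewrite dotvZl di !mxE pmulr_rge0 ?subr_gt0 //; lra.
  case: (ltgtP t t') tt' => // tt' _; first by case: (key _ _ tt'); rewrite !inE eqxx ?orbT.
  by case: (key _ _ tt'); rewrite !inE eqxx ?orbT.
have EE : multi_slopes = \bigcup_j E (f j).
  apply/seteqP; split => p [k _ hk].
    by have [j fj] := fE k; exists j => //; rewrite fj.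
  by move: hk; rewrite /E; case: (f k) => // k' hk; exists k'.
apply/eqP; rewrite eq_le measure_ge0 andbT {1}EE.
apply: le_trans (generalized_Boole_inequality leb (fun j => mE (f j)) _) _.
  by rewrite -EE; exact: multi_slopes_borel.
by rewrite eseries0.
Qed.

(** Agrees, up to the null set [multi_slopes], with the slopes having a contact point in [e]. Being
    a preimage under the selection, it is Borel for Borel [e] and respects disjoint unions. *)
Definition single_slopes (e : set pt) : set pt := [set p | ~ multi_slopes p /\ e (sel p)].

Lemma single_slopes_borel (e : set pt) : @measurable _ bt e -> @measurable _ bt (single_slopes e).
Proof.
(* On [multi_slopes] the choice made by [sel] is arbitrary and is overwritten by a constant.
   Elsewhere the preimage of a closed set is a set of contact slopes, which is closed. *)
move=> me; pose G (p : bt) : bt := if `[< multi_slopes p >] then 0 else sel p.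
have mG : measurable_fun setT G.
  apply: (@measurability _ _ bt bt setT G (@open pt)) => //.
  move=> _ [V oV <-]; rewrite setTI.
  have -> : G @^-1` V = ~` (G @^-1` (~` V)) by rewrite preimage_setC setCK.
  apply: measurableC.
  set K := ~` V; have cK : closed K by exact: open_closedC.
  have -> : G @^-1` K = (multi_slopes `&` [set p : bt | K 0]) `|` (contact_slopes K `\` multi_slopes).
    apply/seteqP; split => p; rewrite /preimage /G /=.
      case: asboolP => np Kp; [by left|right; split => //].
      by exists (sel p) => //; exact: selP.
    move=> [[np K0]|[[x Kx px] np]]; case: asboolP => //.
    by rewrite (contact_unique np (selP p) px).
  apply: measurableU; last first.
    by apply: measurableD; [apply: closed_borel; exact: closed_contact_slopes|exact: multi_slopes_borel].
  apply: measurableI; first exact: multi_slopes_borel.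
  have [K0|K0] := pselect (K 0).
    have -> : [set p : bt | K 0] = setT by apply/seteqP; split.
    exact: measurableT.
  have -> : [set p : bt | K 0] = set0 by apply/seteqP; split.
  exact: measurable0.
have -> : single_slopes e = G @^-1` e `\` multi_slopes.
  apply/seteqP; split => p; rewrite /preimage /G /=.
    by move=> [np ep]; case: asboolP.
  by move=> [+ np]; case: asboolP.
apply: measurableD; last exact: multi_slopes_borel.
by rewrite -[X in measurable X]setTI; exact: mG.
Qed.

Lemma contact_subdiff U p x : U `<=` C -> C `<=` closure U -> U x ->
  contact p x <-> subdiff U u x p.
Proof.
move=> UC CU Ux; split=> [[_ h] y Uy|h].
  by have := h y (UC _ Uy); rewrite dotvDr dotvNr; lra.
split; first exact: UC.
move=> y Cy; rewrite leNgt; apply/negP => lt_y.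
have ctp := tilt_continuous (p := p) (@subset_refl _ C).
move/(@continuous_within_epsdelta R pt R) : ctp.
set d := u x - dotv p x - (u y - dotv p y).
have d0 : 0 < d by rewrite subr_gt0.
move=> /(_ y Cy d d0) [e e0 he].
have [z Uz zy] := (closure_epsP U y).1 (CU _ Cy) e e0.
have := he z (UC _ Uz) zy; have := h z Uz; rewrite dotvDr dotvNr ltr_norml /d.
by move=> h1 /andP[_ h2]; lra.
Qed.

Lemma weight_subdiff_img (leb nu : {measure set bt -> \bar R}) (Rf : pt -> R) U e :
  is_lebesgue leb -> weight_of leb Rf nu -> U `<=` C -> C `<=` closure U ->
  @measurable _ bt e -> e `<=` U ->
  (\int[leb]_(p in subdiff_img U u e) (Rf p)%:E)%E = nu (single_slopes e).
Proof.
move=> hleb hnu UC CU me eU.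
apply: (weight_integral hnu (N := multi_slopes)).
- exact: single_slopes_borel.
- exact: multi_slopes_borel.
- exact: multi_slopes_null.
move=> p np; split=> [[x ex xp]|[_ ep]].
  have px : contact p x by apply/(contact_subdiff p UC CU) => //; exact: eU.
  by split => //; rewrite (contact_unique np (selP p) px).
by exists (sel p) => //; apply/(contact_subdiff p UC CU); [exact: eU|exact: selP].
Qed.

End Contact.

(** * Comparison of two functions of equal mass *)

Section Comparison.
Variables (R : realType) (n : nat).
Local Notation pt := 'rV[R]_n.+1.
Local Notation bt := (borel_pt R n.+1).
Variables (leb nu : {measure set bt -> \bar R}) (Rf : pt -> R).
Hypotheses (hleb : is_lebesgue leb) (hnu : weight_of leb Rf nu).

(* Points of a translated segment avoid a null set, so no Fubini argument is needed. *)
Lemma common_subgradient_diff (f1 f2 : pt -> R) (S : pt -> pt) (Z : set pt) (B L : R) :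
  @measurable _ bt Z -> leb Z = 0%E -> (forall p, ~ Z p -> `|S p| <= B) ->
  (forall p q, `|f1 p - f1 q| <= L * `|p - q|) ->
  (forall p q, `|f2 p - f2 q| <= L * `|p - q|) ->
  (forall p q, ~ Z p -> f1 p + dotv (q - p) (S p) <= f1 q) ->
  (forall p q, ~ Z p -> f2 p + dotv (q - p) (S p) <= f2 q) ->
  forall p q, f1 p - f2 p = f1 q - f2 q.
Proof.
move=> mZ Z0 SB L1 L2 S1 S2 p q; pose f p := f1 p - f2 p.
suff key N : (0 < N)%N ->
    `|f q - f p| <= (2 * B * n.+1%:R * `|q - p| + 4 * `|L|) / N%:R.
  apply/esym/eqP; rewrite -subr_eq0 -/(f q) -/(f p) -normr_eq0 eq_le normr_ge0 andbT.
  rewrite leNgt; apply/negP => d0; set A := (2 * B * _ * _ + _) in key.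
  have := key (Num.truncn (A / `|f q - f p|)).+1 isT; rewrite leNgt => /negP; apply.
  by rewrite ltr_pdivrMr // mulrC -ltr_pdivrMr // truncnS_gt.
move=> N0; have N0' : 0 < N%:R :> R by rewrite ltr0n.
pose e : pt := N%:R^-1 *: (q - p).
(* The bad shifts form a countable union of translates of [Z], a null set, which cannot cover a
   ball. *)
have [z zN zZ] : exists2 z : pt, `|z| < N%:R^-1 & forall k, (k <= N)%N -> ~ Z (z + (p + k%:R *: e)).
  apply: contrapT => nz.
  pose F (k : nat) : set bt := (fun z : pt => z + (p + k%:R *: e)) @^-1` Z.
  have mF k : measurable (F k).
    rewrite -[X in measurable X]setTI; apply: continuous_borel => //.
    exact: translate_continuous.
  have : (0 < leb (ball (0%R : pt) (N%:R^-1)%R))%E.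
    apply: leb_open_gt0 => //; first exact: ball_open.
    by exists 0; apply: ballxx; rewrite invr_gt0.
  rewrite ltNge => /negP; apply.
  have sub : ball (0 : pt) N%:R^-1 `<=` \bigcup_k F k.
    move=> z; rewrite -ball_normE /= sub0r normrN => zN; apply: contrapT => nF.
    by apply: nz; exists z => // k _ Zk; apply: nF; exists k.
  apply: (@le_trans _ _ (leb (\bigcup_k F k))).
    apply: le_measure; rewrite ?inE //; first by apply: open_borel; exact: ball_open.
    by apply: bigcupT_measurable.
  apply: le_trans (generalized_Boole_inequality leb mF _) _.
    by apply: bigcupT_measurable.
  by rewrite eseries0 // => k _ _; rewrite /F leb_translate.
pose P k := z + (p + k%:R *: e).
have PS k : P k.+1 - P k = e.
  by rewrite /P -natr1 scalerDl scale1r; apply/rowP => i; rewrite !mxE; ring.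
(* Over one step both functions increase by an amount between [dotv e (S (P k))] and
   [dotv e (S (P k.+1))]. The sum of the gaps telescopes to a bounded quantity times [e], which is
   of order [1 / N]. *)
have tele k : (k <= N)%N -> `|f (P k) - f (P 0)| <= dotv e (S (P k) - S (P 0)).
  elim: k => [|k IH] kN; first by rewrite !subrr normr0 dotv0r.
  have := IH (ltnW kN).
  have a1 := S1 _ (P k.+1) (zZ k (ltnW kN)); have a2 := S2 _ (P k.+1) (zZ k (ltnW kN)).
  have b1 := S1 _ (P k) (zZ k.+1 kN); have b2 := S2 _ (P k) (zZ k.+1 kN).
  rewrite -/(P k) -/(P k.+1) in a1 a2 b1 b2.
  rewrite PS in a1 a2; rewrite -(opprB (P k.+1)) PS dotvNl in b1 b2.
  rewrite !dotvDr !dotvNr !ler_norml /f => /andP[c1 c2]; apply/andP; split; lra.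
have PN : P N = z + q.
  rewrite /P /e scalerA divff ?gt_eqF // scale1r; congr (_ + _).
  by rewrite addrC subrK.
have P0 : P 0 = z + p by rewrite /P scale0r addr0.
have he : dotv e (S (P N) - S (P 0)) <= 2 * B * n.+1%:R * `|q - p| / N%:R.
  apply: le_trans (ler_norm _) _; apply: le_trans (dotv_le_norm _ _) _.
  have -> : `|e| = `|q - p| / N%:R.
    by rewrite normrZ gtr0_norm ?invr_gt0 // mulrC.
  have hS : `|S (P N) - S (P 0)| <= 2 * B.
    apply: le_trans (ler_normB _ _) _.
    have := SB _ (zZ N (leqnn N)); have := SB _ (zZ 0 (leq0n N)); rewrite -/(P N) -/(P 0); lra.
  have : n.+1%:R * (`|q - p| / N%:R) * `|S (P N) - S (P 0)| <= n.+1%:R * (`|q - p| / N%:R) * (2 * B).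
    by rewrite ler_wpM2l // !mulr_ge0 // invr_ge0 ltW.
  move=> /le_trans; apply; rewrite le_eqVlt; apply/orP; left; apply/eqP; ring.
have lip (r : pt) : `|f (z + r) - f r| <= 2 * `|L| / N%:R.
  have h1 := L1 (z + r) r; have h2 := L2 (z + r) r; rewrite addrK in h1 h2.
  have h3 : L * `|z| <= `|L| / N%:R.
    apply: (@le_trans _ _ (`|L| * `|z|)); first by rewrite ler_wpM2r // ler_norm.
    by rewrite ler_wpM2l // ltW.
  move: h1 h2; rewrite !ler_norml /f => /andP[? ?] /andP[? ?]; apply/andP; split; lra.
have := le_trans (tele N (leqnn N)) he; have := lip p; have := lip q; rewrite PN P0.
rewrite !ler_norml => /andP[? ?] /andP[? ?] /andP[? ?]; apply/andP; split; lra.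
Qed.

Variables (U : set pt) (u v : pt -> R).
Hypotheses (oU : open U) (cU : Defs.convex_set U) (U0 : U !=set0) (bU : Defs.bounded_set U).
Local Notation C := (closure U).

Lemma closure_compact : compact C.
Proof.
have [B hB] := bU; apply: bounded_closed_compact; last exact: closed_closure.
exists (B + 1); split; first by rewrite num_real.
move=> M hM x /closure_epsP /(_ 1 ltr01) [y /hB yB xy].
apply: ltW; apply: le_lt_trans hM; rewrite -(subrK y x).
apply: le_trans (ler_normD _ _) _.
have := le_trans (norm_le_enorm y) yB; move: xy; rewrite distrC; lra.
Qed.

Let C0 : C !=set0.
Proof. by have [x Ux] := U0; exists x; exact: subset_closure. Qed.

Lemma conj_lipschitz (w : pt -> R) : {within C, continuous w} ->
  exists2 L, 0 <= L & forall p q, `|conj C w p - conj C w q| <= L * `|p - q|.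
Proof.
move=> cw; have Cc := closure_compact.
have [B B0 hB] : exists2 B : R, 0 < B & forall x, C x -> `|x| <= B.
  have /compact_bounded [B [_ hB]] := Cc.
  exists (`|B| + 1) => [|x Cx]; first by rewrite ltr_wpDl.
  by apply: (hB (`|B| + 1)) => //; rewrite (le_lt_trans (ler_norm _)) // ltrDl.
exists (n.+1%:R * B); first by rewrite mulr_ge0 // ltW.
suff key p q : conj C w p - conj C w q <= n.+1%:R * B * `|p - q|.
  move=> p q; rewrite ler_norml key andbT -lerN2 opprK opprB distrC; exact: key.
have := conj_subgradient Cc C0 cw q (selP Cc C0 cw p).
have := le_trans (ler_norm _) (dotv_le_norm (p - q) (sel C w p)).
have := ler_wpM2l (mulr_ge0 (ler0n R n.+1) (normr_ge0 (p - q))) (hB _ (selP Cc C0 cw p).1).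
rewrite -(opprB p q) dotvNl => h1 h2 h3.
have -> : n.+1%:R * B * `|p - q| = n.+1%:R * `|p - q| * B by ring.
lra.
Qed.

Hypotheses (cu : {within C, continuous u}) (cv : {within C, continuous v}).
Hypothesis uv_bnd : forall x, bnd U x -> u x = v x.
Hypothesis cvxu : convex_on U u.
(* [b] is an exposed boundary point with inner normal [a]. *)
Variables (a b : pt).
Hypothesis exposed : bnd U b /\ (forall x, C x -> 0 <= dotv a (x - b)) /\
  forall e, 0 < e -> exists2 k, 0 < k & forall x, C x -> dotv a (x - b) < k -> `|x - b| < e.
Hypothesis same_mass : forall e : set pt, @measurable _ bt e -> e `<=` U ->
  (nu (single_slopes C u e) < +oo)%E /\ nu (single_slopes C u e) = nu (single_slopes C v e).

Let Cc := closure_compact.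

Let W d : set pt := [set x | U x /\ d < u x - v x].

Let W_open d : open (W d).
Proof.
apply/(@open_epsP R pt) => x [Ux dx].
have [e1 e10 h1] := (open_epsP U).1 oU x Ux.
move/(@continuous_within_epsdelta R pt R) : (cu) => ctu.
move/(@continuous_within_epsdelta R pt R) : (cv) => ctv.
have g0 : 0 < (u x - v x - d) / 2 by rewrite divr_gt0 // subr_gt0.
have [e2 e20 h2] := ctu x (subset_closure Ux) _ g0.
have [e3 e30 h3] := ctv x (subset_closure Ux) _ g0.
exists (Num.min e1 (Num.min e2 e3)); first by rewrite !lt_min e10 e20.
move=> y; rewrite !lt_min => /andP[/h1 Uy /andP[y2 y3]]; split => //.
have := h2 y (subset_closure Uy) y2; have := h3 y (subset_closure Uy) y3.
rewrite !ltr_norml => /andP[? ?] /andP[? ?]; lra.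
Qed.

Let Wu d p : W d (sel C u p) -> d < conj C v p - conj C u p.
Proof.
move=> [Ux dx]; have := conj_ge Cc C0 cv p (subset_closure Ux).
rewrite (conjE Cc C0 cu (selP Cc C0 cu p)); lra.
Qed.

(** The sign of [d] excludes boundary minimisers, since [u = v] there. *)
Let Wv d p : 0 <= d -> d < conj C v p - conj C u p -> W d (sel C v p).
Proof.
move=> d0 dp; have px := selP Cc C0 cv p; set x := sel C v p in px *.
have dx : d < u x - v x.
  have := conj_ge Cc C0 cu p px.1; have := conjE Cc C0 cv px; lra.
split => //; apply: contrapT => nUx.
have : bnd U x by split; [exact: px.1|move=> /interior_subset].
by move/uv_bnd => e; move: dx; rewrite e subrr ltNge d0.
Qed.

Let bad (d : rat) : set pt := single_slopes C v (W (ratr d)) `\` single_slopes C u (W (ratr d)).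

Let Z : set pt := multi_slopes C u `|` multi_slopes C v `|`
  \bigcup_(d in [set d : rat | 0 <= d]) bad d.

Let mZ : @measurable _ bt Z.
Proof.
apply: measurableU.
  by apply: measurableU; [exact: multi_slopes_borel|exact: multi_slopes_borel].
rewrite bigcup_mkcond; apply: bigcupT_measurable_rat => d; case: ifP => // _.
by apply: measurableD; apply: single_slopes_borel => //; exact: open_borel.
Qed.

(** By [Wu] and [Wv] the set [A] lies in [B] up to a null set. As their weights are equal and
    finite, the difference has weight 0, and positivity of the density turns this into Lebesgue
    measure 0. *)
Let bad_null d : 0 <= d -> leb (bad d) = 0%E.
Proof.
move=> d0; have mW : @measurable _ bt (W (ratr d)) by exact: open_borel.
have WU : W (ratr d) `<=` U by move=> x [].
have [fin eq] := same_mass mW WU.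
have d0' : 0 <= ratr d :> R by rewrite ler0q.
have mA := single_slopes_borel Cc C0 cu mW; have mB := single_slopes_borel Cc C0 cv mW.
set A := single_slopes C u _ in fin eq mA *; set B := single_slopes C v _ in eq mB *.
have mMv : @measurable _ bt (multi_slopes C v) by exact: multi_slopes_borel.
have AB : A `<=` (A `&` B) `|` multi_slopes C v.
  move=> p [np Wp]; have [mp|nmp] := pselect (multi_slopes C v p); [by right|left].
  by split => //; split => //; apply: Wv => //; exact: Wu.
have nuAB : nu (A `&` B) = nu A.
  apply/eqP; rewrite eq_le; apply/andP; split.
    by apply: le_measure; rewrite ?inE //; exact: measurableI.
  have mAB : @measurable _ bt (A `&` B) by exact: measurableI.
  apply: (@le_trans _ _ (nu ((A `&` B) `|` multi_slopes C v))).
    by apply: le_measure; rewrite ?inE //; exact: measurableU.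
  have U2 : (nu ((A `&` B) `|` multi_slopes C v) <= nu (A `&` B) + nu (multi_slopes C v))%E by exact: measureU2.
  apply: le_trans U2 _; rewrite (weight_null hnu mMv) ?adde0 //.
  exact: multi_slopes_null.
have mBA : @measurable _ bt (B `\` A) by exact: measurableD.
suff nu0 : nu (B `\` A) = 0%E.
  apply/eqP; apply: contraTT isT => l0.
  have : (0 < leb (bad d))%E by rewrite lt_neqAle eq_sym l0 measure_ge0.
  by move=> /(weight_gt0 hnu mBA); rewrite nu0 ltxx.
have mD : (nu B = nu (B `\` A) + nu (B `&` A))%E by exact: measureDI.
rewrite setIC nuAB -eq in mD.
have finA : nu A \is a fin_num by rewrite ge0_fin_numE.
have : (nu A - nu A = nu (B `\` A))%E by rewrite {1}mD addeK.
by rewrite subee.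
Qed.

Let Z_null : leb Z = 0%E.
Proof.
have cover : Z `<=` \bigcup_k (if k is k.+1 then (if unpickle k is Some d then
    (if 0 <= (d : rat) then bad d else set0) else set0) else multi_slopes C u `|` multi_slopes C v).
  move=> p [hp|[d d0 hp]]; first by exists 0.
  have d0' : (0 <= d) = true by exact: d0.
  by exists (pickle d).+1 => [//|]; rewrite pickleK d0'.
set F := fun k => _ in cover.
have mF k : @measurable _ bt (F k).
  case: k => [|k] /=.
    by apply: measurableU; [exact: multi_slopes_borel|exact: multi_slopes_borel].
  case: unpickle => // d; case: ifP => // _.
  by apply: measurableD; apply: single_slopes_borel => //; exact: open_borel.
have F0 k : leb (F k) = 0%E.
  case: k => [|k] /=; last first.
    by case: unpickle => [d|]; [case: ifPn => [/bad_null//|_]|]; rewrite measure0.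
  have U2 : (leb (multi_slopes C u `|` multi_slopes C v) <= leb (multi_slopes C u) + leb (multi_slopes C v))%E.
    by apply: measureU2; [exact: multi_slopes_borel|exact: multi_slopes_borel].
  apply/eqP; rewrite eq_le measure_ge0 andbT (le_trans U2) //.
  by rewrite !multi_slopes_null ?adde0.
apply/eqP; rewrite eq_le measure_ge0 andbT.
apply: (@le_trans _ _ (leb (\bigcup_k F k))).
  by apply: le_measure; rewrite ?inE //; exact: bigcupT_measurable.
apply: le_trans (generalized_Boole_inequality leb mF _) _; first exact: bigcupT_measurable.
by rewrite eseries0.
Qed.

(** Otherwise a rational [d >= 0] fits strictly between [u - v] at the minimiser for [u] and the
    difference of the transforms. Then [p] belongs to [bad d], hence to [Z]. *)
Let sel_contact p : ~ Z p -> conj C u p < conj C v p -> contact C v p (sel C u p).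
Proof.
move=> nZ lt_p; have px := selP Cc C0 cu p; split; first exact: px.1.
set x := sel C u p in px *; move=> y Cy; have h1 := conj_ge Cc C0 cv p Cy.
suff : conj C v p - conj C u p <= u x - v x by have := conjE Cc C0 cu px; lra.
rewrite leNgt; apply/negP => lt_x.
have [d] : exists2 d : rat, Num.max 0 (u x - v x) < ratr d :> R & ratr d < conj C v p - conj C u p.
  have : Num.max 0 (u x - v x) < conj C v p - conj C u p.
    by rewrite gt_max lt_x andbT subr_gt0.
  by move=> /rat_in_itvoo [d]; rewrite in_itv /= => /andP[? ?]; exists d.
rewrite gt_max => /andP[d0 dx] dp.
have d0' : 0 <= ratr d :> R by exact: ltW.
have nmu : ~ multi_slopes C u p by move=> c; apply: nZ; left; left.
have nmv : ~ multi_slopes C v p by move=> c; apply: nZ; left; right.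
apply: nZ; right; exists d; first by rewrite /= -(ler0q R).
split; first by split => //; exact: Wv.
by move=> [_ [_]]; rewrite -/x; lra.
Qed.

Lemma conj_le_of_same_mass p : conj C v p <= conj C u p.
Proof.
pose f p := Num.max (conj C u p) (conj C v p).
have [Lu Lu0 hLu] := conj_lipschitz cu; have [Lv Lv0 hLv] := conj_lipschitz cv.
have [B B0 hB] : exists2 B : R, 0 < B & forall x, C x -> `|x| <= B.
  have /compact_bounded [B [_ hB]] := Cc.
  exists (`|B| + 1) => [|x Cx]; first by rewrite ltr_wpDl.
  by apply: (hB (`|B| + 1)) => //; rewrite (le_lt_trans (ler_norm _)) // ltrDl.
have cst q : f q - conj C u q = f p - conj C u p.
  apply: (common_subgradient_diff (S := sel C u) (Z := Z) (B := B) (L := Lu + Lv)) => //.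
  - by move=> r _; apply: hB; exact: (selP Cc C0 cu r).1.
  - move=> r s; have := hLu r s; have := hLv r s.
    have := normr_ge0 (r - s); set t := `|r - s| => t0.
    rewrite mulrDl !ler_norml /f => /andP[? ?] /andP[? ?].
    have := mulr_ge0 Lu0 t0; have := mulr_ge0 Lv0 t0 => ? ?.
    by rewrite /Num.max; case: ltP => ?; case: ltP => ?; apply/andP; split; lra.
  - move=> r s; apply: le_trans (hLu r s) _.
    by rewrite ler_wpM2r // lerDl.
  - move=> r s nZ; rewrite {1}/f /Num.max; case: ifPn => [c|_].
      have := conj_subgradient Cc C0 cv s (sel_contact nZ c); rewrite /f le_max => ->.
      by rewrite orbT.
    by have := conj_subgradient Cc C0 cu s (selP Cc C0 cu r); rewrite /f le_max => ->.
  by move=> r s _; have := conj_subgradient Cc C0 cu s (selP Cc C0 cu r).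
rewrite leNgt; apply/negP => lt_p.
pose c := conj C v p - conj C u p; have c0 : 0 < c by rewrite subr_gt0.
have all_c q : conj C v q = conj C u q + c.
  have := cst q; rewrite /f (max_r (ltW lt_p)) -/c => h.
  by move: h; rewrite /Num.max; case: ifP => _; lra.
have [bb [a0 hk]] := exposed; have Cb := bb.1.
move/(@continuous_within_epsdelta R pt R) : (cv) => /(_ b Cb c c0) [e e0 he].
have [k k0 {}hk] := hk e e0.
have [y Cy hy] := compact_EVT_min C0 Cc cv; rewrite inE in Cy.
(* With this steepness the contact point [x] of [v] for the slope [- s *: a] has
   [dotv a (x - b) < k], so [v x] is within [c] of [v b = u b]. At that slope the transforms then
   differ by less than [c]. *)
pose s := (v b - v y) / k + 1.
have s0 : 0 < s.
  by rewrite ltr_wpDl // divr_ge0 ?(ltW k0) // subr_ge0 hy // inE.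
have px := selP Cc C0 cv (- s *: a); set x := sel C v _ in px.
have xb : dotv a (x - b) < k.
  have := px.2 b Cb; have : v y <= v x by apply: hy; rewrite inE; exact: px.1.
  rewrite !dotvE => h1 h2.
  have h3 : s * (dotv a x - dotv a b) <= v b - v y by lra.
  have h4 : s * k = v b - v y + k by rewrite /s mulrDl divfK ?mul1r // gt_eqF.
  by rewrite -(ltr_pM2l s0) h4; lra.
have := he x px.1 (hk x px.1 xb); rewrite ltr_norml => /andP[h1 _].
have h2 := conj_ge Cc C0 cu (- s *: a) Cb.
have h3 := conjE Cc C0 cv px; have h4 := all_c (- s *: a).
have h5 : 0 <= s * dotv a (x - b) by rewrite mulr_ge0 ?(ltW s0) // a0 //; exact: px.1.
have h6 : u b = v b by exact: uv_bnd.
move: h2 h3 h5; rewrite !dotvE; lra.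
Qed.

(** The set where [u > v] is open, so it contains a point [y] with a subgradient [p] of [u]; at this
    slope the transform of [v] would exceed that of [u]. *)
Lemma le_of_same_mass x : U x -> u x <= v x.
Proof.
move=> Ux; rewrite leNgt; apply/negP => lt_x.
have Wx : W 0 x by split => //; rewrite subr_gt0.
have [e e0 he] := (open_epsP _).1 (@W_open 0) x Wx.
have ctu y : U y -> {for y, continuous u}.
  move=> Uy; apply/(@continuous_epsdelta R pt R) => d d0.
  move/(@continuous_within_epsdelta R pt R) : (cu) => /(_ y (subset_closure Uy) d d0) [r r0 hr].
  have [r' r'0 hr'] := (open_epsP U).1 oU y Uy.
  exists (Num.min r r'); first by rewrite lt_min r0.
  by move=> z; rewrite lt_min => /andP[zr zr']; apply: hr => //; apply: subset_closure; exact: hr'.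
have [y [p [Uy yx py]]] := subdiff_dense oU cvxu ctu Ux e0.
have [_ lt_y] := he y yx.
have cy : contact C u p y.
  exact: (contact_subdiff cu p (@subset_closure _ U) (@subset_refl _ C) Uy).2.
have := conj_le_of_same_mass p; rewrite (conjE Cc C0 cu cy).
have := conj_ge Cc C0 cv p (subset_closure Uy); lra.
Qed.

End Comparison.

(** * Frames at boundary points *)

Section BoundaryFrame.
Variables (R : realType) (n : nat).
Local Notation pt := 'rV[R]_n.+1.

Definition frame_coord (a0 : pt) (Q : 'M[R]_n.+1) (x : pt) : pt := (x - a0) *m Q.

Definition height (a0 : pt) (Q : 'M[R]_n.+1) (x : pt) : R := frame_coord a0 Q x 0 ord_max.

Lemma height_dotv a0 Q x : height a0 Q x = dotv (\row_i Q i ord_max) (x - a0).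
Proof. by rewrite /height mxE; apply: eq_bigr => i _; rewrite !mxE mulrC. Qed.

(** The parabolic support in the form used later, for points of the closure and not only of the
    boundary: a cap of height [l] has width of order [l] to the power [1 / (tau + 2)], and low caps
    shrink to [a0]. *)
Record boundary_frame (Omega : set pt) (tau : R) (a0 : pt) (Q : 'M[R]_n.+1) (eta c1 : R) : Prop :=
  BoundaryFrame {
    frame_orth : Q *m Q^T = 1%:M;
    frame_eta : 0 < eta;
    frame_c1 : 0 < c1;
    height_ge0 : forall x, closure Omega x -> 0 <= height a0 Q x;
    height_gt0 : forall x, Omega x -> 0 < height a0 Q x;
    frame_width : forall x, closure Omega x -> height a0 Q x < c1 ->
      forall i, i != ord_max ->
        `|frame_coord a0 Q x 0 i| <= (height a0 Q x / eta) `^ (tau + 2)^-1;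
    frame_exposed : forall e, 0 < e -> exists2 k, 0 < k &
      forall x, closure Omega x -> height a0 Q x < k -> enorm (x - a0) < e;
    dist_le_height : forall x, Omega x -> dist_set x (bnd Omega) <= height a0 Q x }.

Lemma exists_boundary_frame (Omega : set pt) (tau : R) (a0 : pt) :
  open Omega -> Defs.convex_set Omega -> 0 <= tau -> bnd Omega a0 ->
  parabolic_support Omega tau a0 ->
  exists Q eta c1, boundary_frame Omega tau a0 Q eta c1.
Proof.
move=> oO cO tau0 ba0 [Q [r [eta [last [[QQ r0 eta0 lastE] Hgt _ Hpar]]]]].
have lE : last = ord_max.
  by apply/val_inj => /=; apply/esym/eqP; rewrite -eqSS; apply/eqP.
have ltE (i : 'I_n.+1) : (i < last)%N = (i != ord_max :> 'I_n.+1).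
  rewrite lE -val_eqE /= ltn_neqAle -ltnS ltn_ord andbT //.
rewrite lE in Hgt Hpar ltE => {last lastE lE}.
pose y := frame_coord a0 Q; pose l := height a0 Q.
pose s x := Num.sqrt (\sum_(i < n.+1 | (i < @ord_max n)%N) (y x 0 i) ^+ 2).
have QQ' : Q^T *m Q = 1%:M by apply: mulmx1C.
have hgt x : Omega x -> 0 < l x by exact: Hgt.
have cl : continuous l.
  move=> x; rewrite (_ : l = fun x => dotv (\row_i Q i ord_max) (x - a0)); last first.
    by apply/funext => z; exact: height_dotv.
  apply: (@continuous_comp pt pt R (fun x => x - a0) (dotv _)).
    exact: translate_continuous.
  exact: dotv_continuous.
have hge x : closure Omega x -> 0 <= l x.
  have : closed [set x | 0 <= l x].
    by apply: (@closed_comp _ _ l [set t | 0 <= t]) => [z _|]; [exact: cl|exact: closed_ge].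
  move=> /closure_id E cx; have : closure [set x | 0 <= l x] x.
    by apply: closureS cx => z /hgt; exact: ltW.
  by rewrite -E.
have s0 x : 0 <= s x by exact: sqrtr_ge0.
have sl x : enorm (x - a0) ^+ 2 = s x ^+ 2 + l x ^+ 2.
  rewrite -(enorm_mulmx_orth (x - a0) QQ) sqr_enorm sqr_sqrtr; last first.
    by apply: sumr_ge0 => i _; rewrite sqr_ge0.
  rewrite /dotv (bigD1 ord_max) //= addrC expr2; congr (_ + _).
  by apply: eq_big => i; rewrite ?ltE // => _; rewrite expr2.
have yi x i : i != ord_max -> `|y x 0 i| <= s x.
  move=> im; rewrite -(@ler_pXn2r _ 2) ?nnegrE // sqr_sqrtr; last first.
    by apply: sumr_ge0 => j _; rewrite sqr_ge0.
  rewrite -normrX ger0_norm ?sqr_ge0 // (bigD1 i) ?ltE //= lerDl.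
  by apply: sumr_ge0 => j _; rewrite sqr_ge0.
pose a : pt := \row_i Q i ord_max.
have aQ : a *m Q = delta_mx 0 ord_max.
  rewrite (_ : a = row ord_max Q^T); last by apply/rowP => i; rewrite !mxE.
  by rewrite -row_mul QQ' row1.
have ydrop x t : y (x - t *: a) = y x - t *: delta_mx 0 ord_max.
  by rewrite /y /frame_coord addrAC mulmxBl -scalemxAl aQ.
have ldrop x t : l (x - t *: a) = l x - t.
  by rewrite /l /height -/(y _) ydrop !mxE !eqxx mulr1.
have sdrop x t : s (x - t *: a) = s x.
  rewrite /s; congr Num.sqrt; apply: eq_bigr => i; rewrite ltE => im.
  by rewrite ydrop !mxE (negbTE im) andbF mulr0 subr0.
have enorm_a : enorm a = 1.
  rewrite -(enorm_mulmx_orth a QQ) aQ /enorm /dotv (bigD1 ord_max) //= big1.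
    by rewrite mxE !eqxx mulr1 addr0 sqrtr1.
  by move=> i im; rewrite mxE (negbTE im) andbF mul0r.
(* Moving down along the normal keeps the tangential coordinates and lowers the height, so the
   estimate at the boundary point below [x] implies it at [x]. *)
have drop x : Omega x -> exists2 t, 0 <= t <= l x & bnd Omega (x - t *: a).
  move=> Ox; have nO : ~ Omega° (x - l x *: a).
    by move=> /interior_subset /hgt; rewrite ldrop subrr ltxx.
  have [t /andP[t0 t1] bt] := exists_boundary_segment Ox nO.
  exists (t * l x); first by rewrite mulr_ge0 ?(ltW (hgt _ Ox)) // ler_piMl // ltW // hgt.
  move: bt; congr bnd; apply/rowP => i; rewrite !mxE; ring.
have par x : closure Omega x -> enorm (x - a0) < r -> eta * s x `^ (tau + 2) <= l x.
  move=> cx xr; have [Ox|nO] := pselect (Omega x); last first.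
    by apply: Hpar => //; split => // /interior_subset.
  have [t /andP[t0 tl] bt] := drop x Ox.
  have := Hpar _ bt; rewrite -/(height a0 Q _) -/(l _) ldrop -/(frame_coord _ _ _).
  rewrite -/(y _) -/(s _) sdrop => h.
  apply: le_trans (h _) _; last by rewrite gerBl.
  rewrite /eball /=; apply: le_lt_trans xr.
  rewrite -(@ler_pXn2r _ 2) ?nnegrE ?enorm_ge0 // !sl sdrop ldrop lerD2l.
  by rewrite ler_pXn2r ?nnegrE ?subr_ge0 // ?(le_trans t0) // gerBl.
have tau2 : 0 < tau + 2 by lra.
(* A low but distant point is contracted towards [a0] to the distance [q / 2], where [par] applies.
   The height shrinks as well, so the tangential part is at least [q / 4] and the parabola is
   violated. *)
have expo e : 0 < e -> exists2 k, 0 < k & forall x, closure Omega x -> l x < k -> enorm (x - a0) < e.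
  move=> e0; pose q := Num.min r e; have q0 : 0 < q by rewrite lt_min r0.
  have [qr qe] : q <= r /\ q <= e by rewrite /q !ge_min !lexx orbT.
  have q40 : 0 < q / 4 by rewrite divr_gt0.
  exists (Num.min (q / 4) (eta * (q / 4) `^ (tau + 2))).
    by rewrite lt_min q40 mulr_gt0 // powR_gt0.
  move=> x cx; rewrite lt_min => /andP[lx1 lx2].
  apply: lt_le_trans qe; rewrite ltNge; apply/negP => qx.
  have E0 : 0 < enorm (x - a0) by exact: lt_le_trans qx.
  pose t := q / 2 / enorm (x - a0).
  have t0 : 0 < t by rewrite !divr_gt0.
  have t1 : t <= 1 by rewrite ler_pdivrMr // mul1r; lra.
  pose x' := (1 - t) *: a0 + t *: x.
  have cx' : closure Omega x'.
    by apply: (convex_set_closure cO) => //; [exact: ba0.1|rewrite (ltW t0)].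
  have x'E : x' - a0 = t *: (x - a0) by apply/rowP => i; rewrite !mxE; ring.
  have lx' : l x' = t * l x.
    by rewrite /l !height_dotv x'E dotvZr.
  have ex' : enorm (x' - a0) = q / 2.
    have : enorm (x' - a0) ^+ 2 = (q / 2) ^+ 2.
      by rewrite sqr_enorm x'E dotvZl dotvZr -sqr_enorm mulrA -expr2 -exprMn /t divfK ?gt_eqF.
    by move/eqP; rewrite eqrXn2 ?enorm_ge0 ?divr_ge0 ?(ltW q0) // => /eqP.
  have lx'2 : l x' < q / 4.
    by rewrite lx'; apply: le_lt_trans lx1; rewrite ler_piMl // hge.
  have sx' : q / 4 <= s x'.
    rewrite -(@ler_pXn2r _ 2) ?nnegrE ?(ltW q40) //.
    have := sl x'; rewrite ex' => h.
    have : l x' ^+ 2 <= (q / 4) ^+ 2 by rewrite ler_pXn2r ?nnegrE ?hge // ltW.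
    have : 0 < (q / 4) ^+ 2 by rewrite exprn_gt0.
    have h2 : (q / 2) ^+ 2 = 4 * (q / 4) ^+ 2 by field.
    lra.
  have := par x' cx'; rewrite ex' => /(_ ltac:(lra)).
  have : eta * (q / 4) `^ (tau + 2) <= eta * s x' `^ (tau + 2).
    by rewrite ler_pM2l // ge0_ler_powR ?nnegrE // ltW.
  have : l x' <= l x by rewrite lx' ler_piMl // hge.
  lra.
have [c1 c10 hc1] := expo r r0.
exists Q, eta, c1; split => //.
- move=> x cx xc i im; apply: le_trans (yi x i im) _.
  have -> : s x = (s x `^ (tau + 2)) `^ (tau + 2)^-1.
    by rewrite -powRrM divff ?gt_eqF // powRr1.
  rewrite ge0_ler_powR ?nnegrE ?invr_ge0 ?powR_ge0 ?divr_ge0 ?hge ?(ltW eta0) ?(ltW tau2) //.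
  by rewrite ler_pdivlMr // mulrC par // hc1.
move=> x Ox; have [t /andP[t0 tl] bt] := drop x Ox.
apply: le_trans tl; apply: ge_inf; last first.
  exists (x - t *: a) => //; rewrite opprB addrC subrK.
  by rewrite /enorm dotvZl dotvZr mulrA sqrtrM ?mulr_ge0 // -expr2 sqrtr_sqr ger0_norm // -/(enorm a) enorm_a mulr1.
by exists 0 => _ [z _ <-]; exact: enorm_ge0.
Qed.

End BoundaryFrame.

(** * Uniform bounds *)

Section SlopeIn.
Variables (R : realType) (n : nat).
Local Notation pt := 'rV[R]_n.+1.
Local Notation bt := (borel_pt R n.+1).

(** The device for locating contact nodes in the uniform bound, the barrier and the passage to the
    limit. The tilted nodal data have a minimum not above the tilted value at [y], so the minimising
    vertex can only be a node in [P]. *)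
Lemma fe_slope_in (leb mu : {measure set bt -> \bar R}) (Omega : set pt) (g Rf v : pt -> R)
    (M : mesh R n.+1) (h : R) (P : set pt) (p y : pt) :
  is_mesh Omega M h -> fe_solution leb mu M g Rf v -> closure (mesh_dom M) y ->
  (forall V, is_vertex M V -> ~ mesh_dom M V -> v y - dotv p y < g V - dotv p V) ->
  (forall V, is_vertex M V -> mesh_dom M V -> ~ P V -> v y - dotv p y < v V - dotv p V) ->
  fe_slopes M v P p.
Proof.
move=> hM hv cy hB hD; have [w [wB vw wv]] := fe_vertex_values hM hv.
have [V vV hV] := vertex_argmin hM (fun V => w V - dotv p V).
have wy : w V - dotv p V <= v y - dotv p y.
  suff : dotv p y + (w V - dotv p V) <= v y by lra.
  by apply: wv => // V' /hV; lra.
have DV : mesh_dom M V.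
  by apply: contrapT => nD; have := hB V vV nD; rewrite -wB //; lra.
have PV : P V.
  by apply: contrapT => nP; have := hD V vV DV nP; have := vw V vV; lra.
by exists V => //; exact: fe_contact vw wv vV hV.
Qed.

End SlopeIn.

Section UniformBound.
Variables (R : realType) (n : nat).
Local Notation pt := 'rV[R]_n.+1.
Local Notation bt := (borel_pt R n.+1).
Variables (leb mu nu : {measure set bt -> \bar R}) (Omega : set pt) (g Rf : pt -> R).
Hypotheses (hleb : is_lebesgue leb) (hnu : weight_of leb Rf nu).
Hypotheses (oO : open Omega) (cO : Defs.convex_set Omega) (O0 : Omega !=set0)
  (bO : Defs.bounded_set Omega).

Lemma closure_bound : exists2 B, 0 < B & forall x, closure Omega x -> `|x| <= B.
Proof.
have /compact_bounded [B [_ hB]] := closure_compact bO.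
exists (`|B| + 1) => [|x Cx]; first by rewrite ltr_wpDl.
by apply: (hB (`|B| + 1)) => //; rewrite (le_lt_trans (ler_norm _)) // ltrDl.
Qed.

Lemma bnd_compact : compact (bnd Omega).
Proof.
apply: (@subclosed_compact _ _ (closure Omega)); last by move=> x [].
- rewrite /bnd setDE; apply: closedI; first exact: closed_closure.
  by apply: open_closedC; exact: open_interior.
- exact: closure_compact.
Qed.

Hypothesis cg : {within bnd Omega, continuous g}.

Lemma boundary_values_bounded : exists2 G, 0 < G & forall x, bnd Omega x -> `|g x| <= G.
Proof.
have /compact_bounded [B [_ hB]] := continuous_compact cg bnd_compact.
exists (`|B| + 1) => [|x Cx]; first by rewrite ltr_wpDl.
apply: (hB (`|B| + 1)); last by exists x.
by rewrite (le_lt_trans (ler_norm _)) // ltrDl.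
Qed.

Hypothesis mass : (mu Omega < nu setT)%E.

Lemma mass_ball : exists k : nat, (mu Omega < nu [set p : pt | (`|p| <= k%:R)%R])%E.
Proof.
pose F (k : nat) : set bt := [set p : pt | `|p| <= k%:R].
have mF k : measurable (F k) by apply: closed_borel; exact: closed_norm_le.
have cvF : nu \o F @ \oo --> nu (\bigcup_k F k).
  apply: nondecreasing_cvg_mu => //; first exact: bigcupT_measurable.
  move=> i j ij; apply/subsetPset => p; rewrite /F /= => /le_trans; apply.
  by rewrite ler_nat.
have UF : \bigcup_k F k = setT.
  rewrite -subTset => p _; exists (Num.truncn `|p|).+1 => //.
  by rewrite /F /= ltW // truncnS_gt.
apply: contrapT => nk; have le_k k : (nu (F k) <= mu Omega)%E.
  by rewrite leNgt; apply/negP => c; apply: nk; exists k.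
have : (limn (nu \o F) <= mu Omega)%E.
  apply: lime_le; first by apply/cvg_ex; eexists; exact: cvF.
  by apply: nearW => k; exact: le_k.
by rewrite (cvg_lim _ cvF) // UF leNgt mass.
Qed.

(** From above by the maximum principle. If [v] fell too low, all slopes of the ball from
    [mass_ball] would be realised at interior nodes, and these have total weight at most
    [mu Omega]. *)
Lemma fe_uniform_bound : exists2 B, 0 < B & forall (M : mesh R n.+1) (h : R) (v : pt -> R),
  is_mesh Omega M h -> fe_solution leb mu M g Rf v ->
  forall x, closure (mesh_dom M) x -> `|v x| <= B.
Proof.
have [G G0 hG] := boundary_values_bounded; have [k hk] := mass_ball.
have [B B0 hB] := closure_bound.
(* [E] bounds [dotv p z] for [p] in that ball and [z] in the closure. A value below [- (G + 2 * E)]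
   thus beats the tilted data at every boundary vertex. *)
pose E := n.+1%:R * k%:R * B; have E0 : 0 <= E by rewrite !mulr_ge0 // ltW.
exists (G + 2 * E); first by lra.
move=> M h v hM hv x cx; rewrite ler_norml; apply/andP; split; last first.
  have : v x <= dotv 0 x + G.
    apply: (fe_max_principle oO cO O0 bO hM hv) => // z bz.
    have := hG z bz; rewrite ler_norml dotvC dotv0r add0r => /andP[_]; lra.
  by rewrite dotvC dotv0r; lra.
rewrite leNgt; apply/negP => lt_x.
have DC z : closure (mesh_dom M) z -> closure Omega z.
  by apply: closureS; exact: (mesh_domS hM).
have pE p z : `|p| <= k%:R -> closure Omega z -> `|dotv p z| <= E.
  move=> pk cz; apply: le_trans (dotv_le_norm _ _) _.
  by rewrite /E ler_pM ?mulr_ge0 ?ler_wpM2l // hB.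
have : (nu [set p : pt | (`|p| <= k%:R)%R] <= mu Omega)%E.
  apply: (@le_trans _ _ (nu (fe_slopes M v setT))).
    apply: le_measure; rewrite ?inE.
    - by apply: closed_borel; exact: closed_norm_le.
    - exact: fe_slopes_borel.
    move=> p /= pk; apply: (fe_slope_in hM hv cx) => [V vV nD|V _ _ /(_ I)//].
    have bV := boundary_vertex hM vV nD.
    have := pE p x pk (DC _ cx); have := pE p V pk bV.1; have := hG V bV.
    rewrite !ler_norml => /andP[? ?] /andP[? ?] /andP[? ?]; lra.
  apply: (fe_slopes_le hleb hnu bO hM hv); first exact: open_borel.
  by move=> z a Dz _ _ _; exact: (mesh_domS hM).
by rewrite leNgt hk.
Qed.

End UniformBound.

(** * Boundary barriers *)

Section BarrierExponents.
Variable R : realType.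

Definition exponent_condition (n : nat) (tau k lam : R) : Prop :=
  let d : R := n.+1%:R in
  let K := (d + tau + 1) / (tau + 2) + lam / 2 in
  (k < 1 \/ d / 2 <= k -> k <= K) /\ (1 <= k < d / 2 -> k < K).

(* [N = 1] suffices below the critical exponent; at [k = K >= d / 2] the [N] dyadic slope boxes have equal weight and add up. *)
Lemma barrier_exponents (n : nat) (tau k lam U0 L0 : R) :
  0 <= tau -> 0 <= lam -> 0 < U0 -> 0 < L0 ->
  exponent_condition n tau k lam -> exists N : nat, exists2 c0 : R, 0 < c0 &
    [/\ (0 < N)%N, N = 1%N \/ n.+1%:R <= 2 * k &
    forall c, 0 < c <= c0 ->
      U0 * c `^ (lam + n%:R * (tau + 2)^-1 + 1) <
      N%:R * (L0 * c `^ (2 * k - n%:R * (tau + 2)^-1 - 1))].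
Proof.
move=> tau0 lam0 U00 L00 /= [k1 k2].
have tau2 : 0 < tau + 2 by lra.
set K := (n.+1%:R + tau + 1) / (tau + 2) + lam / 2 in k1 k2.
have KE : K = 1 + n%:R * (tau + 2)^-1 + lam / 2.
  by rewrite /K -natr1; field; lra.
(* The exponent of the cap mass minus that of the box weight. It equals [2 * (K - k)], which is
   where [K] comes from. *)
pose e := lam + 2 * (n%:R * (tau + 2)^-1) + 2 - 2 * k.
have eE : e = 2 * (K - k) by rewrite /e KE; field; lra.
have split c : 0 < c -> c `^ (lam + n%:R * (tau + 2)^-1 + 1) =
    c `^ e * c `^ (2 * k - n%:R * (tau + 2)^-1 - 1).
  move=> c0; rewrite -powRD; last by apply/implyP => _; rewrite gt_eqF.
  by congr (_ `^ _); rewrite /e; ring.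
have K1 : 1 <= K.
  have : 0 <= n%:R * (tau + 2)^-1 by rewrite mulr_ge0 // invr_ge0 ltW.
  rewrite KE; lra.
have kK : k <= K.
  case: (ltP k 1) => h1; first by apply: k1; left.
  case: (ltP k (n.+1%:R / 2)) => h2; last by apply: k1; right.
  by apply: ltW; apply: k2; rewrite h1.
have [lt_k|ge_k] := ltP k K.
  have e0 : 0 < e by rewrite eE mulr_gt0 // subr_gt0.
  have q0 : 0 < L0 / (2 * U0) by rewrite divr_gt0 // mulr_gt0.
  exists 1%N, ((L0 / (2 * U0)) `^ e^-1); first by rewrite powR_gt0.
  split => //; first by left.
  move=> c /andP[c0 cc]; rewrite split // mul1r mulrA ltr_pM2r ?powR_gt0 //.
  have : c `^ e <= L0 / (2 * U0).
    apply: (@le_trans _ _ (((L0 / (2 * U0)) `^ e^-1) `^ e)).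
      by rewrite ge0_ler_powR ?nnegrE ?powR_ge0 // ltW.
    by rewrite -powRrM mulVf ?gt_eqF // powRr1 // ltW.
  rewrite -(ler_pM2l U00) => /le_lt_trans; apply.
  rewrite (_ : U0 * _ = L0 / 2); last by field; rewrite gt_eqF.
  lra.
have kE : k = K by apply/eqP; rewrite eq_le kK.
have e0 : e = 0 by rewrite eE kE subrr mulr0.
have k2d : n.+1%:R <= 2 * k.
  rewrite leNgt; apply/negP => c; have : 1 <= k < n.+1%:R / 2.
    by rewrite kE K1 -kE; lra.
  by move/k2; rewrite kE ltxx.
exists (Num.truncn (U0 / L0)).+1, 1 => //; split => //; first by right.
move=> c /andP[c0 _]; rewrite split // e0 powRr0 mul1r mulrA ltr_pM2r ?powR_gt0 //.
by rewrite -ltr_pdivrMr // truncnS_gt.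
Qed.

(** A slope box scaled by [b] loses [b ^+ n.+1] in volume, while the lower bound on the density
    gains the power of [b] with exponent [- (2 * k)]. For these [k] the smaller box has no smaller
    bound. *)
Lemma powR_dyadic_ge1 (n : nat) (k b : R) : 0 < b <= 1 -> n.+1%:R <= 2 * k ->
  1 <= b `^ (- (2 * k)) * b ^+ n * b.
Proof.
move=> /andP[b0 b1] kn.
have -> : b `^ (- (2 * k)) * b ^+ n * b = (b `^ (2 * k - n.+1%:R))^-1.
  rewrite -mulrA -exprSr -powR_mulrn ?(ltW b0) // -powRN -powRD; last by apply/implyP => _; rewrite gt_eqF.
  by congr (_ `^ _); ring.
rewrite invr_ge1 ?unitfE ?gt_eqF ?powR_gt0 //.
have : 0 <= 2 * k - n.+1%:R by lra.
set x := 2 * k - _ => x0.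
rewrite /powR gt_eqF // -[leRHS]expR0 ler_expR.
exact: mulr_ge0_le0 x0 (ln_le0 b1).
Qed.

Lemma powR_neg_le (a x y : R) : 0 <= a -> 0 < x -> x <= y -> y `^ (- a) <= x `^ (- a).
Proof.
move=> a0 x0 xy; have y0 := lt_le_trans x0 xy.
rewrite !powRN lef_pV2 ?posrE ?powR_gt0 // ge0_ler_powR ?nnegrE //; exact: ltW.
Qed.

End BarrierExponents.

(** * Slopes realised in a boundary cap *)

Section BarrierSlopes.
Variables (R : realType) (n : nat).
Local Notation pt := 'rV[R]_n.+1.
Local Notation bt := (borel_pt R n.+1).
Variables (leb mu : {measure set bt -> \bar R}) (Omega : set pt) (g Rf : pt -> R).
Hypotheses (oO : open Omega) (cO : Defs.convex_set Omega) (O0 : Omega !=set0)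
  (bO : Defs.bounded_set Omega).
Variables (tau : R) (a0 : pt) (Q : 'M[R]_n.+1) (eta c1 : R).
Hypothesis fr : boundary_frame Omega tau a0 Q eta c1.
Local Notation ht := (height a0 Q).
Local Notation fc := (frame_coord a0 Q).

Lemma dotv_orth p x : dotv p (x - a0) = \sum_i (p *m Q) 0 i * fc x 0 i.
Proof.
have QQ := frame_orth fr.
have dE (y z : pt) : dotv y z = (y *m z^T) 0 0.
  by rewrite mxE; apply: eq_bigr => i _; rewrite mxE.
rewrite -/(dotv (p *m Q) (fc x)) !dE /frame_coord trmx_mul mulmxA -(mulmxA p) QQ.
by rewrite mulmx1.
Qed.

Lemma height_dist x y : `|ht x - ht y| <= enorm (x - y).
Proof.
rewrite -(enorm_mulmx_orth (x - y) (frame_orth fr)).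
apply: le_trans (coord_le_enorm _ ord_max).
by rewrite /height /frame_coord !mulmxBl !mxE opprB addrA subrK.
Qed.

Lemma height_continuous : continuous ht.
Proof.
move=> x; apply/(@continuous_epsdelta R pt R) => e e0.
exists (e / n.+1%:R); first by rewrite divr_gt0.
move=> y yx; apply: le_lt_trans (height_dist _ _) _.
by apply: le_lt_trans (enorm_le_norm _) _; rewrite mulrC -ltr_pdivlMr.
Qed.

Lemma height_comb x y t : ht ((1 - t) *: x + t *: y) = (1 - t) * ht x + t * ht y.
Proof.
rewrite !height_dotv -!dotvZr -dotvDr; congr dotv.
by apply/rowP => i; rewrite !mxE; ring.
Qed.

Variables (eps Kc : R).
Hypothesis hA : forall x, bnd Omega x -> g a0 - eps - Kc * ht x <= g x.

(** Up to a constant, [v - p.x] is [w + q * ht - S], where [w] is the deviation from the affine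
    barrier and the tangential part [S] is at most [sig] in the cap. The depth of [y] beats the
    boundary vertices in the cap by the first inequality, and the vertices beyond it by the
    second. *)
Lemma barrier_slope (M : mesh R n.+1) (h : R) (v : pt -> R) (J th c t rho beta sig : R) (y p : pt) :
  is_mesh Omega M h -> fe_solution leb mu M g Rf v ->
  let w x := v x - (g a0 - eps - Kc * ht x) in
  let q := - (p *m Q) 0 ord_max - Kc in
  (forall x, mesh_dom M x -> ht x < c -> - (J + th) <= w x) ->
  mesh_dom M y -> ht y < t -> t <= c / 2 -> w y < - (J - th) ->
  (forall x, closure Omega x -> ht x < c -> forall i, i != ord_max -> `|fc x 0 i| <= rho) ->
  0 <= beta -> (forall i, i != ord_max -> `|(p *m Q) 0 i| <= beta) ->
  n%:R * (beta * rho) <= sig -> 0 <= q ->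
  2 * sig + th + q * t < J -> 2 * th + 2 * sig + q * t < q * (c / 2) ->
  fe_slopes M v [set x | ht x < c] p.
Proof.
move=> hM hv w q low Dy yt tc wy width beta0 pb sigE q0 H1 H2.
pose S x := \sum_(i | i != ord_max) (p *m Q) 0 i * fc x 0 i.
have clO x : closure (mesh_dom M) x -> closure Omega x.
  by apply: closureS; exact: (mesh_domS hM).
have SE x : closure Omega x -> ht x < c -> `|S x| <= sig.
  move=> cx xc; apply: le_trans (ler_norm_sum _ _ _) _; apply: le_trans sigE.
  apply: (@le_trans _ _ (\sum_(i : 'I_n.+1 | i != ord_max) beta * rho)).
    by apply: ler_sum => i im; rewrite normrM ler_pM // ?pb // width.
  by rewrite sumr_const cardC1 card_ord mulr_natl.
pose Phi f x := f x - dotv p x.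
have PhiE f x : f x - dotv p x = (f x - (g a0 - eps - Kc * ht x)) + q * ht x - S x + (g a0 - eps - dotv p a0).
  have : dotv p x = dotv p a0 + dotv p (x - a0) by rewrite dotvDr dotvNr; ring.
  rewrite dotv_orth (bigD1 ord_max) //= -/(S x) -/(ht x) => ->.
  by rewrite /q; ring.
have c0 : 0 < c by have := height_gt0 fr (mesh_domS hM oO cO O0 Dy); lra.
have yc : ht y < c by have := height_gt0 fr (mesh_domS hM oO cO O0 Dy); lra.
have cy := clO _ (subset_closure Dy).
have qy : q * ht y <= q * t by rewrite ler_wpM2l // ltW.
have := SE _ cy yc; rewrite ler_norml => /andP[Sy1 Sy2].
(* A vertex beyond the cap would, by convexity, force a too small value at height [c / 2]. *)
have far V : closure (mesh_dom M) V -> c <= ht V -> v y - dotv p y < v V - dotv p V.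
  move=> cV Vc; rewrite ltNge; apply/negP => le_V.
  have d0 : 0 < ht V - ht y by lra.
  pose s := (c / 2 - ht y) / (ht V - ht y).
  have s0 : 0 <= s by rewrite divr_ge0 ?(ltW d0) //; lra.
  have s1 : s < 1 by rewrite ltr_pdivrMr // mul1r; lra.
  pose z := (1 - s) *: y + s *: V.
  have hz : ht z = c / 2.
    by rewrite height_comb /s; field; rewrite gt_eqF.
  have Dz : mesh_dom M z.
    have -> : z = (1 - (1 - s)) *: V + (1 - s) *: y by rewrite /z addrC; congr (_ *: _ + _); ring.
    apply: (convex_closure_interior (@open_mesh_dom _ _ M) (convex_mesh_dom hM)) => //.
    by rewrite subr_gt0 s1 gerBl.
  have zc : ht z < c by have := height_gt0 fr (mesh_domS hM oO cO O0 Dy); rewrite hz; lra.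
  have := low z Dz zc; have := SE _ (clO _ (subset_closure Dz)) zc.
  rewrite ler_norml => /andP[Sz1 Sz2] wz.
  have cvx := convex_on_closure (convex_mesh_dom hM) (fe_convex hv) (fe_continuous hv).
  have s01 : 0 <= s <= 1 by rewrite s0 ltW.
  have := cvx _ _ (subset_closure Dy) cV _ s01; rewrite -/z => vz.
  have : v z - dotv p z <= v y - dotv p y.
    have -> : dotv p z = (1 - s) * dotv p y + s * dotv p V by rewrite /z dotvDr !dotvZr.
    have : s * (v V - dotv p V) <= s * (v y - dotv p y) by rewrite ler_wpM2l.
    lra.
  rewrite !PhiE -/(w z) -/(w y) hz; lra.
apply: (fe_slope_in hM hv (subset_closure Dy)) => [V vV nD|V vV DV nP]; last first.
  by apply: far; [exact: subset_closure|rewrite leNgt; apply/negP].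
have bV := boundary_vertex hM vV nD.
have cV := vertex_closure hM vV.
have [Vc|Vc] := ltP (ht V) c; last first.
  apply: lt_le_trans (far V cV Vc) _; rewrite lerD2r.
  by have [w' [wB vw _]] := fe_vertex_values hM hv; rewrite -wB // vw.
rewrite (PhiE v) (PhiE g) -/(w y); have := hA bV.
have := SE _ bV.1 Vc; rewrite ler_norml => /andP[SV1 SV2].
have : 0 <= q * ht V by rewrite mulr_ge0 // (height_ge0 fr) //; exact: bV.1.
lra.
Qed.

End BarrierSlopes.

(** * Mass of a cap and weight of slope boxes *)

Section BarrierMass.
Variables (R : realType) (n : nat).
Local Notation pt := 'rV[R]_n.+1.
Local Notation bt := (borel_pt R n.+1).
Variables (leb mu nu : {measure set bt -> \bar R}) (Omega : set pt) (Rf : pt -> R).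
Hypotheses (hleb : is_lebesgue leb) (hnu : weight_of leb Rf nu).
Hypothesis oO : open Omega.
Variables (tau : R) (a0 : pt) (Q : 'M[R]_n.+1) (eta c1 : R).
Hypothesis fr : boundary_frame Omega tau a0 Q eta c1.
Local Notation ht := (height a0 Q).
Local Notation fc := (frame_coord a0 Q).
Variable kappa : R.
Hypothesis kappa0 : 0 < kappa.
Hypothesis lebQ : forall z a : pt, (forall i, 0 <= a 0 i) ->
  leb [set x | hbox z a (x *m Q)] = (kappa * \prod_i a 0 i)%:E.

Definition last_row (A B : R) : pt := \row_i if i == ord_max then A else B.

Lemma prod_last_row A B : \prod_i last_row A B 0 i = A * B ^+ n.
Proof.
rewrite (bigD1 ord_max) //= mxE eqxx; congr (_ * _).
rewrite (eq_bigr (fun=> B)); last by move=> i /negbTE im; rewrite mxE im.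
by rewrite prodr_const cardC1 card_ord.
Qed.

Lemma mulmx_hbox_borel z a : @measurable _ bt [set x : pt | hbox z a (x *m Q)].
Proof.
have cQ : continuous (fun x : pt => x *m Q).
  move=> x; apply/(@continuous_epsdelta R pt pt) => e e0; exists (e / n.+1%:R).
    by rewrite divr_gt0.
  move=> y yd; rewrite -mulmxBl; apply: le_lt_trans (norm_le_enorm _) _.
  rewrite (enorm_mulmx_orth _ (frame_orth fr)); apply: le_lt_trans (enorm_le_norm _) _.
  by rewrite mulrC -ltr_pdivlMr.
rewrite -[X in measurable X]setTI; apply: (continuous_borel cQ) => //.
exact: hbox_borel.
Qed.

(** The cap lies in a rotated box, and its distances to the boundary are bounded by its height. *)
Lemma cap_mass (c rho C1 lam rhoD : R) : 0 < c -> 0 < rho -> 0 < C1 -> 0 <= lam ->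
  (forall e : set pt, borel e -> e `<=` eball a0 rhoD `&` Omega ->
       (mu (e `&` Omega) <=
        (C1 * (sup [set dist_set x (bnd Omega) | x in e]) `^ lam)%:E * leb e)%E) ->
  (forall x, closure Omega x -> ht x < 2 * c -> enorm (x - a0) < rhoD) ->
  (forall x, closure Omega x -> ht x < 2 * c -> forall i, i != ord_max -> `|fc x 0 i| <= rho) ->
  @measurable _ bt [set x | Omega x /\ ht x < 2 * c] /\
  (mu [set x | Omega x /\ (ht x < 2 * c)%R] <=
    (C1 * (2 * c) `^ lam * (kappa * (2 * c * (3 * rho) ^+ n)))%:E)%E.
Proof.
move=> c0 rho0 C10 lam0 hD capD width.
set E := [set x | Omega x /\ ht x < 2 * c].
have mE : @measurable _ bt E.
  apply: (@measurableI _ bt Omega [set x | ht x < 2 * c]); first exact: open_borel.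
  apply: open_borel; apply: (@open_comp _ _ ht [set t | t < 2 * c]); last exact: open_lt.
  by move=> x _; exact: (height_continuous fr).
split => //.
have -> : E = E `&` Omega by apply/seteqP; split => [x [Ox hx]|x []].
apply: le_trans (hD E mE _) _.
  by move=> x [Ox hx]; split => //; apply: capD => //; exact: subset_closure.
have d0 x : 0 <= dist_set x (bnd Omega).
  rewrite /dist_set; have [->|/set0P ne] := eqVneq [set enorm (x - z) | z in bnd Omega] set0.
    by rewrite inf0.
  by apply: lb_le_inf => // _ [z _ <-]; exact: enorm_ge0.
(* The supremum of the empty set is 0 by convention, so an empty cap is treated apart. *)
have supE : 0 <= sup [set dist_set x (bnd Omega) | x in E] <= 2 * c.
  have [->|/set0P [x Ex]] := eqVneq E set0.
    by rewrite image_set0 sup0 lexx mulr_ge0 // ltW.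
  have ub z : E z -> dist_set z (bnd Omega) <= 2 * c.
    by move=> [Oz hz]; apply: le_trans (dist_le_height fr Oz) (ltW hz).
  apply/andP; split; last by apply: ge_sup; [exists (dist_set x (bnd Omega)), x|move=> _ [z Ez <-]; exact: ub].
  apply: le_trans (d0 x) _; apply: sup_upper_bound; last by exists x.
  by split; [exists (dist_set x (bnd Omega)), x|exists (2 * c) => _ [z Ez <-]; exact: ub].
move: supE => /andP[s0 s1].
(* The sides are [3 * rho], not [2 * rho]: the box is half-open, while a coordinate may equal
   [rho]. *)
pose z := a0 *m Q + last_row 0 (- rho); pose a := last_row (2 * c) (3 * rho).
have a_ge0 i : 0 <= a 0 i by rewrite mxE; case: ifP => _; rewrite mulr_ge0 // ltW.
have lebE : (leb E <= (kappa * (2 * c * (3 * rho) ^+ n))%:E)%E.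
  rewrite -prod_last_row -(lebQ z) //; apply: le_measure; rewrite ?inE //.
    exact: mulmx_hbox_borel.
  move=> x [Ox hx] i; have fE : (x *m Q) 0 i = (a0 *m Q) 0 i + fc x 0 i.
    by rewrite /frame_coord mulmxBl; move: (x *m Q) (a0 *m Q) => u' v'; rewrite !mxE; ring.
  rewrite fE /z /a; move: (a0 *m Q) => v; rewrite ![last_row _ _ _ _]mxE [_ 0 i]mxE ![last_row _ _ _ _]mxE.
  case: eqP => [->|/eqP im].
    by rewrite -/(ht x); have := height_gt0 fr Ox; lra.
  have := width x (subset_closure Ox) hx i im; rewrite ler_norml => /andP[? ?].
  apply/andP; split; lra.
rewrite [leRHS]EFinM; apply: lee_pmul => //.
  by rewrite lee_fin mulr_ge0 ?powR_ge0 // ltW.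
by rewrite lee_fin ler_wpM2l ?(ltW C10) // ge0_ler_powR ?nnegrE // mulr_ge0 // ltW.
Qed.

(** The normal component is shifted by [Kc] so that the excess [q] of [barrier_slope] ranges over
    (2A, 4A]. Halving [A] then gives a disjoint box. *)
Definition slope_box (A beta Kc : R) : set pt :=
  [set p | hbox (last_row (- (4 * A) - Kc) (- beta)) (last_row (2 * A) (2 * beta)) (p *m Q)].

Lemma slope_boxP A beta Kc p : slope_box A beta Kc p ->
  2 * A < - (p *m Q) 0 ord_max - Kc <= 4 * A /\
  forall i, i != ord_max -> `|(p *m Q) 0 i| <= beta.
Proof.
move=> h; split.
  by have := h ord_max; rewrite ![last_row _ _ _ _]mxE eqxx => /andP[? ?]; apply/andP; split; lra.
move=> i /negbTE im; have := h i; rewrite ![last_row _ _ _ _]mxE im => /andP[? ?].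
by rewrite ler_norml; apply/andP; split; lra.
Qed.

(** On the box [enorm p] is at least [2 * A], so the bound on [Rf] applies, and at most
    [5 * n.+1%:R * A], where the decreasing power is smallest. *)
Lemma slope_box_mass (A beta Kc C0 k r0 : R) : 0 < A -> 0 < beta -> 0 <= Kc -> Kc <= A ->
  r0 <= 2 * A -> beta <= 5 * A -> 0 <= k -> 0 < C0 -> 
  (forall p, r0 <= enorm p -> C0 * enorm p `^ (- (2 * k)) <= Rf p) ->
  ((C0 * (5 * n.+1%:R * A) `^ (- (2 * k)) * (kappa * (2 * A * (2 * beta) ^+ n)))%:E
    <= nu (slope_box A beta Kc))%E.
Proof.
move=> A0 b0 K0 KA rA bA k0 C00 hB.
have mP : @measurable _ bt (slope_box A beta Kc) by exact: mulmx_hbox_borel.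
have a_ge0 i : 0 <= last_row (2 * A) (2 * beta) 0 i.
  by rewrite mxE; case: ifP => _; rewrite mulr_ge0 // ltW.
have c_ge0 : 0 <= C0 * (5 * n.+1%:R * A) `^ (- (2 * k)) by rewrite mulr_ge0 ?powR_ge0 // ltW.
apply: le_trans (weight_ge hnu mP c_ge0 _); last first.
  move=> p /slope_boxP [/andP[q1 q2] pb].
  have e1 : 2 * A <= enorm p.
    rewrite -(enorm_mulmx_orth p (frame_orth fr)).
    apply: le_trans (coord_le_enorm _ ord_max); rewrite -normrN.
    by apply: le_trans (ler_norm _); lra.
  apply: le_trans (hB p (le_trans rA e1)); rewrite ler_pM2l //.
  apply: powR_neg_le; first by rewrite mulr_ge0.
    by apply: lt_le_trans e1; rewrite mulr_gt0.
  rewrite -(enorm_mulmx_orth p (frame_orth fr)); apply: le_trans (enorm_le_norm _) _.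
  rewrite (_ : 5 * n.+1%:R * A = n.+1%:R * (5 * A)); last by ring.
  rewrite ler_wpM2l //; apply: norm_le_coord => [|i]; first by rewrite mulr_ge0 // ltW.
  have [->|im] := eqVneq i ord_max; last exact: le_trans (pb i im) bA.
  by rewrite ler_norml; apply/andP; split; lra.
by rewrite /slope_box lebQ // prod_last_row -EFinM.
Qed.

Lemma dyadic_slope_mass (A beta Kc C0 k r0 : R) (N : nat) :
  0 < A -> 0 < beta -> 0 <= Kc -> Kc <= 2^-1 ^+ N * A -> r0 <= 2^-1 ^+ N * A -> beta <= 5 * A ->
  0 <= k -> 0 < C0 -> (N = 1%N \/ n.+1%:R <= 2 * k) ->
  (forall p, r0 <= enorm p -> C0 * enorm p `^ (- (2 * k)) <= Rf p) ->
  ((N%:R * (C0 * (5 * n.+1%:R * A) `^ (- (2 * k)) * (kappa * (2 * A * (2 * beta) ^+ n))))%:E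
    <= nu (\big[setU/set0]_(j <- iota 0 N) slope_box (2^-1 ^+ j * A) (2^-1 ^+ j * beta) Kc))%E.
Proof.
pose b j : R := 2^-1 ^+ j; rewrite -/(b N) => A0 be0 K0 KA rA bA k0 C00 Nk hB.
have b0 j : 0 < b j by rewrite exprn_gt0.
have b1 j : b j <= 1 by rewrite exprn_ile1 // ?invr_ge0 // invf_le1 // ler1n.
have bmono i j : (i <= j)%N -> b j <= b i.
  by move=> ij; apply: ler_wiXn2l => //; rewrite invf_le1 // ler1n.
set LB := C0 * _ * _.
have LB0 : 0 <= LB by rewrite !mulr_ge0 ?powR_ge0 ?exprn_ge0 ?mulr_ge0 // ltW.
pose P j := slope_box (b j * A) (b j * beta) Kc.
have Pmass j : (j < N)%N -> (LB%:E <= nu (P j))%E.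
  move=> jN; have bj0 := b0 j.
  have bjA : b N * A <= b j * A by rewrite ler_wpM2r ?(ltW A0) // bmono // ltnW.
  have bjA0 : 0 < b j * A by rewrite mulr_gt0.
  apply: le_trans (@slope_box_mass (b j * A) (b j * beta) Kc C0 k r0 _ _ _ _ _ _ _ _ hB) => //; first last.
  - by rewrite mulrCA ler_pM2l.
  - lra.
  - lra.
  - by rewrite mulr_gt0.
  rewrite lee_fin.
  have -> : C0 * (5 * n.+1%:R * (b j * A)) `^ (- (2 * k)) * (kappa * (2 * (b j * A) * (2 * (b j * beta)) ^+ n)) =
      LB * (b j `^ (- (2 * k)) * b j ^+ n * b j).
    rewrite (_ : 5 * n.+1%:R * (b j * A) = b j * (5 * n.+1%:R * A)); last by ring.
    have dA0 : 0 <= 5 * n.+1%:R * A by rewrite !mulr_ge0 // ltW.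
    rewrite (powRM _ (ltW bj0) dA0) (_ : 2 * (b j * beta) = b j * (2 * beta)); last by ring.
    by rewrite exprMn /LB; ring.
  case: Nk => [N1|Nk]; last by rewrite ler_peMr // powR_dyadic_ge1 ?b0 ?b1.
  have -> : j = 0%N by apply/eqP; rewrite -leqn0 -ltnS -N1.
  by rewrite /b expr0 powR1 expr1n !mulr1.
rewrite (measure_bigsetU_null (iota_uniq 0 N)); first last.
- move=> i j _ _ ij; rewrite (_ : _ `&` _ = set0) ?measure0 //.
  apply/seteqP; split => // p [/slope_boxP [/andP[i1 i2] _] /slope_boxP [/andP[j1 j2] _]].
  have half i' j' : (i' < j')%N -> 4 * (b j' * A) <= 2 * (b i' * A).
    move=> ij'; have : b j' * A <= b i'.+1 * A by rewrite ler_wpM2r ?(ltW A0) // bmono.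
    have -> : b i'.+1 * A = b i' * A / 2 by rewrite /b exprS; field.
    lra.
  by case: (ltngtP i j) ij => // ij _; have := half _ _ ij; rewrite /b; lra.
- by move=> i; exact: mulmx_hbox_borel.
have -> : (N%:R * LB)%:E = (\sum_(j <- iota 0 N) LB%:E)%E.
  by rewrite sumEFin big_const_seq count_predT size_iota iter_addr_0 mulr_natl.
rewrite big_seq [leRHS]big_seq; apply: lee_sum => j; rewrite mem_iota /= => jN.
exact: Pmass.
Qed.

End BarrierMass.

Section BarrierPowers.
Variables (R : realType) (n : nat) (c D s : R).
Hypotheses (c0 : 0 < c) (D0 : 0 < D).

(** With the width [D] times the power [s] of [c], this and [slope_power] isolate the powers of [c]
    that [barrier_exponents] compares. *)
Lemma cap_power (C1 lam kappa : R) :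
  C1 * (2 * c) `^ lam * (kappa * (2 * c * (3 * (D * c `^ s)) ^+ n)) =
  C1 * 2 `^ lam * (kappa * (2 * (3 * D) ^+ n)) * c `^ (lam + n%:R * s + 1).
Proof.
have c_ge0 := ltW c0.
rewrite powRM // !powRD; try by apply/implyP => _; rewrite gt_eqF.
rewrite powRr1 // (mulrC n%:R) powRrM powR_mulrn ?powR_ge0 //.
by rewrite !exprMn; ring.
Qed.

Lemma slope_power (C0 d J k kappa : R) : 0 < d -> 0 < J ->
  C0 * (5 * d * (J / c)) `^ (- (2 * k)) *
    (kappa * (2 * (J / c) * (2 * (J / (16 * d * (D * c `^ s)))) ^+ n)) =
  C0 * (5 * d * J) `^ (- (2 * k)) * (kappa * (2 * J * (J / (8 * d * D)) ^+ n)) *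
    c `^ (2 * k - n%:R * s - 1).
Proof.
move=> d0 J0; have c_ge0 := ltW c0; have cs0 : 0 < c `^ s by rewrite powR_gt0.
rewrite !powRB; try by apply/implyP => _; rewrite gt_eqF.
have -> : c `^ (n%:R * s) = (c `^ s) ^+ n by rewrite mulrC powRrM powR_mulrn ?powR_ge0.
rewrite powRr1 //.
have -> : 5 * d * (J / c) = 5 * d * J * c^-1 by ring.
have dJ0 : 0 <= 5 * d * J by rewrite !mulr_ge0 // ltW.
have ci0 : 0 <= c^-1 by rewrite invr_ge0.
rewrite (powRM _ dJ0 ci0).
have -> : c^-1 `^ (- (2 * k)) = c `^ (2 * k).
  by rewrite -powR_inv1 // -powRrM mulN1r opprK.
have -> : 2 * (J / (16 * d * (D * c `^ s))) = (J / (8 * d * D)) / c `^ s.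
  by field; rewrite !gt_eqF.
rewrite expr_div_n; move: (c `^ (2 * k)) (_ `^ (- (2 * k))) ((J / (8 * d * D)) ^+ n) => x y z.
move: (c `^ s ^+ n) (exprn_gt0 n cs0) => w w0.
by field; rewrite !gt_eqF.
Qed.

End BarrierPowers.

(** * Absence of a downward jump at the boundary *)

Section Barrier.
Variables (R : realType) (n : nat).
Local Notation pt := 'rV[R]_n.+1.
Local Notation bt := (borel_pt R n.+1).
Variables (leb mu nu : {measure set bt -> \bar R}) (Omega : set pt) (g Rf : pt -> R).
Hypotheses (hleb : is_lebesgue leb) (hnu : weight_of leb Rf nu).
Hypotheses (oO : open Omega) (cO : Defs.convex_set Omega) (O0 : Omega !=set0)
  (bO : Defs.bounded_set Omega).
Variables (tau k C0 r0 C1 lam : R) (I : set R) (Th : R -> mesh R n.+1) (uh : R -> pt -> R).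
Hypotheses (tau0 : 0 <= tau) (k0 : 0 <= k) (C00 : 0 < C0) (r00 : 0 < r0) (C10 : 0 < C1) (lam0 : 0 <= lam).
Hypothesis hB : forall p, r0 <= enorm p -> C0 * enorm p `^ (- (2 * k)) <= Rf p.
Hypothesis hk : exponent_condition n tau k lam.
Hypothesis hI : forall h, I h -> is_mesh Omega (Th h) h /\ fe_solution leb mu (Th h) g Rf (uh h).
Variable B : R.
Hypothesis uhB : forall h, I h -> forall x, closure (mesh_dom (Th h)) x -> `|uh h x| <= B.
Variables (a0 : pt) (Q : 'M[R]_n.+1) (eta c1 rhoD : R).
Hypothesis fr : boundary_frame Omega tau a0 Q eta c1.
Hypothesis rhoD0 : 0 < rhoD.
Hypothesis hD : forall e : set pt, borel e -> e `<=` eball a0 rhoD `&` Omega ->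
       (mu (e `&` Omega) <=
        (C1 * (sup [set dist_set x (bnd Omega) | x in e]) `^ lam)%:E * leb e)%E.
Local Notation ht := (height a0 Q).
Variables (eps Kc : R).
Hypotheses (eps0 : 0 <= eps) (Kc0 : 0 <= Kc).
Hypothesis hA : forall x, bnd Omega x -> g a0 - eps - Kc * ht x <= g x.

Let w h x := uh h x - (g a0 - eps - Kc * ht x).

Let low s := exists2 c, 0 < c & exists2 e, 0 < e &
  forall h, I h -> h < e -> forall x, mesh_dom (Th h) x -> ht x < c -> - s <= w h x.

Let low_mono s s' : s <= s' -> low s -> low s'.
Proof.
move=> ss' [c c0 [e e0 H]]; exists c => //; exists e => // h Ih he x Dx xc.
by apply: le_trans (H h Ih he x Dx xc); rewrite lerN2.
Qed.

(** The constants suit [barrier_slope]: in units of [b j * J], the tangential part and the tolerance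
    [th] are at most 1/16 and [q * t] is at most 1/8, while [q * (c / 2)] exceeds 1. *)
Let cap_slopes (J c rho h : R) (N j : nat) (y : pt) : 0 < J -> 0 < c -> 0 < rho ->
  (j < N)%N -> I h -> mesh_dom (Th h) y -> ht y < 2^-1 ^+ N * c / 32 ->
  w h y < - (J - 2^-1 ^+ N * J / 16) ->
  (forall x, mesh_dom (Th h) x -> ht x < c -> - (J + 2^-1 ^+ N * J / 16) <= w h x) ->
  (forall x, closure Omega x -> ht x < 2 * c ->
    forall i, i != ord_max -> `|frame_coord a0 Q x 0 i| <= rho) ->
  slope_box Q (2^-1 ^+ j * (J / c)) (2^-1 ^+ j * (J / (16 * n.+1%:R * rho))) Kc
    `<=` fe_slopes (Th h) (uh h) [set x | ht x < c].
Proof.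
move=> J0 cp rho0 jN Ih Dy yt wy low_l width p /slope_boxP [/andP[q1 q2] pb].
have [hM hv] := hI Ih.
pose b j : R := 2^-1 ^+ j; pose d : R := n.+1%:R; have d0 : 0 < d by rewrite ltr0n.
pose A := J / c; pose beta := J / (16 * d * rho).
pose th := b N * J / 16; pose t := b N * c / 32.
have b0 j' : 0 < b j' by rewrite exprn_gt0.
have b1 j' : b j' <= 1 by rewrite exprn_ile1 // ?invr_ge0 // invf_le1 // ler1n.
have bmono i j' : (i <= j')%N -> b j' <= b i.
  by move=> ij; apply: ler_wiXn2l => //; rewrite invf_le1 // ler1n.
have A0 : 0 < A by rewrite divr_gt0.
have beta0 : 0 < beta by rewrite divr_gt0 // !mulr_gt0.
have t0 : 0 < t by rewrite divr_gt0 // mulr_gt0.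
have th0 : 0 < th by rewrite divr_gt0 // !mulr_gt0.
have Kc_ge0 := Kc0; have bNJ0 : 0 < b N * J by rewrite mulr_gt0.
have tc : t <= c / 2.
  have := b1 N; have : b N * c <= 1 * c by rewrite ler_wpM2r // ltW.
  rewrite /t; lra.
rewrite -/(b N) -/th -/t -/(b j) -/d -/A -/beta in yt wy low_l q1 q2 pb *.
have bjN := bmono _ _ (ltnW jN); have bj0 := b0 j; have bj1 := b1 j.
pose sig := n%:R * (b j * beta * rho).
have sigE : sig <= b j * J / 16.
  have -> : sig = b j * J / 16 * (n%:R / d).
    by rewrite /sig /beta; field; rewrite !gt_eqF.
  rewrite ler_piMr ?divr_ge0 ?mulr_ge0 ?(ltW bj0) ?(ltW J0) //.
  by rewrite ler_pdivrMr // mul1r ler_nat.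
set q := - _ - Kc in q1 q2.
have bjA0 : 0 < b j * A by rewrite mulr_gt0.
have q0 : 0 <= q by lra.
have qc : b j * J < q * (c / 2).
  have : 2 * (b j * A) * (c / 2) < q * (c / 2) by rewrite ltr_pM2r ?divr_gt0.
  by rewrite (_ : 2 * (b j * A) * (c / 2) = b j * J) // /A; field; rewrite gt_eqF.
have qt : q * t <= b N * J / 8.
  apply: (@le_trans _ _ (4 * (b j * A) * t)); first by rewrite ler_wpM2r // ltW.
  have -> : 4 * (b j * A) * t = b j * (b N * J / 8) by rewrite /A /t; field; rewrite gt_eqF.
  by rewrite ler_piMl // divr_ge0 // ltW.
have bNj : b N * J <= b j * J by rewrite ler_wpM2r // ltW.
have bj1J : b j * J <= J by rewrite ler_piMl // ltW.
have bjJ : 0 < b j * J by rewrite mulr_gt0.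
apply: (barrier_slope oO cO O0 fr hA hM hv (J := J) (th := th) (t := t) (rho := rho) (beta := b j * beta) (sig := sig) (y := y)) => //.
- by move=> x cx xc; apply: width => //; lra.
- by rewrite mulr_ge0 // ltW.
- by rewrite -/q /th; lra.
- by rewrite -/q /th; lra.
Qed.

Let no_jump (J : R) : 0 < J -> (forall th, 0 < th -> low (J + th)) ->
  (forall th, 0 < th -> ~ low (J - th)) -> False.
Proof.
move=> J0 Jlow Jnot.
have htau0 := tau0; have hk0 := k0; have hC00 := C00; have hr00 := r00; have hKc0 := Kc0.
have eta0 := frame_eta fr; have tau2 : 0 < tau + 2 by lra.
have [kappa kappa0 lebQ] := leb_rotated_box hleb (frame_orth fr).
pose d : R := n.+1%:R; have d0 : 0 < d by rewrite ltr0n.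
pose s := (tau + 2)^-1; have s0 : 0 < s by rewrite invr_gt0.
pose D := (2 / eta) `^ s; have D0 : 0 < D by rewrite powR_gt0 // divr_gt0.
pose U0 := C1 * 2 `^ lam * (kappa * (2 * (3 * D) ^+ n)).
pose L0 := C0 * (5 * d * J) `^ (- (2 * k)) * (kappa * (2 * J * (J / (8 * d * D)) ^+ n)).
have U00 : 0 < U0 by rewrite !mulr_gt0 ?powR_gt0 ?exprn_gt0 ?mulr_gt0.
have L00 : 0 < L0.
  by rewrite !mulr_gt0 ?powR_gt0 ?exprn_gt0 ?divr_gt0 ?mulr_gt0.
have [N [c0 c00 [N0 Nk HN]]] := barrier_exponents tau0 lam0 U00 L00 hk.
pose b j : R := 2^-1 ^+ j.
have b0 j : 0 < b j by rewrite exprn_gt0.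
have b1 j : b j <= 1 by rewrite exprn_ile1 // ?invr_ge0 // invf_le1 // ler1n.
have bmono i j : (i <= j)%N -> b j <= b i.
  by move=> ij; apply: ler_wiXn2l => //; rewrite invf_le1 // ler1n.
pose th := b N * J / 16; have th0 : 0 < th by rewrite divr_gt0 // mulr_gt0.
have [cl cl0 [el el0 low_l]] := Jlow th th0.
have [kD kD0 capD] := frame_exposed fr rhoD0.
have c10 := frame_c1 fr.
have bJ0 : 0 < b N * J by rewrite mulr_gt0.
have Kc1 : 0 < Kc + 1 by lra.
(* The bounds by [c1] and [kD] make the frame and the mass bound available up to height [2 * c];
   those by 1 and [2 / eta] give [c <= rho]; the last two make even the smallest box steeper than
   [Kc] and [r0]. *)
have [c [cp cle]] : exists c, 0 < c /\ [/\ [/\ c <= c0, c <= cl & c <= c1 / 4], c <= kD / 4, c <= 1 /\ c <= 2 / eta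
    & c <= b N * J / (Kc + 1) /\ c <= b N * J / r0].
  exists (Num.min (Num.min (Num.min c0 cl) (Num.min (c1 / 4) (kD / 4)))
     (Num.min (Num.min 1 (2 / eta)) (Num.min (b N * J / (Kc + 1)) (b N * J / r0)))).
  split; last by rewrite !ge_min !lexx !orbT.
  by rewrite !lt_min c00 cl0 ltr01 !divr_gt0.
move: cle => [[cc0 ccl cc1] ckD [c_1 c_eta] [cK cr]].
pose rho := (2 * c / eta) `^ s.
have rho0 : 0 < rho by rewrite powR_gt0 // divr_gt0 // mulr_gt0.
have rhoE : rho = D * c `^ s.
  by rewrite /rho /D mulrAC powRM ?divr_ge0 // ltW.
have crho : c <= rho.
  have -> : c = (c `^ (tau + 2)) `^ s by rewrite -powRrM divff ?gt_eqF // powRr1 // ltW.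
  rewrite /rho ge0_ler_powR ?nnegrE ?powR_ge0 ?divr_ge0 ?mulr_ge0 ?(ltW cp) ?(ltW s0) ?(ltW eta0) //.
  apply: (@le_trans _ _ (c `^ 2)).
    rewrite /powR gt_eqF // ler_expR ler_wnM2r ?ln_le0 //; lra.
  by rewrite powR_mulrn ?(ltW cp) // expr2 -mulrA mulrCA ler_pM2l.
pose A := J / c; have A0 : 0 < A by rewrite divr_gt0.
pose beta := J / (16 * d * rho); have beta0 : 0 < beta by rewrite divr_gt0 // !mulr_gt0.
have width x : closure Omega x -> ht x < 2 * c -> forall i, i != ord_max -> `|frame_coord a0 Q x 0 i| <= rho.
  move=> cx xc i im; apply: le_trans (frame_width fr cx _ im) _; first lra.
  rewrite ge0_ler_powR ?nnegrE ?divr_ge0 ?mulr_ge0 ?(height_ge0 fr) ?(ltW s0) ?(ltW eta0) ?(ltW cp) //.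
  by rewrite ler_pM2r ?invr_gt0 // ltW.
have capD' x : closure Omega x -> ht x < 2 * c -> enorm (x - a0) < rhoD.
  by move=> cx xc; apply: capD => //; lra.
have [mE muE] := cap_mass oO fr lebQ cp rho0 C10 lam0 hD capD' width.
set E := [set x | _ /\ _] in mE muE.
pose t := b N * c / 32; have t0 : 0 < t by rewrite divr_gt0 // mulr_gt0.
(* The failure of [low (J - th)] provides a deep point for arbitrarily fine meshes. Asking for
   [h < c] keeps the hat functions of nodes below height [c] inside the cap of height [2 * c]. *)
have [h [y [Ih hel [hc Dy] [yt wy]]]] : exists h y, [/\ I h, h < el, h < c /\ mesh_dom (Th h) y & ht y < t /\ w h y < - (J - th)].
  apply: contrapT => nex; apply: (Jnot th th0); exists t => //.
  exists (Num.min el c); first by rewrite lt_min el0.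
  move=> h Ih; rewrite lt_min => /andP[hel hc] y Dy yt.
  rewrite leNgt; apply/negP => wy; apply: nex; exists h, y; split => //.
have [hM hv] := hI Ih.
have tc : t <= c / 2.
  have := b1 N; have : b N * c <= 1 * c by rewrite ler_wpM2r // ltW.
  rewrite /t; lra.
pose P j := slope_box Q (b j * A) (b j * beta) Kc.
have Psub j : (j < N)%N -> P j `<=` fe_slopes (Th h) (uh h) [set x | ht x < c].
  move=> jN; apply: (cap_slopes J0 cp rho0 jN Ih Dy yt wy _ width) => x Dx xc.
  by apply: low_l => //; exact: lt_le_trans ccl.
have UB : (nu (\big[setU/set0]_(j <- iota 0 N) P j) <= mu E)%E.
  apply: (@le_trans _ _ (nu (fe_slopes (Th h) (uh h) [set x | ht x < c]))).
    apply: le_measure.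
    - by rewrite inE; apply: bigsetU_measurable => j _; exact: (mulmx_hbox_borel fr).
    - by rewrite inE; exact: fe_slopes_borel.
    by move=> p; rewrite -bigcup_seq => -[j /=]; rewrite mem_iota /= => jN; exact: Psub.
  apply: (fe_slopes_le hleb hnu bO hM hv) => // x a Dx va ac xa.
  split; first exact: (mesh_domS hM oO cO O0).
  have := height_dist fr x a; rewrite ler_norml => /andP[_ h2].
  by move: ac => /=; lra.
have LU : ((N%:R * (C0 * (5 * d * A) `^ (- (2 * k)) * (kappa * (2 * A * (2 * beta) ^+ n))))%:E
    <= (C1 * (2 * c) `^ lam * (kappa * (2 * c * (3 * rho) ^+ n)))%:E)%E.
  apply: le_trans muE; apply: le_trans UB.
  have bNA : b N * A = b N * J / c by rewrite mulrA.
  apply: (@dyadic_slope_mass _ _ _ _ _ _ hnu _ _ _ _ _ fr _ kappa0 lebQ A beta Kc C0 k r0) => //.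
  - by rewrite -/(b N) bNA ler_pdivlMr //; move: cK; rewrite ler_pdivlMr //; lra.
  - by rewrite -/(b N) bNA ler_pdivlMr //; move: cr; rewrite ler_pdivlMr // mulrC.
  - rewrite /beta /A ler_pdivrMr ?mulr_gt0 //.
    have h1 : 1 <= d by rewrite ler1n.
    have -> : 5 * (J / c) * (16 * d * rho) = J * (80 * d * rho / c) by field; rewrite gt_eqF.
    rewrite ler_peMr ?(ltW J0) // ler_pdivlMr // mul1r; apply: le_trans crho _.
    rewrite ler_peMl ?(ltW rho0) //; lra.
move: LU; rewrite lee_fin leNgt => /negP; apply.
rewrite /A /beta rhoE cap_power // slope_power //.
by apply: HN; rewrite cp.
Qed.

(** Admissible drops exist by the uniform bound [B]. Their infimum, if positive, would satisfy both
    hypotheses of [no_jump]. *)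
Lemma lower_barrier e : 0 < e -> exists2 c, 0 < c & exists2 d, 0 < d &
  forall h, I h -> h < d -> forall x, mesh_dom (Th h) x -> ht x < c ->
    g a0 - eps - Kc * ht x - e <= uh h x.
Proof.
move=> e0; pose S := [set s | 0 <= s /\ low s].
pose s1 := Num.max 0 (B + `|g a0|).
have Ss1 : S s1.
  split; first by rewrite le_max lexx.
  exists 1 => //; exists 1 => // h Ih _ x Dx _.
  have := uhB Ih (subset_closure Dx); rewrite ler_norml => /andP[h1 _].
  have h2 : B + `|g a0| <= s1 by rewrite le_max lexx orbT.
  have h3 := ler_norm (g a0).
  have heps0 := eps0; have [hM _] := hI Ih.
  have h4 : 0 <= Kc * ht x.
    by rewrite mulr_ge0 // (height_ge0 fr) //; apply: subset_closure; exact: (mesh_domS hM).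
  rewrite /w; lra.
have hS : has_inf S by split; [exists s1|exists 0 => s []].
have J0 : 0 <= inf S by apply: lb_le_inf; [exists s1|move=> s []].
suff J00 : inf S <= 0.
  have [s [s0 ls] lt_s] := inf_adherent e0 hS.
  have [|c c0 [d d0 H]] := low_mono (s := s) (s' := e) _ ls; first lra.
  exists c => //; exists d => // h Ih hd x Dx xc; have := H h Ih hd x Dx xc.
  rewrite /w; lra.
rewrite leNgt; apply/negP => J1; apply: (no_jump J1) => th th0.
  have [s [s0 ls] lt_s] := inf_adherent th0 hS.
  by apply: low_mono ls; exact: ltW.
(* Truncation keeps [inf S - th'] nonnegative, hence in [S], below its infimum. *)
move=> lJ; pose th' := Num.min th (inf S).
have th'0 : 0 < th' by rewrite lt_min th0 J1.
have [t1 t2] : th' <= th /\ th' <= inf S by rewrite /th' !ge_min !lexx orbT.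
have : S (inf S - th').
  by split; [rewrite subr_ge0|apply: low_mono lJ; rewrite lerB].
move=> /(ge_inf hS.2); lra.
Qed.

End Barrier.

Section BoundaryBarrier.
Variables (R : realType) (n : nat).
Local Notation pt := 'rV[R]_n.+1.
Local Notation bt := (borel_pt R n.+1).
Variables (leb mu nu : {measure set bt -> \bar R}) (Omega : set pt) (g Rf : pt -> R).
Hypotheses (hleb : is_lebesgue leb) (hnu : weight_of leb Rf nu).
Hypotheses (oO : open Omega) (cO : Defs.convex_set Omega) (O0 : Omega !=set0)
  (bO : Defs.bounded_set Omega).
Hypothesis gc : {within bnd Omega, continuous g}.
Variables (tau k C0 r0 C1 lam : R) (I : set R) (Th : R -> mesh R n.+1) (uh : R -> pt -> R).
Hypotheses (tau0 : 0 <= tau) (k0 : 0 <= k) (C00 : 0 < C0) (r00 : 0 < r0) (C10 : 0 < C1) (lam0 : 0 <= lam).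
Hypothesis hA : forall a0, bnd Omega a0 -> parabolic_support Omega tau a0.
Hypothesis hB : forall p, r0 <= enorm p -> C0 * enorm p `^ (- (2 * k)) <= Rf p.
Hypothesis hD : forall x0, bnd Omega x0 -> exists rho, 0 < rho /\
  forall e : set pt, borel e -> e `<=` eball x0 rho `&` Omega ->
    (mu (e `&` Omega) <=
      (C1 * (sup [set dist_set x (bnd Omega) | x in e]) `^ lam)%:E * leb e)%E.
Hypothesis hk : exponent_condition n tau k lam.
Hypothesis hI : forall h, I h -> is_mesh Omega (Th h) h /\ fe_solution leb mu (Th h) g Rf (uh h).
Variable B : R.
Hypothesis uhB : forall h, I h -> forall x, closure (mesh_dom (Th h)) x -> `|uh h x| <= B.

Lemma boundary_barrier a0 e : bnd Omega a0 -> 0 < e ->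
  exists2 r, 0 < r & exists2 d, 0 < d & forall h, I h -> h < d ->
    forall x, mesh_dom (Th h) x -> `|x - a0| < r -> `|uh h x - g a0| <= e.
Proof.
move=> ba e0.
have [Q [eta [c1 fr]]] := exists_boundary_frame oO cO tau0 ba (hA ba).
have [rhoD [rhoD0 hDa]] := hD ba.
have e3 : 0 < e / 3 by rewrite divr_gt0.
have [r1 r10 gr] := (continuous_within_epsdelta (bnd Omega) g).1 gc a0 ba _ e3.
have [kk kk0 kex] := frame_exposed fr r10.
have [G G0 hG] := boundary_values_bounded bO gc.
(* From height [kk] on, the affine term is at least [2 * G], which bounds the oscillation of [g];
   below [kk] continuity of [g] at [a0] suffices. The same constants give the upper barrier, to
   which the maximum principle applies. *)
pose Kc := 2 * G / kk.
have Kc0 : 0 <= Kc by rewrite divr_ge0 ?mulr_ge0 // ltW.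
have cmp x : bnd Omega x -> `|g x - g a0| <= e / 3 + Kc * height a0 Q x.
  move=> bx; have [cx _] := bx; have h0 := height_ge0 fr cx.
  have [hk1|hk1] := ltP (height a0 Q x) kk.
    have hx : `|x - a0| < r1 by apply: le_lt_trans (norm_le_enorm _) _; exact: kex.
    apply: le_trans (ltW (gr x bx hx)) _; rewrite lerDl mulr_ge0 //.
  have h1 : 2 * G <= Kc * height a0 Q x.
    by rewrite /Kc -mulrA ler_peMr ?mulr_ge0 ?(ltW G0) // mulrC ler_pdivlMr // mul1r.
  apply: le_trans (ler_normB _ _) _; have := hG _ bx; have := hG _ ba; lra.
have cmpl x : bnd Omega x -> g a0 - e / 3 - Kc * height a0 Q x <= g x.
  by move=> /cmp; rewrite ler_norml => /andP[h1 _]; lra.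
have cmpu x : bnd Omega x -> g x <= g a0 + e / 3 + Kc * height a0 Q x.
  by move=> /cmp; rewrite ler_norml => /andP[_ h1]; lra.
have [c c0 [d d0 low]] := lower_barrier hleb hnu oO cO O0 bO tau0 k0 C00 r00 C10 lam0 hB hk hI
  uhB fr rhoD0 hDa (ltW e3) Kc0 cmpl e3.
have K10 : 0 < Kc + 1 by lra.
have n0 : 0 < n.+1%:R :> R by [].
exists (Num.min (c / n.+1%:R) (e / 3 / (Kc + 1) / n.+1%:R)).
  by rewrite lt_min !divr_gt0.
exists d => // h Ih hd x Dx; rewrite lt_min !ltr_pdivlMr // => /andP[xc xe].
have [hM hv] := hI Ih.
have hx : height a0 Q x <= `|x - a0| * n.+1%:R.
  have := height_dist fr x a0; rewrite [height _ _ a0]height_dotv subrr dotv0r subr0 => h1.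
  apply: le_trans (ler_norm _) (le_trans h1 _); rewrite mulrC; exact: enorm_le_norm.
have hx0 : 0 <= height a0 Q x.
  by apply: (height_ge0 fr); apply: subset_closure; exact: (mesh_domS hM oO cO O0).
have Kh : Kc * height a0 Q x <= e / 3.
  apply: (@le_trans _ _ (Kc * (`|x - a0| * n.+1%:R))); first by rewrite ler_wpM2l.
  move: xe; set t := `|x - a0| * _; have t0 : 0 <= t by rewrite mulr_ge0.
  nra.
have l1 := low h Ih hd x Dx (le_lt_trans hx xc).
rewrite ler_norml; apply/andP; split; first lra.
pose p := Kc *: \row_i Q i ord_max.
have pE y : Kc * height a0 Q y = dotv p y - dotv p a0.
  by rewrite height_dotv -dotvZl -/p -[_ - a0]/(y + - a0) dotvDr dotvNr.
have := fe_max_principle oO cO O0 bO hM hv (p := p) (c := g a0 + e / 3 - dotv p a0) _ (subset_closure Dx).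
have h1 y : bnd Omega y -> g y <= dotv p y + (g a0 + e / 3 - dotv p a0).
  by move=> by'; have := cmpu y by'; rewrite pE; lra.
move=> /(_ h1); move: Kh; rewrite pE; lra.
Qed.

End BoundaryBarrier.

(** * Compactness *)

Lemma bnd_neq0 (R : realType) (n : nat) (U : set 'rV[R]_n.+1) :
  U !=set0 -> Defs.bounded_set U -> exists z, bnd U z.
Proof.
move=> [a Ua] [M hM].
have M0 : 0 <= M by apply: le_trans (hM a Ua); exact: enorm_ge0.
have Ub : ~ U (const_mx (M + 1)).
  move=> /hM; have := coord_le_enorm (const_mx (M + 1) : 'rV[R]_n.+1) ord0.
  by rewrite mxE; have := ler_norm (M + 1); lra.
have [|t _ bt] := @exists_boundary_segment _ _ U a (const_mx (M + 1)) Ua.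
  by move=> /interior_subset.
by exists ((1 - t) *: a + t *: const_mx (M + 1)).
Qed.

Definition small_in (R : realType) (S : set R) : set_system R :=
  filter_from [set d | 0 < d] (fun d => [set h | S h /\ h < d]).

Lemma small_in_proper (R : realType) (S : set R) :
  (forall d, 0 < d -> exists2 h, S h & h < d) -> ProperFilter (small_in S).
Proof.
move=> hS; apply: filter_from_proper; last by move=> d /hS [h Sh hd]; exists h.
apply: filter_from_filter; first by exists 1; exact: ltr01.
move=> d e d0 e0; exists (Num.min d e); first by rewrite /= lt_min; apply/andP.
by move=> h [Sh]; rewrite lt_min => /andP[hd he]; split.
Qed.

Section ConvexLimit.
Variables (R : realType) (n : nat).
Local Notation pt := 'rV[R]_n.+1.
Variables (Omega : set pt) (g : pt -> R) (I : set R) (D : R -> set pt) (uh : R -> pt -> R) (B : R).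
Hypotheses (oO : open Omega) (O0 : Omega !=set0) (bO : Defs.bounded_set Omega).
Hypothesis DO : forall h, I h -> D h `<=` Omega.
Hypothesis convuh : forall h, I h -> convex_on (D h) (uh h).
Hypothesis uhB : forall h, I h -> forall x, D h x -> `|uh h x| <= B.
Hypothesis fill : forall delta, 0 < delta -> exists hd, 0 < hd /\
  forall h, I h -> h < hd -> closure (inner_set Omega delta) `<=` D h.
Hypothesis barrier : forall a0 e, bnd Omega a0 -> 0 < e ->
  exists2 r, 0 < r & exists2 d, 0 < d & forall h, I h -> h < d ->
    forall x, D h x -> `|x - a0| < r -> `|uh h x - g a0| <= e.

Let open_interior_pt x : Omega x -> Omega° x.
Proof. by move=> Ox; apply/interior_epsP; exact: (@open_epsP R pt Omega).1 oO x Ox. Qed.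

Lemma mesh_fills x : Omega x -> exists2 r, 0 < r & exists2 d, 0 < d &
  forall h, I h -> h < d -> forall y, `|y - x| < r -> D h y.
Proof.
move=> Ox; have [r r0 hr] := (@open_epsP R pt Omega).1 oO x Ox.
have r3 : 0 < r / 3 by rewrite divr_gt0.
have [d [d0 hd]] := fill r3.
exists (r / 3) => //; exists d => // h Ih hlt y yx.
apply: (hd h Ih hlt); apply: subset_closure; split; first by apply: hr; lra.
have [z0 bz0] := bnd_neq0 O0 bO.
apply: (@lt_le_trans _ _ (2 * (r / 3))); first lra.
apply: lb_le_inf; first by exists (enorm (y - z0)), z0.
move=> _ [z bz <-]; apply: le_trans (norm_le_enorm _).
rewrite leNgt; apply/negP => yz.
have [_] := bz; apply; apply: open_interior_pt; apply: hr; have : `|z - x| <= `|z - y| + `|y - x| := ler_distD _ _ _.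
rewrite distrC in yz; lra.
Qed.

Lemma compact_mesh_fills C : compact C -> C `<=` Omega -> exists2 d, 0 < d &
  forall h, I h -> h < d -> C `<=` D h.
Proof.
move=> /compact_near_coveringP cC CO.
have FF : Filter (small_in I).
  apply: filter_from_filter; first by exists 1; exact: ltr01.
  move=> d e d0 e0; exists (Num.min d e); first by rewrite /= lt_min; apply/andP.
  by move=> h [Sh]; rewrite lt_min => /andP[hd he]; split.
have [|d d0 H] := cC R (small_in I) (fun h x => D h x) FF.
  move=> x /CO Ox; have [r r0 [d d0 H]] := mesh_fills Ox.
  exists ([set y | `|y - x| < r], [set h | I h /\ h < d]).
    split => /=; first by apply/nbhs_ballP; exists r => //= y; rewrite -ball_normE /= distrC.
    by exists d.
  by move=> [y h] /= [yx [Ih hd]]; exact: H.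
by exists d => // h Ih hd; exact: H.
Qed.

Section UltraLimit.
Variable G : set_system R.
Hypotheses (UG : UltraFilter G) (GI : small_in I `<=` G).

Let nearI d : 0 < d -> \forall h \near G, I h /\ h < d.
Proof. by move=> d0; apply: GI; exists d. Qed.

(** An ultrafilter gives limits at all points at once, so no diagonal choice of subsequences is
    made. *)
Definition ultra_limit x := if `[< Omega x >] then lim (uh h x @[h --> G]) else g x.
Local Notation u := ultra_limit.

Let PG : ProperFilter G := ultra_proper.

Let nearD x : Omega x -> \forall h \near G, D h x.
Proof.
move=> Ox; have [r r0 [d d0 H]] := mesh_fills Ox.
by apply: filterS (nearI d0) => h [Ih hd]; apply: H => //; rewrite subrr normr0.
Qed.

(** The values lie in the compact interval from [- B] to [B], where a cluster point of the image of
    an ultrafilter is its limit. *)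
Let u_cvg x : Omega x -> uh h x @[h --> G] --> u x.
Proof.
move=> Ox; rewrite /u asboolT //.
pose F : set_system R := fmap (uh ^~ x) G.
have FB : F [set` `[- B, B]].
  have Dx := nearD Ox; have := nearI ltr01.
  by apply: filterS2 Dx => h Dh [Ih _] /=; rewrite in_itv /= -ler_norml; exact: uhB.
have [p [_ clp]] := @segment_compact R (- B) B F (fmap_proper_filter _ PG) FB.
have hp : F --> p.
  move=> A Ap; have [//|nA] := in_ultra_setVsetC [set h | A (uh h x)] UG.
  by have [z [/= nAz /nAz]] := clp (~` A) A nA Ap.
by rewrite (cvg_lim _ hp).
Qed.

Lemma ultra_limit_bnd x : bnd Omega x -> u x = g x.
Proof.
move=> [_ ix]; rewrite /u asboolF // => Ox; apply: ix.
exact: open_interior_pt.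
Qed.

Let u_near x e : Omega x -> 0 < e -> \forall h \near G, `|uh h x - u x| <= e.
Proof.
move=> Ox e0; have /cvgrPdist_le/(_ e e0) := u_cvg Ox.
by apply: filterS => h; rewrite distrC.
Qed.

Lemma ultra_limit_convex : Defs.convex_set Omega -> convex_on Omega u.
Proof.
move=> cO x y Ox Oy t t01; have Oz := cO x y Ox Oy t t01.
have c2 : (1 - t) * uh h x + t * uh h y @[h --> G] --> (1 - t) * u x + t * u y.
  by apply: cvgD; (apply: cvgM; first exact: cvg_cst); exact: u_cvg.
apply: (ler_cvg_to (u_cvg Oz) c2).
near=> h; have [Ih _] : I h /\ h < 1 by near: h; exact: nearI.
have Dx : D h x by near: h; exact: nearD.
have Dy : D h y by near: h; exact: nearD.
exact: (convuh Ih Dx Dy).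
Unshelve. all: by end_near. Qed.

(* Equicontinuity: by the Lipschitz bound for convex functions inside, by the barriers at the boundary. *)
Let u_cont x e : closure Omega x -> 0 < e -> exists2 r, 0 < r &
  \forall h \near G, forall y, D h y -> `|y - x| < r -> `|uh h y - u x| <= e.
Proof.
move=> cx e0; have [Ox|Ox] := pselect (Omega x); last first.
  have bx : bnd Omega x by split => // /interior_subset.
  have [r r0 [d d0 H]] := barrier bx e0; exists r => //.
  apply: filterS (nearI d0) => h [Ih hd] y Dy yx.
  by rewrite ultra_limit_bnd //; exact: H.
have [r r0 [d d0 H]] := mesh_fills Ox.
have B0 : 0 <= B.
  have [h [Dx [Ih _]]] := filter_ex (filterI (nearD Ox) (nearI ltr01)).
  by apply: le_trans (uhB Ih Dx).
have r2 : 0 < r / 2 by rewrite divr_gt0.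
have e2 : 0 < e / 2 by rewrite divr_gt0.
pose L := 2 * B / (r / 2) + 1.
have L0 : 0 < L by rewrite ltr_wpDl // divr_ge0 ?mulr_ge0 // ltW.
exists (Num.min (r / 2) (e / 2 / L)); first by rewrite lt_min r2 divr_gt0.
near=> h => y Dy; rewrite lt_min => /andP[yr]; rewrite ltr_pdivlMr // => ye.
have [Ih hd] : I h /\ h < d by near: h; exact: nearI.
have ux : `|uh h x - u x| <= e / 2 by near: h; exact: u_near.
have := @convex_lipschitz _ _ (D h) (uh h) x (r / 2) B (convuh Ih) r2 _ y x yr.
rewrite subrr normr0 => /(_ _ r2) lip.
have : `|uh h y - uh h x| <= 2 * B / (r / 2) * `|y - x|.
  apply: lip => z; rewrite mulrC divfK // => zx.
  by have Dz := H h Ih hd z zx; split => //; exact: uhB.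
have : 2 * B / (r / 2) * `|y - x| <= `|y - x| * L.
  by rewrite mulrC ler_wpM2l // lerDl.
have : `|uh h y - u x| <= `|uh h y - uh h x| + `|uh h x - u x| := ler_distD _ _ _.
lra.
Unshelve. all: by end_near. Qed.

Lemma ultra_limit_continuous : {within closure Omega, continuous u}.
Proof.
apply/continuous_within_epsdelta => x cx e e0.
have e3 : 0 < e / 3 by rewrite divr_gt0.
have [r r0 Hx] := u_cont cx e3.
exists (r / 2); first by rewrite divr_gt0.
move=> z cz zx; have [s s0 Hz] := u_cont cz e3.
have [|z' Oz' z'z] := (@closure_epsP R pt Omega z).1 cz (Num.min s (r / 2)).
  by rewrite lt_min s0 divr_gt0.
move: z'z; rewrite lt_min => /andP[z's z'r].
have [h [[h1 h2] Dh]] := filter_ex (filterI (filterI Hx Hz) (nearD Oz')).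
have a1 := h2 _ Dh z's.
have : `|z' - x| <= `|z' - z| + `|z - x| := ler_distD _ _ _.
move=> a2; have a3 := h1 _ Dh _.
have a4 : `|uh h z' - u x| <= e / 3 by apply: a3; lra.
have : `|u z - u x| <= `|u z - uh h z'| + `|uh h z' - u x| := ler_distD _ _ _.
rewrite (distrC (u z) (uh h z')); lra.
Qed.

Lemma ultra_limit_uniform e : 0 < e ->
  \forall h \near G, forall y, D h y -> `|uh h y - u y| <= e.
Proof.
move=> e0; have e2 : 0 < e / 2 by rewrite divr_gt0.
have /compact_near_coveringP cC := closure_compact bO.
have := cC R G (fun h y => D h y -> `|uh h y - u y| <= e) PG.
move=> H; have {}H : \forall h \near G, closure Omega `<=` (fun y => D h y -> `|uh h y - u y| <= e).
  apply: H => x cx; have [r r0 Hx] := u_cont cx e2.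
  have [s s0 Hs] := (continuous_within_epsdelta (closure Omega) u).1 ultra_limit_continuous x cx _ e2.
  exists ([set y | `|y - x| < Num.min r s],
    [set h | I h /\ forall y, D h y -> `|y - x| < r -> `|uh h y - u x| <= e / 2]).
    split => /=.
      by apply/nbhs_ballP; exists (Num.min r s) => /=; [rewrite lt_min r0|move=> y; rewrite -ball_normE /= distrC].
    by apply: filterS2 Hx (nearI ltr01) => h h1 [h2 _].
  move=> [y h] /= []; rewrite lt_min => /andP[yr ys] [Ih hh] Dy.
  have := hh y Dy yr; have := Hs y (subset_closure (DO Ih Dy)) ys.
  have : `|uh h y - u y| <= `|uh h y - u x| + `|u x - u y| := ler_distD _ _ _.
  rewrite (distrC (u x) (u y)); lra.
apply: filterS2 H (nearI ltr01) => h H [Ih _] y Dy.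
by apply: H => //; apply: subset_closure; exact: DO Ih _ Dy.
Qed.

End UltraLimit.

(** Limits of measures of sets need a sequence; uniform convergence along the ultrafilter is
    therefore sampled at the tolerances [j.+1%:R^-1]. *)
Lemma convex_subsequence (S : set R) : Defs.convex_set Omega -> S `<=` I ->
  (forall d, 0 < d -> exists2 h, S h & h < d) ->
  exists u : pt -> R, [/\ convex_on Omega u, {within closure Omega, continuous u},
    forall x, bnd Omega x -> u x = g x &
    exists hh : nat -> R, forall j, [/\ S (hh j), hh j < j.+1%:R^-1 &
      forall y, D (hh j) y -> `|uh (hh j) y - u y| <= j.+1%:R^-1]].
Proof.
move=> cO SI hS; have PF := small_in_proper hS.
have [G [UG SG]] := ultraFilterLemma PF.
have GI : small_in I `<=` G.
  move=> A [d d0 dA]; apply: SG; exists d => // h [Sh hd].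
  by apply: dA; split => //; exact: SI.
exists (ultra_limit G); split.
- exact: ultra_limit_convex.
- exact: ultra_limit_continuous.
- exact: ultra_limit_bnd.
suff /choice [hh H] : forall j : nat, exists h, [/\ S h, h < j.+1%:R^-1 &
   forall y, D h y -> `|uh h y - ultra_limit G y| <= j.+1%:R^-1] by exists hh.
move=> j; have j0 : 0 < j.+1%:R^-1 :> R by rewrite invr_gt0.
have PG : ProperFilter G := ultra_proper.
have G1 : G [set h | S h /\ h < j.+1%:R^-1] by apply: SG; exists j.+1%:R^-1.
have [h [[Sh hj] H]] := filter_ex (filterI G1 (ultra_limit_uniform UG GI j0)).
by exists h.
Qed.

End ConvexLimit.

(** * The mass of a limit *)

Section SetLimits.
Context d (T : measurableType d) (R : realType) (m : {measure set T -> \bar R}).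
Local Open Scope ereal_scope.

(** Fatou's lemma for sets. *)
Lemma measure_liminf_le (E : nat -> set T) (A : set T) (c : \bar R) :
  (forall j, measurable (E j)) -> measurable A ->
  (forall x, A x -> \forall j \near \oo, E j x) ->
  (\forall j \near \oo, m (E j) <= c) -> m A <= c.
Proof.
move=> mE mA hA [N _ hN].
pose B k := \bigcap_(j in [set j | (k <= j)%N]) E j.
have mB k : measurable (B k) by exact: bigcap_measurableType.
have mUB : measurable (\bigcup_k B k) by exact: bigcupT_measurable.
have ndB : {homo B : k l / (k <= l)%N >-> (k <= l)%O}.
  by move=> k l kl; apply/subsetPset => x Bx j /= lj; apply: Bx; exact: leq_trans lj.
have lim := nondecreasing_cvg_mu (mu := m) mB mUB ndB.
apply: (@le_trans _ _ (m (\bigcup_k B k))).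
  by apply: le_measure; rewrite ?inE // => x /hA [k _ hk]; exists k => // j /=; exact: hk.
rewrite -(cvg_lim _ lim) //; apply: lime_le; first by apply/cvg_ex; eexists; exact: lim.
apply: nearW => k /=; apply: (@le_trans _ _ (m (E (maxn k N)))).
  by apply: le_measure; rewrite ?inE // => x; apply => /=; exact: leq_maxl.
by apply: hN; rewrite /= leq_maxr.
Qed.

(** Reverse Fatou lemma for sets; the dominating set [W] of finite measure provides continuity from
    above. *)
Lemma measure_limsup_ge (E : nat -> set T) (A W : set T) (c : \bar R) (N : nat) :
  (forall j, measurable (E j)) -> measurable A -> measurable W -> m W < +oo ->
  (forall j, (N <= j)%N -> E j `<=` W) ->
  (forall x, (forall k, exists2 j, (k <= j)%N & E j x) -> A x) ->
  (forall j, (N <= j)%N -> c <= m (E j)) -> c <= m A.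
Proof.
move=> mE mA mW fW EW hA hc.
pose B k := \bigcup_(j in [set j | (N + k <= j)%N]) E j.
have mB k : measurable (B k) by exact: bigcup_measurable.
have mIB : measurable (\bigcap_k B k) by exact: bigcapT_measurable.
have niB : {homo B : k l / (k <= l)%N >-> (l <= k)%O}.
  move=> k l kl; apply/subsetPset => x [j /= lj Ejx]; exists j => //=.
  by apply: leq_trans lj; rewrite leq_add2l.
have fB : m (B 0%N) < +oo.
  apply: le_lt_trans fW; apply: le_measure; rewrite ?inE //.
  by move=> x [j /=]; rewrite addn0 => Nj; exact: EW.
have lim := nonincreasing_cvg_mu fB mB mIB niB.
apply: (@le_trans _ _ (m (\bigcap_k B k))); last first.
  apply: le_measure; rewrite ?inE // => x hx; apply: hA => k.
  by have [j /= kj Ejx] := hx k I; exists j => //; apply: leq_trans kj; exact: leq_addl.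
rewrite -(cvg_lim _ lim) //; apply: lime_ge; first by apply/cvg_ex; eexists; exact: lim.
apply: nearW => k /=; apply: (@le_trans _ _ (m (E (N + k)%N))); first by apply: hc; exact: leq_addr.
by apply: le_measure; rewrite ?inE // => x Ex; exists (N + k)%N => //=.
Qed.

Lemma measure_bigcap_ge (F : nat -> set T) (A : set T) (c : \bar R) :
  (forall k, measurable (F k)) -> m (F 0%N) < +oo ->
  (forall k l, (k <= l)%N -> F l `<=` F k) -> measurable A ->
  (forall x, (forall k, F k x) -> A x) -> (forall k, c <= m (F k)) -> c <= m A.
Proof.
move=> mF F0 niF mA hA hc; apply: (measure_limsup_ge mF mA (mF 0%N) F0 (N := 0%N)) => //.
  by move=> j _; exact: niF.
move=> x hx; apply: hA => k; have [j kj Fj] := hx k; exact: niF kj _ Fj.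
Qed.

End SetLimits.

Section Neighbourhood.
Variables (R : realType) (n : nat).
Local Notation pt := 'rV[R]_n.+1.

Definition nbr (K : set pt) (r : R) : set pt := [set y | exists2 x, K x & `|y - x| < r].

Lemma open_nbr K r : open (nbr K r).
Proof.
apply/open_epsP => y [x Kx yx]; exists (r - `|y - x|); first by rewrite subr_gt0.
move=> z zy; exists x => //; have : `|z - x| <= `|z - y| + `|y - x| := ler_distD _ _ _.
lra.
Qed.

Lemma closure_nbr K r s : r < s -> closure (nbr K r) `<=` nbr K s.
Proof.
move=> rs y /(@closure_epsP R pt); rewrite -subr_gt0 in rs; move=> /(_ _ rs) [z [x Kx zx] zy].
exists x => //; have : `|y - x| <= `|y - z| + `|z - x| := ler_distD _ _ _.
rewrite (distrC y z); lra.
Qed.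

Lemma nbr_nbr K r s : nbr (nbr K r) s `<=` nbr K (r + s).
Proof.
move=> y [z [x Kx zx] yz]; exists x => //.
have : `|y - x| <= `|y - z| + `|z - x| := ler_distD _ _ _; lra.
Qed.

Lemma nbr_le K r s : r <= s -> nbr K r `<=` nbr K s.
Proof. by move=> rs y [x Kx yx]; exists x => //; exact: lt_le_trans rs. Qed.

Lemma sub_nbr K r : 0 < r -> K `<=` nbr K r.
Proof. by move=> r0 x Kx; exists x => //; rewrite subrr normr0. Qed.

Lemma nbr_cap K x r : closed K -> 0 < r -> (forall k : nat, nbr K (r / k.+1%:R) x) -> K x.
Proof.
move=> cK r0 h; rewrite ((closure_id K).1 cK); apply/(@closure_epsP R pt) => e e0.
have [k hk] : exists k : nat, r / k.+1%:R < e.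
  have re0 : 0 <= r / e by rewrite divr_ge0 // ltW.
  exists (Num.bound (r / e)); rewrite ltr_pdivrMr // mulrC -ltr_pdivrMr //.
  apply: lt_le_trans (archi_boundP re0) _; by rewrite ler_nat.
by have [y Ky xy] := h k; exists y => //; rewrite distrC; exact: lt_trans hk.
Qed.

Lemma compact_thick K O' : compact K -> open O' -> K `<=` O' ->
  exists2 r, 0 < r & nbr K r `<=` O'.
Proof.
move=> /compact_near_coveringP cK oO KO.
have PF : ProperFilter (small_in [set r : R | 0 < r]).
  by apply: small_in_proper => d d0; exists (d / 2); [rewrite /= divr_gt0|lra].
have [|d d0 H] := cK R (small_in [set r : R | 0 < r])
    (fun r x => forall y : pt, `|y - x| < r -> O' y) _.
  move=> x /KO Ox; have [e e0 he] := (@open_epsP R pt O').1 oO x Ox.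
  have e2 : 0 < e / 2 by rewrite divr_gt0.
  exists ([set y | `|y - x| < e / 2], [set r | 0 < r /\ r < e / 2]).
    split => /=; first by apply/nbhs_ballP; exists (e / 2) => //= y; rewrite -ball_normE /= distrC.
    by exists (e / 2).
  move=> [z r] /= [zx [_ re]] y yz; apply: he.
  have : `|y - x| <= `|y - z| + `|z - x| := ler_distD _ _ _; lra.
exists (d / 2); first by rewrite divr_gt0.
have d2 : 0 < d / 2 by rewrite divr_gt0.
by move=> y [x Kx yx]; apply: (H (d / 2) _ x Kx y yx); split => //; lra.
Qed.

End Neighbourhood.

Section SelMass.
Variables (R : realType) (n : nat).
Local Notation pt := 'rV[R]_n.+1.
Local Notation bt := (borel_pt R n.+1).
Variables (C : set pt) (u : pt -> R) (nu : {measure set bt -> \bar R}).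
Hypotheses (cC : compact C) (C0 : C !=set0) (ctu : {within C, continuous u}).

(** The push-forward of [nu] under the selection, off [multi_slopes]: on subsets of the open domain,
    the weighted Monge-Ampère measure. *)
Definition sel_mass (A : set bt) := nu (single_slopes C u A).

Let sel_mass0 : sel_mass set0 = 0%E.
Proof.
rewrite /sel_mass (_ : single_slopes C u set0 = set0) ?measure0 //.
by apply/seteqP; split => // p [_ []].
Qed.

Let sel_mass_ge0 A : (0 <= sel_mass A)%E.
Proof. exact: measure_ge0. Qed.

Let sel_mass_sigma_additive : semi_sigma_additive sel_mass.
Proof.
move=> F mF tF mUF.
have E : single_slopes C u (\bigcup_k F k) = \bigcup_k single_slopes C u (F k).
  apply/seteqP; split => p.
    by move=> [np [k _ Fk]]; exists k.
  by move=> [k _ [np Fk]]; split => //; exists k.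
rewrite /sel_mass E; apply: measure_semi_sigma_additive.
- by move=> k; exact: single_slopes_borel.
- apply/trivIsetP => i j _ _ ij; apply/seteqP; split => // p [[_ Fi] [_ Fj]].
  by have /seteqP[h _] := trivIsetP.1 tF i j I I ij; exact: (h (sel C u p)).
- by rewrite -E; exact: single_slopes_borel.
Qed.

HB.instance Definition _ := isMeasure.Build _ _ _ sel_mass
  sel_mass0 sel_mass_ge0 sel_mass_sigma_additive.

Lemma sel_massE : exists m : {measure set bt -> \bar R}, forall A, m A = sel_mass A.
Proof. by eexists. Qed.

End SelMass.

Lemma borel_generated_closed (R : realType) (n : nat) :
  @measurable _ (borel_pt R n.+1) = <<s @closed 'rV[R]_n.+1 >>.
Proof.
apply/seteqP; split => A.
  move=> mA; apply: (mA <<s @closed 'rV[R]_n.+1 >>); split; first exact: smallest_sigma_algebra.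
  move=> O' oO; rewrite -(setCK O') -setTD.
  have [_ hC _] := smallest_sigma_algebra setT (@closed 'rV[R]_n.+1).
  by apply: hC; apply: sub_sigma_algebra; exact: open_closedC.
move=> mA; apply: (mA (@measurable _ (borel_pt R n.+1))); split.
  exact: smallest_sigma_algebra.
by move=> K cK; exact: closed_borel.
Qed.

(** * Identification of the limit mass *)

Section LimitMeasure.
Variables (R : realType) (n : nat).
Local Notation pt := 'rV[R]_n.+1.
Local Notation bt := (borel_pt R n.+1).
Variables (leb mu nu : {measure set bt -> \bar R}) (Omega : set pt) (g Rf u : pt -> R).
Hypotheses (hleb : is_lebesgue leb) (hnu : weight_of leb Rf nu).
Hypotheses (oO : open Omega) (cO : Defs.convex_set Omega) (O0 : Omega !=set0)
  (bO : Defs.bounded_set Omega).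
Hypotheses (muO : mu (~` Omega) = 0%E) (fmu : (mu Omega < +oo)%E).
Hypotheses (ctu : {within closure Omega, continuous u}) (ug : forall x, bnd Omega x -> u x = g x).
Variables (M : nat -> mesh R n.+1) (v : nat -> pt -> R) (h : nat -> R) (B : R).
Hypothesis hM : forall j, is_mesh Omega (M j) (h j).
Hypothesis hv : forall j, fe_solution leb mu (M j) g Rf (v j).
Hypothesis hj : forall j, h j < j.+1%:R^-1.
Hypothesis vu : forall j y, mesh_dom (M j) y -> `|v j y - u y| <= j.+1%:R^-1.
Hypothesis vB : forall j y, mesh_dom (M j) y -> `|v j y| <= B.
Hypothesis fill : forall K, compact K -> K `<=` Omega -> \forall j \near \oo, K `<=` mesh_dom (M j).

Local Notation C := (closure Omega).
Local Notation multi := (multi_slopes C u).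
Local Notation single := (single_slopes C u).
Local Notation sl p := (sel C u p).

Let cC : compact C. Proof. exact: closure_compact. Qed.
Let C0 : C !=set0. Proof. by have [x Ox] := O0; exists x; exact: subset_closure. Qed.

Let DO j : mesh_dom (M j) `<=` Omega.
Proof. exact: (mesh_domS (hM j) oO cO O0). Qed.

Let mfin (A : set bt) : @measurable _ bt A -> (mu A < +oo)%E.
Proof.
move=> mA; have mO : @measurable _ bt Omega by exact: open_borel.
have mOc : @measurable _ bt (~` Omega) by exact: measurableC.
have U2 : (mu (Omega `|` ~` Omega) <= mu Omega + mu (~` Omega))%E by exact: measureU2.
apply: (@le_lt_trans _ _ (mu (Omega `|` ~` Omega))).
  by apply: le_measure; rewrite ?inE //; [exact: measurableU|rewrite setUv].
by apply: le_lt_trans U2 _; rewrite muO adde0.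
Qed.

Let inv_small (e : R) : 0 < e -> \forall j \near \oo, (j.+1%:R^-1 : R) < e.
Proof.
by move=> e0; have := near_infty_natSinv_lt (PosNum e0).
Qed.

(** The minimiser is unique, so the excess over the minimum is positive at each point of [F];
    compactness makes it uniform. *)
Let slope_gap p (F : set pt) : ~ multi p -> compact F -> F `<=` C -> ~ F (sl p) ->
  exists2 gam, 0 < gam & forall x, F x -> u (sl p) - dotv p (sl p) + gam <= u x - dotv p x.
Proof.
move=> np cF FC nF; have [Cs smin] := selP cC C0 ctu p.
have ctp : {within C, continuous (fun x => u x - dotv p x)}.
  exact: (tilt_continuous ctu (@subset_refl _ C)).
move/(@continuous_within_epsdelta R pt R) : ctp => ctp.
move: cF => /compact_near_coveringP cF.
have PF : ProperFilter (small_in [set r : R | 0 < r]).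
  by apply: small_in_proper => d d0; exists (d / 2); [rewrite /= divr_gt0|lra].
have [|d d0 H] := cF R (small_in [set r : R | 0 < r])
    (fun r x => C x -> u (sl p) - dotv p (sl p) + r <= u x - dotv p x) _.
  move=> x Fx; have Cx := FC _ Fx.
  have gt : u (sl p) - dotv p (sl p) < u x - dotv p x.
    rewrite ltNge; apply/negP => le_x; apply: nF.
    suff -> : sl p = x by [].
    apply: (contact_unique np (selP cC C0 ctu p)).
    by split => // y /smin; exact: le_trans.
  have e0 : 0 < (u x - dotv p x - (u (sl p) - dotv p (sl p))) / 2 by rewrite divr_gt0 ?subr_gt0.
  have [d d0 hd] := ctp x Cx _ e0.
  exists ([set y | `|y - x| < d], [set r | 0 < r /\ r < (u x - dotv p x - (u (sl p) - dotv p (sl p))) / 2]).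
    split => /=; first by apply/nbhs_ballP; exists d => //= y; rewrite -ball_normE /= distrC.
    by eexists; first exact: e0.
  move=> [y r] /= [yx [_ re]] Cy; have := hd y Cy yx; rewrite ltr_norml => /andP[h1 _].
  lra.
have d2 : 0 < d / 2 by rewrite divr_gt0.
exists (d / 2) => // x Fx; apply: (H (d / 2)) => //; last exact: FC.
by split => //; lra.
Qed.

Let E (P : set pt) j := fe_slopes (M j) (v j) P.

(** On the boundary and outside [P] the tilted limit exceeds its minimum by [gam]. Once [v j] is
    within [gam / 2] of [u], the strict inequalities of [fe_slope_in] hold. *)
Let slopes_liminf (K P : set pt) p : compact K -> K `<=` Omega -> K `<=` P -> open P ->
  single K p -> \forall j \near \oo, E P j p.
Proof.
move=> cK KO KP oP [np Kp]; set y := sl p in Kp.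
have oPO : open (P `&` Omega) by exact: openI.
have cF : compact (C `&` ~` (P `&` Omega)).
  apply: (@subclosed_compact _ _ C) => //.
  by apply: closedI; [exact: closed_closure|exact: open_closedC].
have nF : ~ (C `&` ~` (P `&` Omega)) y by move=> [_]; apply; split; [exact: KP|exact: KO].
have [gam gam0 hgam] := slope_gap np cF (@subIsetl _ _ _) nF.
have g2 : 0 < gam / 2 by rewrite divr_gt0.
near=> j.
have KD : K `<=` mesh_dom (M j) by near: j; exact: fill.
have jg : j.+1%:R^-1 < gam / 2 by near: j; exact: inv_small.
have vy := vu (KD _ Kp); move: vy; rewrite ler_norml => /andP[_ vy].
have vD V (DV : mesh_dom (M j) V) := vu DV.
move: (j.+1%:R^-1) jg vy vD => q jg vy vD.
apply: (fe_slope_in (hM j) (hv j) (y := y)).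
- by apply: subset_closure; exact: KD.
- move=> V vV nD; have bV := boundary_vertex (hM j) vV nD.
  have : (C `&` ~` (P `&` Omega)) V.
    split; first by case: bV.
    by move=> [_ OV]; have [_] := bV; apply; apply/interior_epsP; exact: (@open_epsP R pt Omega).1 oO V OV.
  move=> /hgam; rewrite -(ug bV) -/y; lra.
- move=> V vV DV nP.
  have : (C `&` ~` (P `&` Omega)) V.
    by split; [apply: subset_closure; exact: DO DV|move=> []].
  move=> /hgam; have := vD _ DV; rewrite ler_norml -/y => /andP[h1 _]; lra.
Unshelve. all: by end_near. Qed.

Let mass_le_nbr (K : set pt) r : compact K -> K `<=` Omega -> 0 < r ->
  (nu (single K) <= mu (nbr K r))%E.
Proof.
move=> cK KO r0; have r2 : 0 < r / 2 by rewrite divr_gt0.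
apply: (@measure_liminf_le _ bt _ nu (E (nbr K (r / 2)))).
- by move=> j; exact: fe_slopes_borel.
- by apply: single_slopes_borel => //; exact: compact_borel.
- move=> p hp; apply: slopes_liminf hp => //; [exact: sub_nbr|exact: open_nbr].
near=> j; have jr : j.+1%:R^-1 < r / 2 by near: j; exact: inv_small.
apply: (fe_slopes_le hleb hnu bO (hM j) (hv j)); first by apply: open_borel; exact: open_nbr.
move=> x a Dx va [y Ky ay] xa; exists y => //.
have : `|x - y| <= `|x - a| + `|a - y| := ler_distD _ _ _.
have := norm_le_enorm (x - a); move: (j.+1%:R^-1) (hj j) jr => q; lra.
Unshelve. all: by end_near. Qed.

Let mass_le (K : set pt) : compact K -> K `<=` Omega -> (nu (single K) <= mu K)%E.
Proof.
move=> cK KO.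
have mN k : @measurable _ bt (nbr K (1 / k.+1%:R)) by apply: open_borel; exact: open_nbr.
apply: (@measure_bigcap_ge _ bt _ mu (fun k => nbr K (1 / k.+1%:R))) => //.
- exact: mfin.
- by move=> k l kl; apply: nbr_le; rewrite ler_pM2l // lef_pV2 ?posrE // ler_nat ltnS.
- exact: compact_borel.
- by move=> x; apply: nbr_cap => //; exact: rV_compact_closed.
by move=> k; apply: mass_le_nbr => //; rewrite divr_gt0.
Qed.

Let closure_nbr_compact (K : set pt) r s : r < s -> nbr K s `<=` Omega ->
  compact (closure (nbr K r)) /\ closure (nbr K r) `<=` Omega.
Proof.
move=> rs sO; have cO' : closure (nbr K r) `<=` Omega by apply: subset_trans (closure_nbr rs) sO.
split => //; apply: (@subclosed_compact _ _ C) => //; first exact: closed_closure.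
by move=> x /cO'; exact: subset_closure.
Qed.

(** The subgradient inequality is tested at [a] moved by [s / 2] both ways along each axis. The
    resulting ball of slopes is the dominating set for [measure_limsup_ge]. *)
Let slope_bound (K : set pt) r s j p : 0 < s -> nbr K (r + s) `<=` mesh_dom (M j) ->
  E (nbr K r) j p -> `|p| <= 4 * B / s.
Proof.
move=> s0 KD [a [va [Da Ka]] hp].
have s2 : 0 < s / 2 by rewrite divr_gt0.
have B0 : 0 <= B by apply: le_trans (vB Da).
apply: norm_le_coord => [|i]; first by rewrite divr_ge0 ?mulr_ge0 // ltW.
have key t : `|t| <= s / 2 -> t * p 0 i <= 2 * B.
  move=> ts; have Dy : mesh_dom (M j) (a + t *: delta_mx 0 i).
    apply: KD; apply: nbr_nbr; exists a => //; rewrite addrAC subrr add0r.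
    apply: (@le_lt_trans _ _ (s / 2)); last lra.
    apply: norm_le_coord => [|l]; first exact: ltW.
    rewrite !mxE; case: (_ == _); rewrite ?andbF ?mulr0 ?normr0 ?(ltW s2) //= ?mulr1 //.
    by case: (l == i); rewrite ?mulr1 ?mulr0 ?normr0 // ltW.
  have := hp _ Dy; rewrite addrAC subrr add0r dotvZr.
  have -> : dotv p (delta_mx 0 i) = p 0 i.
    rewrite /dotv (bigD1 i) //= mxE !eqxx mulr1 big1 ?addr0 // => l li.
    by rewrite mxE (negbTE li) andbF mulr0.
  have := vB Da; have := vB Dy; rewrite !ler_norml => /andP[_ h1] /andP[h2 _]; lra.
have k1 := key (s / 2); have k2 := key (- (s / 2)).
rewrite normrN (ger0_norm (ltW s2)) in k1 k2; move: (k1 (lexx _)) (k2 (lexx _)) => {}k1 {}k2.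
rewrite ler_pdivlMr // -[X in _ * X]ger0_norm ?(ltW s0) // -normrM ler_norml; apply/andP; split; lra.
Qed.

Let slopes_limsup (K : set pt) r s p : r < s -> nbr K s `<=` Omega -> ~ multi p ->
  (forall k, exists2 j, (k <= j)%N & E (nbr K r) j p) -> single (closure (nbr K r)) p.
Proof.
move=> rs sO np hE; split => //; apply: contrapT => nF.
have [cF FO] := closure_nbr_compact rs sO.
have FC : closure (nbr K r) `<=` C by move=> x /FO; exact: subset_closure.
have [gam gam0 hgam] := slope_gap np cF FC nF.
have [Cs _] := selP cC C0 ctu p.
have ctp : {within C, continuous (fun x => u x - dotv p x)}.
  exact: (tilt_continuous ctu (@subset_refl _ C)).
have g2 : 0 < gam / 2 by rewrite divr_gt0.
have g4 : 0 < gam / 4 by rewrite divr_gt0.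
have [d d0 hd] := (@continuous_within_epsdelta R pt R _ _).1 ctp _ Cs _ g2.
(* The minimiser of the limit may be a boundary point outside all mesh domains; a nearby point of
   [Omega] with almost the same tilted value replaces it. *)
have [x Ox xs] := (@closure_epsP R pt Omega _).1 Cs d d0.
have := hd x (subset_closure Ox) xs; rewrite ltr_norml => /andP[_ ux].
have cx : compact [set x] by exact: compact_set1.
have xO : [set x] `<=` Omega by move=> _ ->.
have [N _ hN] : \forall j \near \oo, [set x] `<=` mesh_dom (M j) /\ j.+1%:R^-1 < gam / 4.
  by near=> j; split; near: j; [exact: fill|exact: inv_small].
have [j Nj [a [va [Da Ka]] hp]] := hE N.
have [/(_ x erefl) Dx jg] := hN j Nj.
have := hp x Dx; rewrite dotvDr dotvNr.
have := hgam a (subset_closure Ka).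
have := vu Dx; have := vu Da; rewrite !ler_norml.
move: (j.+1%:R^-1) jg => q jg /andP[h1 _] /andP[_ h2]; lra.
Unshelve. all: by end_near. Qed.

Let mass_ge_nbr (K : set pt) r s : compact K -> K `<=` Omega -> 0 < r -> r < s -> nbr K s `<=` Omega ->
  (mu K <= nu (single (closure (nbr K r))))%E.
Proof.
move=> cK KO r0 rs sO; pose s1 := (s - r) / 2; have s10 : 0 < s1 by rewrite divr_gt0 ?subr_gt0.
have [cF FO] := @closure_nbr_compact K (r + s1) s ltac:(rewrite /s1; lra) sO.
have [cFr FrO] := closure_nbr_compact rs sO.
have [N _ hN] : \forall j \near \oo, closure (nbr K (r + s1)) `<=` mesh_dom (M j) /\ j.+1%:R^-1 < r.
  by near=> j; split; near: j; [exact: fill|exact: inv_small].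
have mS : @measurable _ bt (single (closure (nbr K r))).
  by apply: single_slopes_borel => //; apply: compact_borel.
have mm : @measurable _ bt multi by exact: multi_slopes_borel.
have ND j : (N <= j)%N -> nbr K (r + s1) `<=` mesh_dom (M j).
  by move=> Nj y Ky; have [h1 _] := hN j Nj; apply: h1; exact: subset_closure.
have mW : @measurable _ bt [set p : pt | `|p| <= 4 * B / s1].
  by apply: closed_borel; exact: closed_norm_le.
apply: (@le_trans _ _ (nu (single (closure (nbr K r)) `|` multi))).
  apply: (@measure_limsup_ge _ bt _ nu (E (nbr K r)) _ _ _ N _ _ mW).
  - by move=> j; exact: fe_slopes_borel.
  - exact: measurableU.
  - by apply: (weight_bounded hnu mW (M := 4 * B / s1)).
  - by move=> j Nj p; apply: slope_bound => //; exact: ND.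
  - move=> p hp; have [mp|mp] := pselect (multi p); [by right|left].
    exact: slopes_limsup rs sO mp hp.
  move=> j Nj; apply: (fe_slopes_ge hleb hnu bO (hM j) (hv j)).
  - exact: compact_borel.
  - by move=> x Kx; apply: ND Nj _ _; apply: sub_nbr => //; lra.
  move=> x a Kx va xa; have [_ jr] := hN j Nj.
  have Ka : nbr K r a.
    exists x => //; rewrite distrC; have := norm_le_enorm (x - a).
    move: (j.+1%:R^-1) (hj j) jr => q; lra.
  by split => //; apply: ND Nj _ _; apply: nbr_le Ka; lra.
have U2 : (nu (single (closure (nbr K r)) `|` multi) <= nu (single (closure (nbr K r))) + nu multi)%E.
  exact: measureU2.
apply: le_trans U2 _; rewrite (weight_null hnu mm) ?adde0 //.
exact: multi_slopes_null.
Unshelve. all: by end_near. Qed.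

(** For the lower bound closed neighbourhoods shrink to [K]; their mass is finite by [mass_le], as
    continuity from above requires. *)
Let mass_eq (K : set pt) : compact K -> K `<=` Omega -> nu (single K) = mu K.
Proof.
move=> cK KO; apply/eqP; rewrite eq_le mass_le //=.
have [s s0 sO] := compact_thick cK oO KO.
pose F k := closure (nbr K (s / 3 / k.+1%:R)).
have s3 k : 0 < s / 3 / k.+1%:R by rewrite !divr_gt0.
have s3' k : s / 3 / k.+1%:R <= s / 3 by rewrite ler_pdivrMr // ler_peMr ?ler1n // divr_ge0 // ltW.
have s3s k : s / 3 / k.+1%:R < s by apply: le_lt_trans (s3' k) _; lra.
have [m hm] := sel_massE nu cC C0 ctu.
have HF k := closure_nbr_compact (s3s k) sO.
have mF k : @measurable _ bt (F k) by apply: compact_borel; have [] := HF k.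
have hmE A : m A = nu (single A) by exact: hm.
rewrite -[leRHS]hmE; apply: (@measure_bigcap_ge _ bt _ m F K (mu K) mF).
- rewrite hmE; have [c1 c2] := HF 0%N; apply: le_lt_trans (mass_le c1 c2) _; exact: mfin (mF 0%N).
- move=> k l kl; apply: closureS; apply: nbr_le.
  by rewrite ler_pM2l ?divr_gt0 // lef_pV2 ?posrE // ler_nat ltnS.
- exact: compact_borel.
- move=> x hx; apply: (@nbr_cap _ _ K x s) => //; first exact: rV_compact_closed.
  move=> k; apply: closure_nbr (hx k); rewrite ltr_pM2r ?invr_gt0 //; lra.
by move=> k; rewrite hmE; apply: (mass_ge_nbr cK KO (s3 k) (s3s k) sO).
Qed.

Let Ex k : set pt := C `&` [set x | forall z, bnd Omega z -> k.+1%:R^-1 <= `|x - z|].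

Let closed_Ex k : closed (Ex k).
Proof.
apply: closedI; first exact: closed_closure.
have -> : [set x : pt | forall z, bnd Omega z -> k.+1%:R^-1 <= `|x - z|] =
    \bigcap_(z in bnd Omega) [set x : pt | k.+1%:R^-1 <= `|x - z|].
  by apply/seteqP; split => x hx z bz; exact: hx.
apply: closed_bigI => z _.
apply: (@closed_comp _ _ (fun x : pt => `|x - z|) [set t | k.+1%:R^-1 <= t]); last exact: closed_ge.
move=> x _; apply: (@continuous_comp pt pt R (fun x => x - z) (fun y => `|y|)).
  exact: translate_continuous.
exact: norm_continuous.
Qed.

Let ExO k : Ex k `<=` Omega.
Proof.
move=> x [Cx hx]; apply: contrapT => nO.
have bx : bnd Omega x by split => // /interior_subset.
by have := hx x bx; rewrite subrr normr0 leNgt invr_gt0 ltr0n.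
Qed.

Let Ex_cover : \bigcup_k Ex k = Omega.
Proof.
apply/seteqP; split; first by move=> x [k _]; exact: ExO.
move=> x Ox; have [e e0 he] := (@open_epsP R pt Omega).1 oO x Ox.
have [N _ hN] := inv_small e0; exists N => //; split; first exact: subset_closure.
move=> z bz; apply: ltW; apply: lt_le_trans (hN N (leqnn N)) _.
rewrite leNgt; apply/negP => zx; have [_] := bz; apply.
apply/interior_epsP; apply: ((@open_epsP R pt Omega).1 oO z).
by apply: he; rewrite distrC.
Qed.

(** The part of a closed set in [Omega] is an increasing union of compact sets [K] cut with [Ex k],
    so the masses agree there. Closed sets are stable under intersection and generate the Borel
    sets, hence the two finite restrictions to [Omega] coincide. *)
Lemma limit_mass (e : set bt) : @measurable _ bt e -> e `<=` Omega -> nu (single e) = mu e.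
Proof.
have [m hm] := sel_massE nu cC C0 ctu.
have mO : @measurable _ bt Omega by exact: open_borel.
have closedE (K : set pt) : closed K -> m (K `&` Omega) = mu (K `&` Omega).
  move=> cK; rewrite -Ex_cover setI_bigcupr.
  have cKE k : compact (K `&` Ex k).
    apply: (@subclosed_compact _ _ C) => //; first by apply: closedI.
    by move=> x [_ []].
  have mKE k : @measurable _ bt (K `&` Ex k) by exact: compact_borel.
  have mU : @measurable _ bt (\bigcup_k (K `&` Ex k)) by exact: bigcupT_measurable.
  have nd : {homo (fun k => K `&` Ex k) : k l / (k <= l)%N >-> (k <= l)%O}.
    move=> k l kl; apply/subsetPset => x [Kx [Cx hx]]; split => //; split => // z bz.
    by apply: le_trans (hx z bz); rewrite lef_pV2 ?posrE // ler_nat ltnS.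
  have l1 := nondecreasing_cvg_mu (mu := m) mKE mU nd.
  have l2 := nondecreasing_cvg_mu (mu := mu) mKE mU nd.
  have E1 : m \o (fun k => K `&` Ex k) = mu \o (fun k => K `&` Ex k).
    by apply/funext => k /=; rewrite hm; apply: mass_eq => // x [_]; exact: ExO.
  by rewrite E1 in l1; exact: cvg_unique l1 l2.
move=> me eO; rewrite -[e in RHS](setIidl eO) -[e in LHS](setIidl eO).
rewrite -[LHS]hm.
apply: (@measure_unique _ R bt (@closed pt) (fun=> setT) (borel_generated_closed R n) _ _ _
   (mrestr m mO) (mrestr mu mO)) => //.
- by move=> A A' cA cA'; exact: closedI.
- by rewrite bigcup_const //; exists 0%N.
by move=> _; change (m (setT `&` Omega) < +oo)%E; rewrite closedE ?setTI //; exact: closedT.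
Qed.

End LimitMeasure.

(** * Convergence *)

Section Convergence.
Variables (R : realType) (n : nat).
Local Notation pt := 'rV[R]_n.+1.
Local Notation bt := (borel_pt R n.+1).
Variables (leb mu nu : {measure set bt -> \bar R}) (Omega : set pt) (g Rf : pt -> R).
Hypotheses (hleb : is_lebesgue leb) (hnu : weight_of leb Rf nu).
Hypotheses (oO : open Omega) (cO : Defs.convex_set Omega) (O0 : Omega !=set0)
  (bO : Defs.bounded_set Omega).
Hypothesis gc : {within bnd Omega, continuous g}.
Hypothesis muO : mu (~` Omega) = 0%E.
Variables (tau k C0 r0 C1 lam : R) (I : set R) (Th : R -> mesh R n.+1) (uh : R -> pt -> R).
Hypotheses (tau0 : 0 <= tau) (k0 : 0 <= k) (C00 : 0 < C0) (r00 : 0 < r0) (C10 : 0 < C1) (lam0 : 0 <= lam).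
Hypothesis hA : forall a0, bnd Omega a0 -> parabolic_support Omega tau a0.
Hypothesis hB : forall p, r0 <= enorm p -> C0 * enorm p `^ (- (2 * k)) <= Rf p.
Hypothesis mass : (mu Omega < nu setT)%E.
Hypothesis hD : forall x0, bnd Omega x0 -> exists rho, 0 < rho /\
  forall e : set pt, borel e -> e `<=` eball x0 rho `&` Omega ->
    (mu (e `&` Omega) <=
      (C1 * (sup [set dist_set x (bnd Omega) | x in e]) `^ lam)%:E * leb e)%E.
Hypothesis hk : exponent_condition n tau k lam.
Hypothesis adm : admissible Omega I Th.
Hypothesis hI : forall h, I h -> fe_solution leb mu (Th h) g Rf (uh h).

Let gen_solution_le u v : gen_solution leb mu Omega g Rf u -> gen_solution leb mu Omega g Rf v ->
  forall x, Omega x -> u x <= v x.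
Proof.
move=> [convu cu mu_u ub] [_ cv mu_v vb].
(* Any boundary point serves as the exposed one, with the normal of its frame as [a]. *)
have [b bb] := bnd_neq0 O0 bO.
have [Q [eta [c1 fr]]] := exists_boundary_frame oO cO tau0 bb (hA bb).
have cC : compact (closure Omega) by exact: closure_compact.
have C0' : closure Omega !=set0 by have [x Ox] := O0; exists x; exact: subset_closure.
have OC : Omega `<=` closure Omega by exact: subset_closure.
have fmu : (mu Omega < +oo)%E by apply: lt_le_trans mass _; exact: leey.
have uv x : bnd Omega x -> u x = v x by move=> bx; rewrite ub // vb.
apply: (le_of_same_mass hleb hnu oO O0 bO cu cv uv convu (a := \row_i Q i ord_max) (b := b)).
  split => //; split.
    by move=> x cx; rewrite -height_dotv; exact: (height_ge0 fr).
  move=> e e0; have [kk kk0 H] := frame_exposed fr e0; exists kk => // x cx.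
  by rewrite -height_dotv => xk; apply: le_lt_trans (norm_le_enorm _) _; exact: H.
move=> e me eO.
have E1 := weight_subdiff_img cC C0' cu hleb hnu OC (@subset_refl _ _) me eO.
have E2 := weight_subdiff_img cC C0' cv hleb hnu OC (@subset_refl _ _) me eO.
rewrite -E1 -E2 mu_u // mu_v //; split => //.
apply: le_lt_trans fmu; apply: le_measure; rewrite ?inE //; exact: open_borel.
Qed.

Lemma gen_solution_unique u v : gen_solution leb mu Omega g Rf u -> gen_solution leb mu Omega g Rf v ->
  forall x, closure Omega x -> v x = u x.
Proof.
move=> hu hv x cx; have [Ox|nO] := pselect (Omega x).
  by apply/eqP; rewrite eq_le !gen_solution_le.
have bx : bnd Omega x by split => // /interior_subset.
by have [_ _ _ ->] := hu => //; have [_ _ _ ->] := hv.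
Qed.

Let hIM h : I h -> is_mesh Omega (Th h) h /\ fe_solution leb mu (Th h) g Rf (uh h).
Proof. by move=> Ih; split; [case: adm => _ _ _ H _; exact: H|exact: hI]. Qed.

Lemma exists_limit_solution (S : set R) : S `<=` I ->
  (forall d, 0 < d -> exists2 h, S h & h < d) ->
  exists2 u, gen_solution leb mu Omega g Rf u &
    forall e d, 0 < e -> 0 < d -> exists h, [/\ S h, h < d &
      forall y, mesh_dom (Th h) y -> `|uh h y - u y| <= e].
Proof.
move=> SI hS; have [_ _ _ _ fill] := adm.
have [B B0 hBd] := fe_uniform_bound hleb hnu oO cO O0 bO gc mass.
have uhB h : I h -> forall x, closure (mesh_dom (Th h)) x -> `|uh h x| <= B.
  by move=> /hIM [hM hv] x; exact: hBd hM hv x.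
have barr := boundary_barrier hleb hnu oO cO O0 bO gc tau0 k0 C00 r00 C10 lam0 hA hB hD hk hIM uhB.
have DO h : I h -> mesh_dom (Th h) `<=` Omega.
  by move=> /hIM [hM _]; exact: (mesh_domS hM oO cO O0).
have convuh h : I h -> convex_on (mesh_dom (Th h)) (uh h).
  by move=> /hIM [_ hv]; exact: fe_convex hv.
have uhB' h : I h -> forall x, mesh_dom (Th h) x -> `|uh h x| <= B.
  by move=> Ih x Dx; apply: uhB => //; exact: subset_closure.
have [u [convu ctu ug [hh hhP]]] :=
  convex_subsequence oO O0 bO DO convuh uhB' fill barr cO SI hS.
have invj e : 0 < e -> \forall j \near \oo, (j.+1%:R^-1 : R) < e.
  by move=> e0; exact: near_infty_natSinv_lt (PosNum e0).
have fmu : (mu Omega < +oo)%E by apply: lt_le_trans mass _; exact: leey.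
exists u; last first.
  move=> e d e0 d0.
  have ed0 : 0 < Num.min e d by rewrite lt_min e0.
  have [N _ hN] := invj _ ed0; have := hN N (leqnn N); rewrite lt_min => /andP[Ne Nd].
  have [Sh hj H] := hhP N; exists (hh N); split => //; first exact: lt_trans Nd.
  by move=> y /H Hy; apply: le_trans Hy (ltW Ne).
split => // e me eO.
have cC : compact (closure Omega) by exact: closure_compact.
have C0' : closure Omega !=set0 by have [x Ox] := O0; exists x; exact: subset_closure.
rewrite (weight_subdiff_img cC C0' ctu hleb hnu (@subset_closure _ _) (@subset_refl _ _) me eO).
have hI' j : I (hh j) by have [Sj _ _] := hhP j; exact: SI.
apply: (@limit_mass R n leb mu nu Omega g Rf u hleb hnu oO cO O0 bO muO fmu ctu ug
  (fun j => Th (hh j)) (fun j => uh (hh j)) hh B) => //.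
- by move=> j; have [] := hIM (hI' j).
- by move=> j; exact: hI.
- by move=> j; have [] := hhP j.
- by move=> j; have [] := hhP j.
- by move=> j; exact: uhB'.
move=> K cK KO; have [d d0 H] := compact_mesh_fills oO O0 bO fill cK KO.
apply: filterS (invj d d0) => j jd; apply: H; first exact: hI'.
by have [_ hj _] := hhP j; exact: lt_trans jd.
Qed.

Lemma fe_convergence : exists u : pt -> R,
  [/\ gen_solution leb mu Omega g Rf u,
      (forall v, gen_solution leb mu Omega g Rf v -> forall x, closure Omega x -> v x = u x)
    & forall delta, 0 < delta -> forall eps, 0 < eps -> exists eta, 0 < eta /\
        forall h, I h -> h < eta ->
          forall x, closure (inner_set Omega delta) x -> `|uh h x - u x| <= eps].
Proof.
have [Ipos Iacc _ _ fill] := adm.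
have [u hu _] : exists2 u, gen_solution leb mu Omega g Rf u & forall e d, 0 < e -> 0 < d ->
    exists h, [/\ I h, h < d & forall y, mesh_dom (Th h) y -> `|uh h y - u y| <= e].
  apply: exists_limit_solution => // d d0; have [h [Ih _ hd]] := Iacc d d0.
  by exists h => //; apply: le_lt_trans hd; rewrite subr0 ler_norm.
exists u; split => //; first by move=> v hv; exact: gen_solution_unique.
move=> delta delta0 eps eps0; apply: contrapT => nex.
(* If the bad mesh sizes accumulate at 0, a solution arises as a limit along them. It equals [u],
   against the error above [eps]. *)
pose S := [set h | I h /\ exists2 x, closure (inner_set Omega delta) x & eps < `|uh h x - u x|].
have [||v hv Hv] := @exists_limit_solution S; first by move=> h [].
  move=> d d0; apply: contrapT => nS; apply: nex; exists d; split => // h Ih hd x cx.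
  by rewrite leNgt; apply/negP => bad; apply: nS; exists h => //; split => //; exists x.
have [hd [hd0 H]] := fill delta delta0.
have [h [[Ih [x cx bad]] hlt close]] := Hv eps hd eps0 hd0.
have Dx := H h Ih hlt x cx.
have Ox : Omega x by have [hM _] := hIM Ih; exact: (mesh_domS hM oO cO O0).
have := close x Dx; rewrite (gen_solution_unique hu hv (subset_closure Ox)).
by rewrite leNgt bad.
Qed.

End Convergence.

(* In the statement, [convex_set] and [bounded_set] are those of MathComp-Analysis, which shadow the ones of [Defs]. *)
Lemma convex_set_defs (R : realType) (n : nat) (A : set 'rV[R]_n.+1) :
  convex_set A -> Defs.convex_set A.
Proof.
move=> cA x y Ax Ay t /andP[t0 t1].
have s0 : 0 <= 1 - t by rewrite subr_ge0.
have s1 : 1 - t <= 1 by lra.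
have := cA x y (Itv01 s0 s1) (mem_set Ax) (mem_set Ay).
have -> : conv (Itv01 s0 s1) (x : convex_lmodType 'rV[R]_n.+1) y = (1 - t) *: x + (1 - (1 - t)) *: y by [].
by rewrite inE subKr.
Qed.

Lemma bounded_set_defs (R : realType) (n : nat) (A : set 'rV[R]_n.+1) :
  bounded_set A -> Defs.bounded_set A.
Proof.
move=> [M [_ hM]]; exists (n.+1%:R * (M + 1)) => x Ax.
apply: le_trans (enorm_le_norm x) _; rewrite ler_wpM2l //; apply: (hM (M + 1)) => //.
by rewrite ltrDl.
Qed.

(* dimension d = n.+1 *)
Theorem theorem6p6 (R : realType) (n : nat)
  (leb mu : {measure set borel_pt R n.+1 -> \bar R})
  (Omega : set 'rV[R]_n.+1) (g Rf : 'rV[R]_n.+1 -> R)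
  (tau k C0 r0 C1 lam : R) (I : set R) (Th : R -> mesh R n.+1)
  (uh : R -> 'rV[R]_n.+1 -> R) :
  is_lebesgue leb ->
  (* Omega: bounded open convex domain *)
  open Omega -> Omega !=set0 -> bounded_set Omega -> convex_set Omega ->
  {within bnd Omega, continuous g} ->
  (forall p, 0 < Rf p) -> loc_integrable leb Rf ->
  (* mu is a nonnegative Borel measure on Omega *)
  mu (~` Omega) = 0%E ->
  (* (A) *)
  0 <= tau -> (forall a0, bnd Omega a0 -> parabolic_support Omega tau a0) ->
  (* (B) *)
  0 <= k -> 0 < C0 -> 0 < r0 ->
  (forall p, r0 <= enorm p -> C0 * enorm p `^ (- (2 * k)) <= Rf p) ->
  (* (C) *)
  (mu Omega < \int[leb]_p (Rf p)%:E)%E ->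
  (* (D) *)
  0 < C1 -> 0 <= lam ->
  (forall x0, bnd Omega x0 -> exists rho, 0 < rho /\
     forall e : set 'rV[R]_n.+1, borel e -> e `<=` eball x0 rho `&` Omega ->
       (mu (e `&` Omega) <=
        (C1 * (sup [set dist_set x (bnd Omega) | x in e]) `^ lam)%:E * leb e)%E) ->
  (* conditions on k, with K = (d+tau+1)/(tau+2) + lam/2 *)
  (let d : R := n.+1%:R in
   let K := (d + tau + 1) / (tau + 2) + lam / 2 in
   (k < 1 \/ d / 2 <= k -> k <= K) /\ (1 <= k < d / 2 -> k < K)) ->
  admissible Omega I Th ->
  (forall h, I h -> fe_solution leb mu (Th h) g Rf (uh h)) ->
  exists u : 'rV[R]_n.+1 -> R,
    [/\ gen_solution leb mu Omega g Rf u,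
        (forall v, gen_solution leb mu Omega g Rf v -> forall x, closure Omega x -> v x = u x)
      & forall delta, 0 < delta -> forall eps, 0 < eps -> exists eta, 0 < eta /\
          forall h, I h -> h < eta ->
            forall x, closure (inner_set Omega delta) x -> `|uh h x - u x| <= eps].
Proof.
move=> hleb oO O0 /bounded_set_defs bO /convex_set_defs cO gc Rf0 Rfi muO tau0 hA k0 C00 r00 hB
  mass C10 lam0 hD hk adm hI.
have [nu hnu] := exists_weight Rf0 Rfi.
have nuE : (\int[leb]_p (Rf p)%:E)%E = nu setT.
  by apply: (weight_integral hnu (N := set0)) => //.
rewrite nuE in mass.
exact: (fe_convergence hleb hnu oO cO O0 bO gc muO tau0 k0 C00 r00 C10 lam0 hA hB mass hD hk adm hI).
Qed.
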